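(* There exists a universal constant $K>0$ such that the following holds. Let $\pi$ be a bounded probability density on $\mathbb R^d$ supported by $E\subset\mathbb R^d$, a bounded and convex set with nonempty interior. Let $q$ be a proposal density and suppose that there exist $b>0$ and $\epsilon>0$ such that $q(x,y)\ge b\,\mathrm 1_{B(x,\epsilon)}(y)$ for all $(x,y)\in\mathbb R^d\times\mathbb R^d$. Let $X=(X_n)$ be the Metropolis-Hastings chain with target $\pi$ and proposal $q$, and let $\tau_A$ be the regeneration time of the associated split chain. Let $\mathcal G$ be a countable VC class of measurable functions on $E$ bounded by $U$ with characteristic $(C,v)$. Then there exists a constant $D$, depending only on $v,C,U$ and on the tails of the regeneration time, such that for all $n\ge1$, $$\mathbb E\left[\sup_{g\in\mathcal G}\left|\sum_{i=1}^n\big(g(X_i)-\pi(g)\big)\right|\right]\le D\sqrt{n\,(1\vee\log(\log(n)))}.$$ Moreover, there is $\tau>0$ depending on the tails of the regeneration time such that, for any $\delta\in(0,1)$ and any $n$ with $n/\log(n)\ge\tau^3/(U\,\mathbb E_A[\tau_A^2])$, with probability $1-\delta$, $$\sup_{g\in\mathcal G}\left|\sum_{i=1}^n\big(g(X_i)-\pi(g)\big)\right|\le KD\sqrt{n\,(1\vee\log(\log(n)))}+\max\left(\sqrt{nU^2\,\mathbb E_A[\tau_A^2]\,K\log\Big(\frac K\delta\Big)},\ \log\Big(\frac K\delta\Big)\frac{\tau^3U\log(n)}{\mathbb E_A[\tau_A]}\right).$$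
   Context: Metropolis-Hastings (MH) chain. $q$ is a nonnegative function on $\mathbb R^d\times\mathbb R^d$ with $\int q(x,y)\,dy=1$ for all $x$. Put $\rho(x,y)=\min\big(1,\frac{\pi(y)q(y,x)}{\pi(x)q(x,y)}\big)$ if $\pi(x)q(x,y)>0$ and $\rho(x,y)=1$ if $\pi(x)q(x,y)=0$. Given $X_n$, draw $Y\sim q(X_n,y)dy$ and a Bernoulli variable $B$ with parameter $\rho(X_n,Y)$; set $X_{n+1}=Y$ if $B=1$ and $X_{n+1}=X_n$ if $B=0$. $P$ is the resulting transition kernel; the chain is regarded as a chain with state space $E$ and some initial measure $\nu$ on $E$. ''$\pi$ supported by $E$'' means that $E$ is the support of the measure $\pi(y)dy$. $B(x,\epsilon)$ is the Euclidean ball of centre $x$ and radius $\epsilon$. $\pi(g)=\int g(y)\pi(y)\,dy$, and $a\vee b=\max(a,b)$; $1\vee\log\log n$ is read as $1$ when $n=1$. Regeneration time. Let $S$ be a $\Psi$-small set with $m=1$, i.e. there are $\delta_0>0$ and a probability measure $\Psi$ supported by $S$ with $P(x,B)\ge\delta_0\Psi(B)$ for all $x\in S$ and measurable $B$, and such that $\sup_{x\in S}\mathbb E_x[\tau_S]<\infty$ and $\mathbb E_\nu[\tau_S]<\infty$, where $\tau_S=\inf\{n\ge1:X_n\in S\}$. The split chain is $Z=(X_n,Y_n)$ on $E\times\{0,1\}$, where $(Y_n)$ are independent Bernoulli($\delta_0$) and: if $X_n\in S$, $Y_n=1$, then $X_{n+1}\sim\Psi$; if $X_n\in S$, $Y_n=0$,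 then $X_{n+1}\sim(1-\delta_0)^{-1}(P(X_n,\cdot)-\delta_0\Psi)$; if $X_n\notin S$, then $X_{n+1}\sim P(X_n,\cdot)$. $A=S\times\{1\}$ is an atom of $Z$, $\tau_A=\inf\{n\ge1:Z_n\in A\}$ is the regeneration time, and $\mathbb E_A$ is expectation for the split chain started in $A$. VC class. A countable class $\mathcal G$ of measurable functions is VC, bounded by $U$ with characteristic $(C,v)$ (where $v\ge1$, $C\ge(3\sqrt e)^v$), if $|g|\le U$ for all $g\in\mathcal G$ and for every probability measure $Q$ and every $0<\eta<1$, $\mathcal N(\eta U,\mathcal G,\|\cdot\|_{L_2(Q)})\le C\eta^{-v}$, where $\mathcal N(\eta,\mathcal G,d)$ is the minimal number of balls of size $\eta$ needed to cover $\mathcal G$ and $\|g\|_{L_2(Q)}=(\int g^2dQ)^{1/2}$. *)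

(* Defs.v *)
From HB Require Import structures.
From mathcomp Require Import all_boot all_order all_algebra.
From mathcomp Require Import all_classical all_reals all_analysis.

Set Implicit Arguments.
Unset Strict Implicit.
Unset Printing Implicit Defensive.

Import Order.TTheory GRing.Theory Num.Theory.
Import numFieldNormedType.Exports.

Local Open Scope classical_set_scope.
Local Open Scope ring_scope.

(* R^d is 'rV[R]_d, with the library's topology and with the sigma-algebra
   generated by the coordinates, i.e. the Borel sigma-algebra. *)
Section row_measurable.
Context (R : realType) (n : nat).

Definition row_coord (i : 'I_n) (x : 'rV[R]_n) : R := x ord0 i.

Let row_set0 : g_sigma_preimage row_coord set0.
Proof. exact: sigma_algebra0. Qed.

Let row_setC A : g_sigma_preimage row_coord A ->
  g_sigma_preimage row_coord (~` A).
Proof. exact: sigma_algebraC. Qed.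

Let row_bigcup (F : (set 'rV[R]_n)^nat) :
  (forall i, g_sigma_preimage row_coord (F i)) ->
  g_sigma_preimage row_coord (\bigcup_i F i).
Proof. exact: sigma_algebra_bigcup. Qed.

HB.instance Definition _ := @isMeasurable.Build default_measure_display
  'rV[R]_n (g_sigma_preimage row_coord) row_set0 row_setC row_bigcup.

End row_measurable.

Section lebesgue_row.
Context (R : realType).

Lemma measurable_row_coord n (i : 'I_n) :
  measurable_fun [set: 'rV[R]_n] (@row_coord R n i).
Proof.
move=> _ Y mY; rewrite setTI; apply: sub_sigma_algebra => /=.
rewrite -bigcup_seq/=; exists i => /=; first by rewrite mem_index_enum.
by exists Y => //; rewrite setTI.
Qed.

Lemma measurable_fun_row d (T : measurableType d) n (f : T -> 'rV[R]_n) :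
  (forall i, measurable_fun setT (fun x => f x ord0 i)) ->
  measurable_fun setT f.
Proof.
move=> mf _ Y mY.
suff : g_sigma_preimage (@row_coord R n) `<=` image_set_system setT f measurable.
  by move=> /(_ Y mY); rewrite /image_set_system.
apply: smallest_sub; first exact/sigma_algebra_image/sigma_algebra_measurable.
move=> A; rewrite -bigcup_seq => -[i _ [B mB <-]].
by have := mf i measurableT B mB; rewrite /image_set_system /= !setTI.
Qed.

Definition row_cons n (p : measurableTypeR R * 'rV[R]_n) : 'rV[R]_n.+1 :=
  \row_i oapp (p.2 ord0) p.1 (unlift ord0 i).

Definition row_uncons n (x : 'rV[R]_n.+1) :
    measurableTypeR R * 'rV[R]_n :=
  (x ord0 ord0, \row_i x ord0 (lift ord0 i)).

Lemma row_consK n : cancel (@row_cons n) (@row_uncons n).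
Proof.
move=> [a x]; rewrite /row_uncons /row_cons; congr pair.
  by rewrite mxE unlift_none.
by apply/rowP => i; rewrite !mxE liftK.
Qed.

Lemma row_unconsK n : cancel (@row_uncons n) (@row_cons n).
Proof.
move=> x; apply/rowP => i; rewrite /row_cons !mxE.
by case: unliftP => [j|] ->//=; rewrite mxE.
Qed.

Lemma measurable_row_cons n : measurable_fun setT (@row_cons n).
Proof.
apply: measurable_fun_row => i; rewrite /row_cons.
under eq_fun do rewrite mxE.
case: (unliftP ord0 i) => [j|] _ /=; last exact: measurable_fst.
exact: (measurableT_comp (@measurable_row_coord n j) measurable_snd).
Qed.

Lemma measurable_row_uncons n : measurable_fun setT (@row_uncons n).
Proof.
apply/measurable_fun_pairP; split => /=.
  exact: (@measurable_row_coord n.+1 ord0).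
apply: measurable_fun_row => i /=.
under eq_fun do rewrite mxE.
exact: (@measurable_row_coord n.+1 (lift ord0 i)).
Qed.

Section step.
Context (n : nat) (m : {sigma_finite_measure set 'rV[R]_n -> \bar R}).

Definition lebesgue_row_step : set 'rV[R]_n.+1 -> \bar R :=
  pushforward (lebesgue_measure \x m)%E (@row_cons n).

Let step0 : lebesgue_row_step set0 = 0%E.
Proof. by rewrite /lebesgue_row_step /pushforward preimage_set0 measure0. Qed.

Let step_ge0 A : (0 <= lebesgue_row_step A)%E.
Proof. by rewrite /lebesgue_row_step /pushforward measure_ge0. Qed.

Let step_sigma_additive : semi_sigma_additive lebesgue_row_step.
Proof.
move=> F mF tF mUF; rewrite /lebesgue_row_step /pushforward preimage_bigcup.
have mpre B : measurable B -> measurable (@row_cons n @^-1` B).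
  by move=> mB; rewrite -[X in measurable X]setTI; exact: measurable_row_cons.
apply: measure_semi_sigma_additive.
- by move=> i; exact: mpre.
- apply/trivIsetP => i j _ _ ij; rewrite -preimage_setI.
  by move/trivIsetP : tF => /(_ _ _ _ _ ij) ->//; rewrite preimage_set0.
- by rewrite -preimage_bigcup; exact: mpre.
Qed.

HB.instance Definition _ := isMeasure.Build _ _ _ lebesgue_row_step
  step0 step_ge0 step_sigma_additive.

Let step_sigma_finite : sigma_finite setT lebesgue_row_step.
Proof.
have /sigma_finiteP[F [TF ndF Foo]] := sigma_finiteT (@lebesgue_measure R).
have /sigma_finiteP[G [TG ndG Goo]] := sigma_finiteT m.
exists (fun k => @row_uncons n @^-1` (F k `*` G k)).
  apply/esym; rewrite -subTset => x _.
  have [i _ Fi] : (\bigcup_k F k) (row_uncons x).1 by rewrite -TF.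
  have [j _ Gj] : (\bigcup_k G k) (row_uncons x).2 by rewrite -TG.
  exists (maxn i j) => //; split.
    by move: Fi; exact/subsetPset/ndF/leq_maxl.
  by move: Gj; exact/subsetPset/ndG/leq_maxr.
move=> k; have [mF Fk] := Foo k; have [mG Gk] := Goo k; split.
  rewrite -[X in measurable X]setTI; apply: measurable_row_uncons => //.
  exact: measurableX.
rewrite /lebesgue_row_step /pushforward -comp_preimage.
have -> : @row_uncons n \o @row_cons n = id by apply/funext; exact: row_consK.
rewrite preimage_id.
by rewrite product_measure1E// lte_mul_pinfty// ge0_fin_numE.
Qed.

HB.instance Definition _ := Measure_isSigmaFinite.Build _ _ _
  lebesgue_row_step step_sigma_finite.

End step.

Fixpoint lebesgue_row n : {sigma_finite_measure set 'rV[R]_n -> \bar R} :=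
  if n is n'.+1 then lebesgue_row_step (lebesgue_row n') else \d_(0 : 'rV[R]_0).

End lebesgue_row.

Lemma lebesgue_row_box (R : realType) n (a b : 'rV[R]_n) :
  (forall i, a ord0 i <= b ord0 i) ->
  lebesgue_row R n [set x | forall i, x ord0 i \in `]a ord0 i, b ord0 i]] =
  (\prod_i (b ord0 i - a ord0 i))%:E.
Proof.
elim: n a b => [|n IHn] a b ab.
  by rewrite big_ord0 /= diracE mem_set// => -[].
pose a' : 'rV[R]_n := \row_i a ord0 (lift ord0 i).
pose b' : 'rV[R]_n := \row_i b ord0 (lift ord0 i).
pose B' : set 'rV[R]_n := [set x | forall i, x ord0 i \in `]a' ord0 i, b' ord0 i]].
have mB' : measurable B'.
  rewrite [B'](_ : _ = \bigcap_(i in [set: 'I_n])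
      (@row_coord R n i @^-1` `]a' ord0 i, b' ord0 i]%classic)); last first.
    by apply/seteqP; split => x /= h i => [_|]; exact: h.
  apply: fin_bigcap_measurable => // i _.
  by rewrite -[X in measurable X]setTI; exact: measurable_row_coord.
rewrite /= /lebesgue_row_step /pushforward.
rewrite (_ : _ @^-1` _ = `]a ord0 ord0, b ord0 ord0]%classic `*` B'); last first.
  apply/seteqP; split => -[t x] /=.
    move=> h; split.
      by have := h ord0; rewrite mxE unlift_none.
    by move=> i; have := h (lift ord0 i); rewrite !mxE liftK.
  move=> [h1 h2] i; rewrite mxE; case: (unliftP ord0 i) => [j|] -> //=.
  by have := h2 j; rewrite !mxE.
rewrite product_measure1E// IHn; last by move=> i; rewrite !mxE.
rewrite big_ord_recl EFinM; congr (_ * _)%E.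
  rewrite [LHS]lebesgue_measure_itv/= lte_fin; case: ltP => [_|ba]; first by rewrite EFinB.
  by rewrite (le_anti (introT andP (conj ba (ab ord0)))) subrr.
by congr EFin; apply: eq_bigr => i _; rewrite !mxE.
Qed.

Section markov_chain.
Context (R : realType) (d dO : measure_display) (T : measurableType d)
  (Omega : measurableType dO).

(* The last clause is P(X_{n+1} \in A | X_0, ..., X_n) = kern X_n A, tested on
   the events F of sigma(X_0, ..., X_n). *)
Definition markov_chain (P : probability Omega R) (kern : T -> set T -> \bar R)
    (mu : set T -> \bar R) (X : nat -> Omega -> T) : Prop :=
  [/\ forall n, measurable_fun setT (X n),
      forall A, measurable A -> P (X 0 @^-1` A) = mu A &
      forall n F A, g_sigma_preimage (fun i : 'I_n.+1 => X i) F ->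
        measurable A ->
        P (F `&` X n.+1 @^-1` A) = (\int[P]_(w in F) kern (X n w) A)%E].

(* Pr mu is the law usually written P_mu; P_x is Pr \d_x. *)
Definition markov_family (kern : T -> set T -> \bar R)
    (X : nat -> Omega -> T) (Pr : probability T R -> probability Omega R) :
    Prop :=
  forall mu : probability T R, markov_chain (Pr mu) kern mu X.

(* Extended-real valued: +oo when S is never visited after time 0. *)
Definition return_time (X : nat -> Omega -> T) (S : set T) (w : Omega) :
    \bar R :=
  ereal_inf [set (n%:R)%:E | n in [set n | (0 < n)%N /\ S (X n w)]].

Definition tail (P : probability Omega R) (Y : Omega -> \bar R) (n : nat) :
    \bar R :=
  P [set w | ((n%:R)%:E < Y w)%E].

Definition small_set (kern : T -> set T -> \bar R) (S : set T) (delta0 : R)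
    (Psi : probability T R) : Prop :=
  [/\ measurable S, 0 < delta0, Psi S = 1%E &
      forall x B, S x -> measurable B -> (delta0%:E * Psi B <= kern x B)%E].

End markov_chain.

(* Product of the law of X_{n+1} given (X_n, Y_n) = z and of the Bernoulli
   law of Y_{n+1}. If delta0 = 1, the residual law is the junk value 0, but it
   is then used with probability 0. *)
Definition split_kernel (R : realType) (d : measure_display)
    (T : measurableType d) (kern : T -> set T -> \bar R) (S : set T)
    (delta0 : R) (Psi : probability T R) (z : T * bool) :
    set (T * bool) -> \bar R :=
  ((fun A => if z.1 \in S then
      if z.2 then Psi A
      else ((1 - delta0)^-1)%:E * (kern z.1 A - delta0%:E * Psi A)
    else kern z.1 A) \x^ bernoulli_prob delta0)%E.

Section metropolis_hastings.
Context (R : realType) (d : nat).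
Local Notation Rd := 'rV[R]_d.

Definition eball (x : Rd) (eps : R) : set Rd :=
  [set y | Num.sqrt (\sum_(i < d) (y ord0 i - x ord0 i) ^+ 2) < eps].

Definition density (p : Rd -> R) : Prop :=
  [/\ measurable_fun setT p, forall x, 0 <= p x &
      (\int[lebesgue_row R d]_x (p x)%:E = 1)%E].

Definition proposal (q : Rd -> Rd -> R) : Prop :=
  [/\ measurable_fun setT (fun z : Rd * Rd => q z.1 z.2),
      forall x y, 0 <= q x y &
      forall x, (\int[lebesgue_row R d]_y (q x y)%:E = 1)%E].

Definition density_support (p : Rd -> R) : set Rd :=
  [set x | forall V, open V -> V x ->
    (0 < \int[lebesgue_row R d]_(y in V) (p y)%:E)%E].

Definition mh_accept (p : Rd -> R) (q : Rd -> Rd -> R) (x y : Rd) : R :=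
  if 0 < p x * q x y then Num.min 1 (p y * q y x / (p x * q x y)) else 1.

(* the law of "if B then Y else x" when Y ~ q(x,y)dy and, given Y, B is
   Bernoulli with parameter mh_accept x Y *)
Definition mh_kernel (p : Rd -> R) (q : Rd -> Rd -> R) (x : Rd) (A : set Rd) :
    \bar R :=
  (\int[lebesgue_row R d]_y
     ((q x y)%:E * bernoulli_prob (mh_accept p q x y)
                     [set B : bool | A (if B then y else x)]))%E.

(* Functions on E are represented by functions on R^d whose values outside E
   are irrelevant. *)
Definition mean_on (E : set Rd) (p g : Rd -> R) : R :=
  \int[lebesgue_row R d]_(y in E) (g y * p y).

(* The chain stays in E almost surely, so that (g \_ E) (X i w) is g (X i w);
   restricting g to E keeps this function of w measurable. *)
Definition sup_deviation (Omega : Type) (E : set Rd) (p : Rd -> R)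
    (G : set (Rd -> R)) (X : nat -> Omega -> Rd) (n : nat) (w : Omega) :
    \bar R :=
  ereal_sup [set (`|\sum_(1 <= i < n.+1) ((g \_ E) (X i w) - mean_on E p g)|)%:E
            | g in G].

End metropolis_hastings.

Section vc_class.
Context (R : realType) (d : measure_display) (T : measurableType d).

(* Closed balls, with centres in Z. *)
Definition covering_number (F : Type) (dist : F -> F -> \bar R) (Z G : set F)
    (r : R) : \bar R :=
  ereal_inf [set (k%:R)%:E | k in [set k : nat | exists c : 'I_k -> F,
    (forall i, Z (c i)) /\
    (forall g, G g -> exists i, (dist g (c i) <= r%:E)%E)]].

Definition L2_dist (Q : probability T R) (E : set T) (f g : T -> R) : \bar R :=
  'N[Q]_2%:E[EFin \o ((f \- g)%R \_ E)]%E.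

(* Centres may be any measurable functions, not only members of G; with the
   bound required for every eta in ]0, 1[ of the form C * eta `^ (- v), open and
   closed balls give the same condition. *)
Definition vc_class (E : set T) (G : set (T -> R)) (U C v : R) : Prop :=
  [/\ countable G,
      forall g, G g -> measurable_fun E g /\ (forall x, E x -> `|g x| <= U),
      1 <= v, (3 * Num.sqrt (expR 1)) `^ v <= C &
      forall Q : probability T R, Q E = 1%E ->
        forall eta : R, 0 < eta < 1 ->
        (covering_number (L2_dist Q E) [set f | measurable_fun E f] G (eta * U)
           <= (C * eta `^ (- v))%:E)%E].

End vc_class.

(* Main.v *)
(* The blocks of the split chain between successive visits to the atom are i.i.d.
   and centred (Kac's formula). With h_m(s) the mean, for the chain started from
   the atom, of the norm of s + S_m, where S_m collects the centred sums over
   finitely many members of the class, regeneration at the first block xi gives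
   h_m(s) <= E h_{m-1}(s + xi) + error; symmetrizing one block at a time bounds
   h_m(0) by a Rademacher average of m blocks, which chaining over the VC class
   bounds by a multiple of U sqrt(m E tau^2). The same recursion controls the
   exponential moment: conditionally on the past, h varies by at most a multiple
   of U tau over one block, so that e^x <= 1 + x + x^2 e^|x| yields a Bernstein
   bound.
   Geometric tails of the regeneration time come from a uniform minorization of
   a power of the Metropolis-Hastings kernel by pi on E (chains of balls along
   segments of the convex set E) and from pi(S) > 0, which recurrence forces. *)

From HB Require Import structures.
Require Import Defs.
From mathcomp Require Import all_boot all_order all_algebra.
From mathcomp Require Import all_classical all_reals all_analysis.
From mathcomp Require Import finmap measurable_realfun.
From mathcomp Require Import ring lra zify.

Set Implicit Arguments.
Unset Strict Implicit.
Unset Printing Implicit Defensive.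

Import Order.TTheory GRing.Theory Num.Theory.
Import numFieldNormedType.Exports.

Local Open Scope classical_set_scope.
Local Open Scope ring_scope.

(** * Markov chains and additive functionals *)

(** The number of blocks completed by time n is random and depends on the blocks. The recursion
    therefore runs on the time horizon: a block lasts at least one step, so at most m blocks fit in
    m steps, and the symmetrized quantities increase with the number of blocks, which replaces the
    actual count by m. Independence is never stated for a sequence of blocks: a regeneration is one
    use of the Markov property, a symmetrization one use of an integral operator, and of convexity
    only what this operator preserves is kept. The constants may depend on the chain only through
    the tails of the regeneration time. The minorization constants thus serve only to show that a
    geometric bound exists; [D] and [tau] are computed from a bound [c * rho ^+ n] selected from the
    two tail functions. In the deviation bound the second moment stays exact, since a small
    exponential tilt at most doubles it. The chain and its split version live on different
    probability spaces; only laws of partial sums are transferred. A countable class enters through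
    finite subclasses, with sums in row vectors and a monotone limit. *)

Section ge0_integral_everywhere.
Context d (T : measurableType d) (R : realType) (mu : {measure set T -> \bar R}).
Variables (D : set T) (mD : measurable D).
Local Open Scope ereal_scope.

Lemma fin_num_addeI (a x y : \bar R) : a \is a fin_num -> a + x = a + y -> x = y.
Proof.
by case: a => // a _; move: x y => [x| |] [y| |]//= [] /addrI ->.
Qed.

Lemma ge0_intZl (f : T -> \bar R) (c : R) : measurable_fun setT f ->
  (forall x, 0 <= f x) -> (0 <= c)%R ->
  \int[mu]_(x in D) (c%:E * f x) = c%:E * \int[mu]_(x in D) f x.
Proof.
by move=> mf f0 c0; rewrite ge0_integralZl_EFin//; exact: measurable_funTS.
Qed.

Lemma ge0_intD (f g : T -> \bar R) : measurable_fun setT f ->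
  (forall x, 0 <= f x) -> measurable_fun setT g -> (forall x, 0 <= g x) ->
  \int[mu]_(x in D) (f x + g x) =
  \int[mu]_(x in D) f x + \int[mu]_(x in D) g x.
Proof.
by move=> mf f0 mg g0; rewrite ge0_integralD//; exact: measurable_funTS.
Qed.

Lemma ge0_int_le (f g : T -> \bar R) : measurable_fun setT f ->
  measurable_fun setT g -> (forall x, 0 <= f x) ->
  (forall x, f x <= g x) ->
  \int[mu]_(x in D) f x <= \int[mu]_(x in D) g x.
Proof.
by move=> mf mg f0 fg; apply: ge0_le_integral => //; exact: measurable_funTS.
Qed.

Lemma ge0_int_limn (f_ : (T -> \bar R)^nat) :
  (forall n, measurable_fun setT (f_ n)) -> (forall n x, 0 <= f_ n x) ->
  (forall x, nondecreasing_seq (f_ ^~ x)) ->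
  \int[mu]_(x in D) limn (f_ ^~ x) = limn (fun n => \int[mu]_(x in D) f_ n x).
Proof.
move=> mf f0 nd; rewrite monotone_convergence//.
by move=> n; exact: measurable_funTS.
Qed.

End ge0_integral_everywhere.

Section ge0_induction.
Context d (T : measurableType d) (R : realType).
Import HBNNSimple.

(** The standard machine: a nonnegative measurable function is an increasing limit of simple
    functions, and these are finite nonnegative combinations of indicators. *)
Lemma ge0_measurable_fun_ind (Q : (T -> \bar R) -> Prop) :
  (forall A, measurable A -> Q (EFin \o \1_A)) ->
  (forall (k : R) (f : T -> \bar R), 0 <= k -> measurable_fun setT f ->
     (forall x, 0 <= f x)%E -> Q f -> Q (fun x => k%:E * f x)%E) ->
  (forall f g : T -> \bar R, measurable_fun setT f -> (forall x, 0 <= f x)%E ->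
     measurable_fun setT g -> (forall x, 0 <= g x)%E ->
     Q f -> Q g -> Q (fun x => f x + g x)%E) ->
  (forall f_ : (T -> \bar R)^nat, (forall n, measurable_fun setT (f_ n)) ->
     (forall n x, 0 <= f_ n x)%E ->
     (forall x, nondecreasing_seq (f_ ^~ x)) -> (forall n, Q (f_ n)) ->
     Q (fun x => limn (f_ ^~ x))) ->
  forall f, measurable_fun setT f -> (forall x, 0 <= f x)%E -> Q f.
Proof.
move=> Qind Qscale Qadd Qlim f mf f0.
pose f_ := nnsfun_approx measurableT mf.
have -> : f = (fun x => limn ((fun n => EFin \o f_ n) ^~ x)).
  apply/funext => x; apply/esym/cvg_lim => //=.
  exact: (cvg_nnsfun_approx measurableT mf (fun x _ => f0 x)).
apply: Qlim.
- by move=> n; exact/measurable_EFinP.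
- by move=> n x /=; rewrite lee_fin.
- by move=> x m n mn; rewrite lee_fin; exact/lefP/nd_nnsfun_approx.
move=> n; move: (f_ n) => {f_}g.
have -> : EFin \o g = (fun x => \sum_(y \in range g)
    (y%:E * (\1_(g @^-1` [set y]) x)%:E))%E.
  by apply/funext => x /=; rewrite fimfunE -fsumEFin//.
have -> : (fun x => \sum_(y \in range g) (y%:E * (\1_(g @^-1` [set y]) x)%:E))%E =
    (fun x => \sum_(y <- fset_set (range g)) (y%:E * (\1_(g @^-1` [set y]) x)%:E))%E.
  by apply/funext => x; rewrite fsbig_finite.
have : forall y, y \in finmap.enum_fset (fset_set (range g)) -> 0 <= y.
  move=> y; change (y \in fset_set (range g) -> 0 <= y).
  by rewrite in_fset_set// => /set_mem[x _ <-].
elim: (finmap.enum_fset (fset_set (range g))) => [|y s IH] ys.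
  rewrite (_ : (fun _ => _) = (fun x => 0%:E * (\1_(set0 : set T) x)%:E)%E); last first.
    by apply/funext => x; rewrite big_nil mul0e.
  apply: Qscale => //; first exact/measurable_EFinP/measurable_indic.
  exact: (Qind set0).
have mpre : measurable (g @^-1` [set y]) by [].
rewrite (_ : (fun _ => _) = (fun x => y%:E * (\1_(g @^-1` [set y]) x)%:E +
   \sum_(y <- s) (y%:E * (\1_(g @^-1` [set y]) x)%:E))%E); last first.
  by apply/funext => x; rewrite big_cons.
have y0 : 0 <= y by apply: ys; rewrite mem_head.
have s0 z : z \in s -> 0 <= z by move=> zs; apply: ys; rewrite in_cons zs orbT.
apply: Qadd.
- by apply: measurable_funeM; exact/measurable_EFinP/measurable_indic.
- by move=> x; rewrite lee_fin mulr_ge0.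
- by apply: emeasurable_sum => z; apply: measurable_funeM; exact/measurable_EFinP/measurable_indic.
- by move=> x; rewrite big_seq sume_ge0// => z zs; rewrite lee_fin mulr_ge0// s0.
- apply: Qscale => //; first exact/measurable_EFinP/measurable_indic.
  exact: Qind.
- exact: IH.
Qed.

End ge0_induction.

(** * Histories and the Markov property *)

Section history.
Context d dO (T : measurableType d) (Omega : measurableType dO).
Variable X : nat -> Omega -> T.

(** A copy of [Omega] carrying the sigma-algebra of [X 0, ..., X n]: being determined by the past
    becomes measurability on this type. *)
Definition hist n := g_sigma_algebraType
  (\big[setU/set0]_(i < n.+1) preimage_set_system setT (X i) measurable).

Lemma measurable_hist n i : (i <= n)%N -> measurable_fun setT (X i : hist n -> T).
Proof.
move=> ilen _ B mB; rewrite setTI; apply: sub_sigma_algebra.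
rewrite -bigcup_seq/=; exists (inord i) => /=; first by rewrite mem_index_enum.
by exists B => //; rewrite setTI inordK.
Qed.

Lemma hist_sub n m (A : set Omega) : (n <= m)%N ->
  measurable (A : set (hist n)) -> measurable (A : set (hist m)).
Proof.
move=> nm; apply: smallest_sub.
  exact: sigma_algebra_measurable.
move=> B; rewrite -bigcup_seq => -[i _ [C mC <-]].
have im : (i <= m)%N by rewrite (leq_trans _ nm)// -ltnS.
exact: (@measurable_hist m i im measurableT C mC).
Qed.

Lemma hist_measurable_fun n m d' (V : measurableType d') (Y : Omega -> V) :
  (n <= m)%N ->
  measurable_fun setT (Y : hist n -> V) -> measurable_fun setT (Y : hist m -> V).
Proof. by move=> nm mY _ B mB; apply: (hist_sub nm); exact: mY. Qed.

Lemma measurable_of_hist n (A : set Omega) :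
  (forall i, measurable_fun setT (X i)) ->
  measurable (A : set (hist n)) -> measurable A.
Proof.
move=> mX; apply: smallest_sub; first exact: sigma_algebra_measurable.
move=> B; rewrite -bigcup_seq => -[i _ [C mC <-]].
exact: mX.
Qed.

Lemma measurable_fun_of_hist n d' (V : measurableType d') (Y : Omega -> V) :
  (forall i, measurable_fun setT (X i)) ->
  measurable_fun setT (Y : hist n -> V) -> measurable_fun setT Y.
Proof.
by move=> mX mY _ B mB; apply: (measurable_of_hist mX); exact: mY.
Qed.

End history.

Section kernel_precomp.
Context d d1 d2 (T0 : measurableType d) (T1 : measurableType d1)
  (T2 : measurableType d2) (R : realType).
Variables (k : R.-fker T1 ~> T2) (g : T0 -> T1).
Hypothesis mg : measurable_fun setT g.

(** The proof [mg] is an explicit argument so that the kernel structure can be attached to the term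
    [kprecomp mg]. *)
Definition kprecomp (mg : measurable_fun setT g) (x : T0) : {measure set T2 -> \bar R} := k (g x).

Let mkprecomp U : measurable U -> measurable_fun setT (kprecomp mg ^~ U).
Proof. by move=> mU; exact: (measurableT_comp (measurable_kernel k U mU)). Qed.

HB.instance Definition _ := isKernel.Build _ _ _ _ _ (kprecomp mg) mkprecomp.

Let kprecomp_uub : measure_fam_uub (kprecomp mg).
Proof. by have [r kr] := measure_uub k; exists r => x; exact: kr. Qed.

HB.instance Definition _ := Kernel_isFinite.Build _ _ _ _ R (kprecomp mg) kprecomp_uub.

Lemma measurable_integral_kernel_comp (f : T0 * T2 -> \bar R) :
  measurable_fun setT f -> (forall z, 0 <= f z)%E ->
  measurable_fun setT (fun x => \int[k (g x)]_y f (x, y))%E.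
Proof. by move=> mf f0; exact: (@measurable_kfcomp _ _ _ _ _ (kprecomp mg) f mf f0). Qed.

End kernel_precomp.

Section markov_property.
Context (R : realType) (d dO : measure_display) (T : measurableType d)
  (Omega : measurableType dO).
Variables (P : probability Omega R) (k : R.-fker T ~> T)
  (mu : set T -> \bar R) (X : nat -> Omega -> T).
Hypothesis MC : markov_chain P (fun x => k x : set T -> \bar R) mu X.

Let mX n : measurable_fun setT (X n). Proof. by case: MC. Qed.

Section joint.
Context dV (V : measurableType dV) (n : nat) (F : set Omega) (Y : Omega -> V).
Hypotheses (mF : measurable (F : set (hist X n)))
  (mY : measurable_fun setT (Y : hist X n -> V)).

Let mF' : measurable F. Proof. exact: (measurable_of_hist mX mF). Qed.
Let mY' : measurable_fun setT Y. Proof. exact: (measurable_fun_of_hist mX mY). Qed.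

(** For a rectangle the condition on [Y] is absorbed into the past event [F], which leaves the
    definition of a Markov chain; Dynkin's theorem extends this to all measurable sets of the
    product. *)
Let markov_joint_set C : measurable C ->
  (\int[P]_(w in F) k (X n w) (xsection C (Y w)) =
   P (F `&` (fun w => (Y w, X n.+1 w)) @^-1` C))%E.
Proof.
have mYX : measurable_fun setT (fun w => (Y w, X n.+1 w)).
  exact: measurable_fun_pair.
have mk C' : measurable C' -> measurable_fun setT (fun w => k (X n w) (xsection C' (Y w))).
  move=> mC.
  have := @measurable_integral_kernel_comp _ _ _ (T * V)%type T T R k fst measurable_fst
    (fun z => (\1_C' (z.1.2, z.2))%:E).
  move=> /(_ _ _)/=.
  have m1 : measurable_fun setT (fun z : (T * V) * T => (\1_C' (z.1.2, z.2))%:E : \bar R).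
    apply/measurable_EFinP; apply: (measurableT_comp (measurable_indic mC)).
    apply: measurable_fun_pair => //=.
    exact: (measurableT_comp measurable_snd measurable_fst).
  move=> /(_ m1 (fun z => ltac:(by rewrite lee_fin)))m2.
  have := measurableT_comp m2 (measurable_fun_pair (mX n) mY').
  apply: eq_measurable_fun => w _ /=.
  rewrite (_ : (fun y => _) = EFin \o \1_(xsection C' (Y w))); last first.
    by apply/funext => y /=; rewrite !indicE mem_xsection.
  by rewrite integral_indic ?setIT//; exact: measurable_xsection.
have PF : (P F < +oo)%E by rewrite (le_lt_trans (probability_le1 P mF')) ?ltry.
have mI C' : measurable C' -> measurable (F `&` (fun w => (Y w, X n.+1 w)) @^-1` C').
  by move=> mC'; apply: measurableI => //; rewrite -[X in measurable X]setTI; exact: mYX.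
move=> mC.
have GE : @measurable _ (V * T)%type = <<s [set A `*` B | A in measurable & B in measurable] >>.
  exact: measurable_prod_measurableType.
apply: (@dynkin_induction _ (V * T)%type [set A `*` B | A in measurable & B in measurable]
   (fun C => (\int[P]_(w in F) k (X n w) (xsection C (Y w)) =
   P (F `&` (fun w => (Y w, X n.+1 w)) @^-1` C))%E)) => //.
- move=> A B [A1 mA1 [A2 mA2 <-]] [B1 mB1 [B2 mB2 <-]].
  exists (A1 `&` B1); first exact: measurableI.
  by exists (A2 `&` B2); [exact: measurableI|rewrite setXI].
- under eq_integral do rewrite xsectionE preimage_setT.
  case: MC => _ _ /(_ n F setT mF measurableT) <-.
  by congr (P _); rewrite !preimage_setT.
- move=> _ [A mA [B mB <-]].
  transitivity (\int[P]_(w in F) ((fun w => k (X n w) B) \_ (Y @^-1` A)) w)%E.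
    apply: eq_integral => w _; rewrite patchE.
    have [YA|YA] := boolP (w \in Y @^-1` A).
      by rewrite in_xsectionX// inE; move: YA; rewrite inE.
    by rewrite notin_xsectionX ?measure0.
  rewrite -integral_mkcondr.
  case: MC => _ _ MCn; rewrite -MCn//.
    by congr (P _); apply/seteqP; split => w /=; rewrite /setX /=; tauto.
  have mA' : measurable (Y @^-1` A : set (hist X n)).
    by rewrite -[X in measurable X]setTI; exact: mY.
  exact: (measurableI _ _ mF mA').
(* Complements: the identities for [C'] and its complement add up to the one for the whole space,
   and the term of [C'] is finite, so it cancels. *)
- move=> C' mC' IH.
  have fC' : P (F `&` (fun w => (Y w, X n.+1 w)) @^-1` C') \is a fin_num.
    by rewrite fin_num_measure//; exact: mI.
  apply: (fin_num_addeI fC'); rewrite -{1}IH -ge0_integralD//=; last 2 first.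
    by apply: measurable_funTS; exact: mk.
    by apply: measurable_funTS; apply: mk; exact: measurableC.
  rewrite -measureU; [|exact: mI|by apply: mI; exact: measurableC|]; last first.
    by rewrite -setIIr -preimage_setI setICr preimage_set0 setI0.
  rewrite -setIUr -preimage_setU setUCr preimage_setT setIT.
  transitivity (\int[P]_(w in F) k (X n w) setT)%E; last first.
    by case: MC => _ _ /(_ n F setT mF measurableT); rewrite preimage_setT setIT => H; exact/esym/H.
  apply: eq_integral => w _; rewrite -measureU.
  - by rewrite !xsectionE preimage_setC setUCr.
  - exact: measurable_xsection.
  - by apply: measurable_xsection; exact: measurableC.
  - by rewrite !xsectionE preimage_setC setICr.
- move=> C_ mC_ tC IH.
  have tpre (Z : Type) (h : Z -> V * T) : trivIset setT (fun i => h @^-1` C_ i).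
    apply/trivIsetP => i j _ _ ij; rewrite -preimage_setI.
    by move/trivIsetP : tC => /(_ i j Logic.I Logic.I ij) ->; rewrite preimage_set0.
  transitivity (\int[P]_(w in F) \sum_(i <oo) k (X n w) (xsection (C_ i) (Y w)))%E.
    apply: eq_integral => w _; rewrite xsection_bigcup measure_semi_bigcup//.
    - by move=> i; exact: measurable_xsection.
    - by under eq_fun do rewrite xsectionE; exact: tpre.
    - by apply: bigcup_measurable => i _; exact: measurable_xsection.
  rewrite integral_nneseries//; last by move=> i; apply: measurable_funTS; exact: mk.
  rewrite preimage_bigcup setI_bigcupr measure_semi_bigcup//.
  - by apply: eq_eseriesr => i _.
  - by move=> i; exact: mI.
  - apply/trivIsetP => i j _ _ ij; rewrite setIACA setIid.
    by move/trivIsetP : (tpre _ (fun w => (Y w, X n.+1 w))) => /(_ i j Logic.I Logic.I ij) ->; rewrite setI0.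
  - by apply: bigcup_measurable => i _; exact: mI.
- by rewrite -GE.
Qed.

(** The freezing form of the Markov property: [Y], known at time [n], is a constant while the next
    state is averaged. It is used with [Y] the current state or the running sum. *)
Lemma markov_joint (f : V * T -> \bar R) : measurable_fun setT f ->
  (forall z, 0 <= f z)%E ->
  (\int[P]_(w in F) f (Y w, X n.+1 w) =
   \int[P]_(w in F) \int[k (X n w)]_x f (Y w, x))%E.
Proof.
have mYX : measurable_fun setT (fun w => (Y w, X n.+1 w)).
  exact: measurable_fun_pair.
have mYf (g : V * T -> \bar R) : measurable_fun setT g -> measurable_fun setT (fun w => g (Y w, X n.+1 w)).
  by move=> mg; exact: (measurableT_comp mg mYX).
have mfY (g : V * T -> \bar R) : measurable_fun setT g -> (forall z, 0 <= g z)%E ->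
    measurable_fun setT (fun w => \int[k (X n w)]_x g (Y w, x))%E.
  move=> mg g0.
  apply: (@measurable_integral_kernel_comp _ _ _ _ _ _ _ k (X n) (mX n) (fun z => g (Y z.1, z.2))) => //.
  apply: (measurableT_comp mg); apply: measurable_fun_pair => //=.
  exact: (measurableT_comp mY' measurable_fst).
have mgx (g : V * T -> \bar R) (y : V) : measurable_fun setT g -> measurable_fun setT (fun x : T => g (y, x)).
  by move=> mg; exact: measurableT_comp.
move: f; apply: ge0_measurable_fun_ind.
- move=> C mC.
  transitivity (\int[P]_(w in F) (\1_((fun w => (Y w, X n.+1 w)) @^-1` C) w)%:E)%E => //.
  rewrite integral_indic//; last by rewrite -[X in measurable X]setTI; exact: mYX.
  rewrite setIC; transitivity (\int[P]_(w in F) k (X n w) (xsection C (Y w)))%E.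
    exact/esym/markov_joint_set.
  apply: eq_integral => w _.
  rewrite (_ : (fun x => _) = EFin \o \1_(xsection C (Y w))); last first.
    by apply/funext => y /=; rewrite !indicE mem_xsection.
  by rewrite integral_indic ?setIT//; exact: measurable_xsection.
- move=> c f c0 mf f0 IH.
  rewrite (ge0_intZl P mF' (mYf f mf) (fun w => f0 _) c0) IH.
  rewrite -(ge0_intZl P mF' (mfY f mf f0) (fun w => integral_ge0 _ (fun x _ => f0 _)) c0).
  by apply: eq_integral => w _; rewrite (ge0_intZl _ measurableT (mgx f _ mf) (fun x => f0 _) c0).
- move=> f g mf f0 mg g0 IHf IHg.
  rewrite (ge0_intD P mF' (mYf f mf) (fun w => f0 _) (mYf g mg) (fun w => g0 _)) IHf IHg.
  rewrite -(ge0_intD P mF' (mfY f mf f0) (fun w => integral_ge0 _ (fun x _ => f0 _))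
    (mfY g mg g0) (fun w => integral_ge0 _ (fun x _ => g0 _))).
  by apply: eq_integral => w _;
    rewrite (ge0_intD _ measurableT (mgx f _ mf) (fun x => f0 _) (mgx g _ mg) (fun x => g0 _)).
- move=> f_ mf f0 nd IH.
  rewrite (ge0_int_limn P mF' (fun m => mYf (f_ m) (mf m)) (fun m w => f0 m _) (fun w => nd _)).
  transitivity (\int[P]_(w in F) limn (fun m => \int[k (X n w)]_x f_ m (Y w, x)))%E; last first.
    by apply: eq_integral => w _;
      rewrite (ge0_int_limn _ measurableT (fun m => mgx (f_ m) _ (mf m)) (fun m x => f0 m _) (fun x => nd _)).
  rewrite (ge0_int_limn P mF' (fun m => mfY (f_ m) (mf m) (f0 m))
     (fun m w => integral_ge0 _ (fun x _ => f0 m _))).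
    by congr (limn _); apply/funext => m; exact: IH.
  move=> w m1 m2 m12; apply: (ge0_int_le _ measurableT (mgx _ _ (mf _)) (mgx _ _ (mf _)) (fun x => f0 _ _)).
  by move=> x; exact: nd.
Qed.

End joint.

(* Iterates of [kop] are taboo expectations: the chain has to stay in [A]. *)
Definition kop (A : set T) (f : T -> \bar R) (x : T) : \bar R :=
  (\int[k x]_(y in A) f y)%E.

Lemma measurable_kop A f : measurable A -> measurable_fun setT f ->
  (forall x, 0 <= f x)%E -> measurable_fun setT (kop A f).
Proof.
move=> mA mf f0; rewrite /kop.
under eq_fun do rewrite integral_mkcond.
apply: (measurable_fun_integral_kernel (measurable_kernel k)).
  by move=> y; rewrite patchE; case: ifP.
exact: (measurable_restrictT f mA).1 (measurable_funTS mf).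
Qed.

Lemma kop_ge0 A f : (forall x, 0 <= f x)%E -> forall x, (0 <= kop A f x)%E.
Proof. by move=> f0 x; exact: integral_ge0. Qed.

Lemma iter_kop_ge0 A f n : (forall x, 0 <= f x)%E -> forall x, (0 <= iter n (kop A) f x)%E.
Proof. by move=> f0; elim: n => [//|n IH] /= x; exact: kop_ge0. Qed.

Lemma measurable_iter_kop A f n : measurable A -> measurable_fun setT f ->
  (forall x, 0 <= f x)%E -> measurable_fun setT (iter n (kop A) f).
Proof.
move=> mA mf f0; elim: n => [//|n IH] /=; apply: measurable_kop => //.
exact: iter_kop_ge0.
Qed.

(** The strict lower bound leaves time [m] free, as return times ignore time 0. *)
Definition stays (A : set T) (m n : nat) : set Omega :=
  [set w | forall i, (m < i <= n)%N -> A (X i w)].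

Lemma stays0 A n : stays A n n = setT.
Proof.
by apply/seteqP; split => w //= _ i /andP[ni /(leq_trans ni)]; rewrite ltnn.
Qed.

Lemma staysS A m n : (m <= n)%N -> stays A m n.+1 = stays A m n `&` X n.+1 @^-1` A.
Proof.
move=> mn; apply/seteqP; split => w /=.
  move=> h; split => [i /andP[mi ilen]|]; apply: h; rewrite ?mi ?ltnS ?leqnn ?andbT//.
  exact: leqW.
move=> [h1 h2] i /andP[mi]; rewrite leq_eqVlt => /orP[/eqP ->//|ilen].
by apply: h1; rewrite mi.
Qed.

Lemma measurable_hist_stays A m n : measurable A ->
  measurable (stays A m n : set (hist X n)).
Proof.
move=> mA; have -> : stays A m n = \bigcap_(i in [set i | (m < i <= n)%N]) (X i @^-1` A).
  by apply/seteqP; split.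
apply: (@bigcap_measurableType _ (hist X n)) => i /= /andP[mi ilen].
by have := measurable_hist (X:=X) ilen measurableT mA; rewrite setTI.
Qed.

Lemma measurable_stays A m n : measurable A -> measurable (stays A m n).
Proof. by move=> mA; apply: (measurable_of_hist mX); exact: measurable_hist_stays. Qed.

(** The last transition is averaged first: it turns [f] into [kop A f], to which the induction
    hypothesis applies. With [A := setT] this is the n-step transition formula. *)
Lemma markov_stays (A : set T) (F : set Omega) m n (f : T -> \bar R) : measurable A -> measurable (F : set (hist X m)) ->
  measurable_fun setT f -> (forall x, 0 <= f x)%E ->
  (\int[P]_(w in F `&` stays A m (m + n)) f (X (m + n)%N w) =
   \int[P]_(w in F) iter n (kop A) f (X m w))%E.
Proof.
move=> mA mF; elim: n f => [|n IH] f mf f0; first by rewrite addn0 stays0 setIT.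
rewrite addnS staysS ?leq_addr// setIA.
have mF' : measurable (F `&` stays A m (m + n) : set (hist X (m + n)%N)).
  apply: (@measurableI _ (hist X (m + n)%N)); last exact: measurable_hist_stays.
  by apply: (hist_sub _ mF); rewrite leq_addr.
rewrite integral_mkcondr.
have mfA : measurable_fun setT (f \_ A) by exact: (measurable_restrictT f mA).1 (measurable_funTS mf).
have fA0 x : (0 <= (f \_ A) x)%E by rewrite patchE; case: ifP.
transitivity (\int[P]_(w in F `&` stays A m (m + n)) (f \_ A) (X (m + n).+1 w))%E.
  by apply: eq_integral => w _; rewrite !patchE; congr (if _ then _ else _); apply/idP/idP; rewrite !inE.
rewrite (@markov_joint _ T (m + n)%N _ (X (m + n)%N) mF' (measurable_hist (X:=X) (leqnn _)) (fun z => (f \_ A) z.2)); [|exact: (measurableT_comp mfA)|by []].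
rewrite iterSr -IH; [|exact: measurable_kop|exact: kop_ge0].
by apply: eq_integral => w _; rewrite /kop [RHS]integral_mkcond.
Qed.

Section additive_functional.
Variables (r : nat) (g : T -> 'rV[R]_r).
Hypothesis mg : measurable_fun setT g.

Definition psum (m n : nat) (w : Omega) : 'rV[R]_r := \sum_(m.+1 <= i < n.+1) g (X i w).

Lemma psum_nil n : psum n n = cst 0.
Proof. by apply/funext => w; rewrite /psum big_geq. Qed.

Lemma psumS m n w : (m <= n)%N -> psum m n.+1 w = psum m n w + g (X n.+1 w).
Proof. by move=> mn; rewrite /psum big_nat_recr. Qed.

Lemma measurable_rowD d' (V : measurableType d') (a b : V -> 'rV[R]_r) :
  measurable_fun setT a -> measurable_fun setT b ->
  measurable_fun setT (fun x => a x + b x).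
Proof.
move=> ma mb; apply: measurable_fun_row => i.
under eq_fun do rewrite mxE.
by apply: measurable_funD; exact: (measurableT_comp (measurable_row_coord i)).
Qed.

Lemma measurable_hist_psum m n : (m <= n)%N -> measurable_fun setT (psum m n : hist X n -> _).
Proof.
elim: n => [|n IH].
  by rewrite leqn0 => /eqP ->; rewrite psum_nil; exact: measurable_cst.
rewrite leq_eqVlt => /orP[/eqP ->|mn]; first by rewrite psum_nil; exact: measurable_cst.
have -> : psum m n.+1 = (fun w => psum m n w + g (X n.+1 w)) by apply/funext => w; exact: psumS.
apply: measurable_rowD; first by apply: (hist_measurable_fun (leqnSn n)); exact: IH.
exact: (measurableT_comp mg (measurable_hist (X:=X) (leqnn _))).
Qed.

(* Transition operator of the pair formed by the chain and its additive functional. *)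
Definition aop (f : T * 'rV[R]_r -> \bar R) (z : T * 'rV[R]_r) : \bar R :=
  (\int[k z.1]_y f (y, (z.2 + g y)%R))%E.

Lemma aop_ge0 f : (forall x, 0 <= f x)%E -> forall x, (0 <= aop f x)%E.
Proof. by move=> f0 x; exact: integral_ge0. Qed.

Lemma measurable_aop f : measurable_fun setT f ->
  (forall x, 0 <= f x)%E -> measurable_fun setT (aop f).
Proof.
move=> mf f0.
apply: (@measurable_integral_kernel_comp _ _ _ (T * 'rV[R]_r)%type T T R k fst measurable_fst
  (fun z => f (z.2, z.1.2 + g z.2))) => //.
apply: (measurableT_comp mf); apply: measurable_fun_pair => //.
apply: measurable_rowD; first exact: (measurableT_comp measurable_snd measurable_fst).
exact: (measurableT_comp mg measurable_snd).
Qed.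

Lemma iter_aop_ge0 f n : (forall x, 0 <= f x)%E -> forall x, (0 <= iter n aop f x)%E.
Proof. by move=> f0; elim: n => [//|n IH] /= x; exact: aop_ge0. Qed.

Lemma measurable_iter_aop f n : measurable_fun setT f ->
  (forall x, 0 <= f x)%E -> measurable_fun setT (iter n aop f).
Proof.
move=> mf f0; elim: n => [//|n IH] /=; apply: measurable_aop => //.
exact: iter_aop_ge0.
Qed.

(** The pair of state and running sum is itself Markov. The sum starts at [l], while the
    conditioning time [m] may be later; regeneration uses [l := 0] and [m] the regeneration time. *)
Lemma markov_psum (F : set Omega) l m n (f : T * 'rV[R]_r -> \bar R) s : (l <= m)%N -> measurable (F : set (hist X m)) ->
  measurable_fun setT f -> (forall x, 0 <= f x)%E ->
  (\int[P]_(w in F) f (X (m + n)%N w, (s + psum l (m + n) w)%R) =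
   \int[P]_(w in F) iter n aop f (X m w, (s + psum l m w)%R))%E.
Proof.
move=> lm mF; elim: n f => [|n IH] f mf f0; first by rewrite addn0.
rewrite addnS.
under eq_integral do rewrite psumS ?(leq_trans lm) ?leq_addr// addrA.
have mF' : measurable (F : set (hist X (m + n)%N)) by apply: (hist_sub _ mF); rewrite leq_addr.
rewrite (@markov_joint _ 'rV[R]_r (m + n)%N _ (fun w => s + psum l (m + n) w) mF' _
  (fun z => f (z.2, z.1 + g z.2))).
- by rewrite iterSr -IH; [|exact: measurable_aop|exact: aop_ge0].
- apply: measurable_rowD; first exact: measurable_cst.
  by apply: measurable_hist_psum; rewrite (leq_trans lm)// leq_addr.
- apply: (measurableT_comp mf); apply: measurable_fun_pair => //.
  apply: measurable_rowD => //.
  exact: (measurableT_comp mg measurable_snd).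
- by move=> z.
Qed.

End additive_functional.

End markov_property.

(** * Rademacher averages over a VC class *)

Section expR_bounds.
Context {R : realType}.
Implicit Types x y : R.

(** Everything comes from [expR x - 1 <= x * expR x], used twice when [x] is nonnegative; for
    negative [x] the second use is replaced by [x <= expR x - 1]. *)
Lemma expR_le_quadratic x : expR x <= 1 + x + x ^+ 2 * expR `|x|.
Proof.
have e1 : expR x - 1 <= x * expR x.
  have := expR_ge1Dx (- x); rewrite expRN => h.
  have e0 := expR_gt0 x.
  have : (1 - x) * expR x <= (expR x)^-1 * expR x by rewrite ler_pM2r.
  by rewrite mulVf ?gt_eqF//; lra.
have e2 := expR_ge1Dx x.
have [x0|x0] := leP 0 x.
  rewrite ger0_norm//.
  have : x * (expR x - 1) <= x * (x * expR x) by rewrite ler_wpM2l.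
  by rewrite expr2 -mulrA; lra.
have xm : 1 <= expR `|x| by have := expR_ge1Dx `|x|; have := normr_ge0 x; lra.
have : x * (expR x - 1) <= x * x.
  by rewrite ler_nM2l//; lra.
have : x ^+ 2 * 1 <= x ^+ 2 * expR `|x| by rewrite ler_wpM2l// sqr_ge0.
by rewrite mulr1 expr2; lra.
Qed.

Lemma expR1_le4 : expR 1 <= 4 :> R.
Proof.
have h := expR_ge1Dx (- (1 / 2) : R).
have e : expR 1 = (expR (- (1 / 2)) ^+ 2)^-1 :> R.
  rewrite -expRM_natl -expRN; congr expR; lra.
rewrite e -[4]invrK lef_pV2 ?posrE ?invr_gt0 ?exprn_gt0 ?expR_gt0//.
have : (1 / 2) ^+ 2 <= expR (- (1 / 2)) ^+ 2 :> R.
  by rewrite ler_pXn2r ?nnegrE ?expR_ge0//; lra.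
by apply: le_trans; lra.
Qed.

(** The linear terms of the quadratic bounds at [x] and [- x] cancel; the factor 4 dominates
    [expR 1], which is why [x] is confined to the unit interval. *)
Lemma cosh_le x : `|x| <= 1 -> (expR x + expR (- x)) / 2 <= expR (4 * x ^+ 2).
Proof.
move=> x1.
have h1 := expR_le_quadratic x.
have h2 := expR_le_quadratic (- x).
have h3 : x ^+ 2 * expR `|x| <= x ^+ 2 * 4.
  by rewrite ler_wpM2l ?sqr_ge0// (le_trans _ expR1_le4)// ler_expR.
have h4 := expR_ge1Dx (4 * x ^+ 2).
move: h2; rewrite normrN sqrrN => h2; lra.
Qed.

Lemma le_ln_expR (x a : R) : 0 < a -> x <= ln a + expR x / a - 1.
Proof.
move=> a0; have := expR_ge1Dx (x - ln a).
by rewrite expRD expRN lnK// => h; lra.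
Qed.

End expR_bounds.

Section rademacher.
Context {R : realType} {S : zmodType}.
Implicit Types (l : seq S) (phi psi : S -> R).

(** The mean of [phi] at [s] plus the sum of the elements of [l] with independent fair signs. The
    recursion on [l] makes it a finite average, without a probability space. *)
Fixpoint ravg l phi (s : S) : R :=
  if l is a :: l' then (ravg l' phi (s + a) + ravg l' phi (s - a)) / 2 else phi s.

Lemma ravg_le l phi psi s : (forall s, phi s <= psi s) -> ravg l phi s <= ravg l psi s.
Proof.
move=> h; elim: l s => [//|a l IH] s /=.
by rewrite ler_pM2r ?invr_gt0//; apply: lerD.
Qed.

Lemma ravgD l phi psi s : ravg l (fun s => phi s + psi s) s = ravg l phi s + ravg l psi s.
Proof. by elim: l s => [//|a l IH] s /=; rewrite !IH; lra. Qed.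

Lemma ravgZ l c phi s : ravg l (fun s => c * phi s) s = c * ravg l phi s.
Proof. by elim: l s => [//|a l IH] s /=; rewrite !IH; lra. Qed.

Lemma ravg_cst l c s : ravg l (cst c) s = c.
Proof. by elim: l s => [//|a l IH] s /=; rewrite !IH; lra. Qed.

Lemma ravg_sum (J : Type) (q : seq J) l (F : J -> S -> R) s :
  ravg l (fun s => \sum_(j <- q) F j s) s = \sum_(j <- q) ravg l (F j) s.
Proof.
elim: q => [|j q IH].
  rewrite big_nil -[RHS](ravg_cst l 0 s); congr (ravg _ _ _).
  by apply/funext => x; rewrite big_nil.
rewrite big_cons -IH -ravgD; congr (ravg _ _ _).
by apply/funext => x; rewrite big_cons.
Qed.

(** A crude bound, linear in the number of signs; it serves for the residual left after the finest
    level of the chaining. *)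
Lemma ravg_le_step l phi d s :
  (forall a s, a \in l -> phi (s + a) <= phi s + d /\ phi (s - a) <= phi s + d) ->
  ravg l phi s <= phi s + (size l)%:R * d.
Proof.
elim: l s => [|a l IH] s h /=; first by rewrite mul0r addr0.
have h' b t : b \in l -> phi (t + b) <= phi t + d /\ phi (t - b) <= phi t + d.
  by move=> bl; apply: h; rewrite in_cons bl orbT.
have := IH (s + a) h'; have := IH (s - a) h'.
have [] := h a s (mem_head _ _).
by rewrite -[(size l).+1%:R]natr1; lra.
Qed.

(** The exponential moment is a product of hyperbolic cosines. The bound on the sum of squares keeps
    every factor within the range of [cosh_le]. *)
Lemma ravg_expR l (f : S -> R) s :
  (forall a b, f (a + b) = f a + f b) -> (forall a, f (- a) = - f a) ->
  \sum_(a <- l) (f a) ^+ 2 <= 1 ->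
  ravg l (expR \o f) s <= expR (f s) * expR (4 * \sum_(a <- l) (f a) ^+ 2).
Proof.
move=> fD fN; elim: l s => [|a l IH] s /=.
  by rewrite big_nil mulr0 expR0 mulr1.
rewrite big_cons => h.
have s0 : 0 <= \sum_(b <- l) f b ^+ 2 by apply: sumr_ge0 => i _; rewrite sqr_ge0.
have a0 : 0 <= f a ^+ 2 by rewrite sqr_ge0.
have hl : \sum_(b <- l) f b ^+ 2 <= 1 by lra.
have fa1 : `|f a| <= 1.
  by rewrite -(@expr_le1 _ 2)// real_normK ?num_real//; lra.
have := IH (s + a) hl; have := IH (s - a) hl.
rewrite !fD fN mulrDr (expRD (4 * _)) (expRD (f s)) (expRD (f s)) => h1 h2.
have h3 := cosh_le fa1.
have e1 := expR_gt0 (f s); have e2 := expR_gt0 (4 * \sum_(b <- l) f b ^+ 2).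
set E := expR (4 * \sum_(b <- l) f b ^+ 2) in h1 h2 e2 *.
apply: (@le_trans _ _ (expR (f s) * ((expR (f a) + expR (- f a)) / 2) * E)); first lra.
by rewrite -mulrA ler_pM2l// ler_pM2r.
Qed.

Lemma le_bigmaxr (J : eqType) (q : seq J) (F : J -> R) (c : R) :
  0 <= c -> (forall j, j \in q -> F j <= c) -> \big[Num.max/0]_(j <- q) F j <= c.
Proof.
move=> c0 h; rewrite big_seq; elim/big_ind : _ => // x y xc yc.
by rewrite ge_max xc yc.
Qed.

(* The exponential moment of size e is used at the scale [sigma] only, through
   [|x| <= ln a + e^|x| / a - 1]; this avoids Jensen's inequality. *)
Lemma rademacher_max (J : eqType) (q : seq J) l (f : J -> S -> R) (sigma L : R) :
  (forall j a b, f j (a + b) = f j a + f j b) -> (forall j a, f j (- a) = - f j a) ->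
  0 < sigma -> 0 <= L -> (size q)%:R <= expR L ->
  (forall j, j \in q -> \sum_(a <- l) (f j a) ^+ 2 <= sigma ^+ 2) ->
  ravg l (fun s => \big[Num.max/0]_(j <- q) `|f j s|) 0 <= sigma * (L + 6).
Proof.
move=> fD fN sigma0 L0 qL hf.
have f0 j : f j 0 = 0 by have := fD j 0 0; rewrite addr0; lra.
(* Each function contributes at most [2 * expR 4] to the exponential sum, and there are at most
   [expR L] of them; as [2 <= expR 2], the total is at most [a]. *)
pose a := expR (L + 6).
have a0 : 0 < a by exact: expR_gt0.
pose h j s := expR (f j s / sigma) + expR (- f j s / sigma).
apply: (@le_trans _ _ (ravg l (fun s => sigma * ((L + 6 - 1) + a^-1 * \sum_(j <- q) h j s)) 0)).
  apply: ravg_le => s.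
  have hpos j : 0 <= h j s by rewrite addr_ge0// expR_ge0.
  apply: le_bigmaxr.
    rewrite mulr_ge0 ?(ltW sigma0)// addr_ge0//; first by lra.
    by rewrite mulr_ge0 ?invr_ge0 ?(ltW a0)// sumr_ge0.
  move=> j jq.
  rewrite mulrC -ler_pdivrMr//.
  have := le_ln_expR (`|f j s| / sigma) a0; rewrite expRK => h1; apply: (le_trans h1).
  have hj : expR (`|f j s| / sigma) <= h j s.
    rewrite /h; have [fs|fs] := leP 0 (f j s).
      by rewrite ger0_norm// lerDl expR_ge0.
    by rewrite ltr0_norm// lerDr expR_ge0.
  have : expR (`|f j s| / sigma) <= \sum_(j <- q) h j s.
    rewrite (le_trans hj)// (big_rem j)//= lerDl sumr_ge0//.
  rewrite -(ler_pM2r (_ : 0 < a^-1)) ?invr_gt0// => h2; lra.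
rewrite (ravgZ l sigma (fun s => (L + 6 - 1) + a^-1 * \sum_(j <- q) h j s)).
rewrite ler_pM2l// (ravgD l (cst (L + 6 - 1))) ravg_cst ravgZ ravg_sum.
have hr j : j \in q -> ravg l (h j) 0 <= 2 * expR 4.
  move=> jq; rewrite /h ravgD.
  have hs : \sum_(b <- l) (f j b / sigma) ^+ 2 <= 1.
    under eq_bigr do rewrite expr_div_n.
    by rewrite -mulr_suml ler_pdivrMr ?exprn_gt0// mul1r hf.
  have := @ravg_expR l (fun s => f j s / sigma) 0.
  have := @ravg_expR l (fun s => - f j s / sigma) 0.
  rewrite /comp /= !f0 oppr0 !mul0r expR0 !mul1r => h1 h2.
  have {}h1 : ravg l (fun s => expR (- f j s / sigma)) 0 <= expR 4.
    have e : \sum_(b <- l) (- f j b / sigma) ^+ 2 = \sum_(b <- l) (f j b / sigma) ^+ 2.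
      by apply: eq_bigr => b _; rewrite mulNr sqrrN.
    rewrite (le_trans (h1 _ _ _))//.
    - by move=> a1 b; rewrite fD opprD mulrDl.
    - by move=> a1; rewrite fN mulNr.
    - by rewrite e.
    - by rewrite e ler_expR; lra.
  have {}h2 : ravg l (fun s => expR (f j s / sigma)) 0 <= expR 4.
    rewrite (le_trans (h2 _ _ _))//.
    - by move=> a1 b; rewrite fD mulrDl.
    - by move=> a1; rewrite fN mulNr.
    - by rewrite ler_expR; lra.
  lra.
have : \sum_(j <- q) ravg l (h j) 0 <= (size q)%:R * (2 * expR 4).
  rewrite -sum1_size natr_sum mulr_suml big_seq [leRHS]big_seq.
  by apply: ler_sum => j jq; rewrite mul1r hr.
have e2 : 2 <= expR 2 :> R by have := expR_ge1Dx (2 : R); lra.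
have : (size q)%:R * (2 * expR 4) <= expR L * (expR 2 * expR 4).
  rewrite ler_pM// ?mulr_ge0 ?expR_ge0//.
  by rewrite ler_pM2r ?expR_gt0.
rewrite -!expRD (_ : 2 + 4 = 6); last by lra.
rewrite -/a => h1 h2.
have : a^-1 * \sum_(j <- q) ravg l (h j) 0 <= 1.
  by rewrite mulrC ler_pdivrMr// mul1r (le_trans h2).
lra.
Qed.

Lemma ge_bigmaxr (J : eqType) (q : seq J) (F : J -> R) j : j \in q ->
  F j <= \big[Num.max/0]_(j <- q) F j.
Proof.
elim: q => [//|i q IH]; rewrite in_cons big_cons le_max => /orP[/eqP ->|/IH ->].
  by rewrite lexx.
by rewrite orbT.
Qed.

Lemma bigmaxr_ge0 (J : Type) (q : seq J) (F : J -> R) : 0 <= \big[Num.max/0]_(j <- q) F j.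
Proof.
elim: q => [|j q IH]; first by rewrite big_nil.
by rewrite big_cons le_max IH orbT.
Qed.

Lemma size_undup_pairs (I J1 J2 : eqType) (q : seq I) (f : I -> J1) (g : I -> J2) :
  (size (undup [seq (f i, g i) | i <- q]) <=
   size (undup (map f q)) * size (undup (map g q)))%N.
Proof.
rewrite -(size_allpairs pair); apply: uniq_leq_size; first exact: undup_uniq.
move=> x; rewrite mem_undup => /mapP[i iq ->].
by apply: (allpairs_f pair); rewrite mem_undup map_f.
Qed.

Lemma geometric_chain (A B W : R) J : 0 <= A -> 0 <= B -> 0 <= W ->
  \sum_(0 <= j < J) (W * 2 ^- j) * (A + B * j%:R) <= W * (2 * A + 2 * B).
Proof.
move=> A0 B0 W0.
(* The subtracted term is the tail of the series from [J] on, so the identity follows by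
   induction. *)
suff -> : \sum_(0 <= j < J) (W * 2 ^- j) * (A + B * j%:R) =
    W * (2 * A + 2 * B) - W * 2 ^- J * (2 * A + 2 * B * (J%:R + 1)).
  rewrite lerBlDr lerDl mulr_ge0 ?mulr_ge0 ?invr_ge0 ?exprn_ge0//.
  by rewrite addr_ge0 ?mulr_ge0// addr_ge0.
elim: J => [|J IH]; first by rewrite big_geq// expr0 invr1; lra.
rewrite big_nat_recr//= IH -[J.+1%:R]natr1 exprS invfM.
by set u := 2 ^- J; set k := J%:R; lra.
Qed.

(** Dudley's chaining with nets whose logarithmic size grows linearly in the level. The coarsest net
    costs [A + 6], the links between successive nets sum to [8 * A + 12 * B + 24], and the residual
    costs 1, all in units of [W]. *)
Lemma rademacher_chain (I : finType) l (f : I -> S -> R) (W A B : R) :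
  (forall i a b, f i (a + b) = f i a + f i b) -> (forall i a, f i (- a) = - f i a) ->
  0 < W -> 0 <= A -> 0 <= B ->
  (forall i, \sum_(a <- l) (f i a) ^+ 2 <= W ^+ 2) ->
  (forall j : nat, exists p : I -> I,
    (size (undup (map p (enum I))))%:R <= expR (A + B * j%:R) /\
    forall i, \sum_(a <- l) (f i a - f (p i) a) ^+ 2 <= (W * 2 ^- j) ^+ 2) ->
  ravg l (fun s => \big[Num.max/0]_(i <- enum I) `|f i s|) 0 <=
  W * (9 * A + 12 * B + 31).
Proof.
move=> fD fN W0 A0 B0 fW /choice[p hp].
have f0 i : f i 0 = 0 by have := fD i 0 0; rewrite addr0; lra.
have s2 j : 0 < 2 ^- j :> R by rewrite invr_gt0 exprn_gt0.
pose M0 s : R := \big[Num.max/0]_(i <- undup (map (p 0%N) (enum I))) `|f i s|.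
pose Q j := undup [seq (p j.+1 i, p j i) | i <- enum I].
pose M j s : R := \big[Num.max/0]_(i <- Q j) `|f i.1 s - f i.2 s|.
pose L J s : R := \big[Num.max/0]_(i <- enum I) `|f i s - f (p J i) s|.
have hN J s : \big[Num.max/0]_(i <- enum I) `|f i s| <=
    M0 s + \sum_(0 <= j < J) M j s + L J s.
  have hM0 : 0 <= M0 s by exact: bigmaxr_ge0.
  have hM j : 0 <= M j s by exact: bigmaxr_ge0.
  have hL : 0 <= L J s by exact: bigmaxr_ge0.
  apply: le_bigmaxr; first by rewrite !addr_ge0// sumr_ge0.
  move=> i _.
  have -> : f i s = f (p 0%N i) s + \sum_(0 <= j < J) (f (p j.+1 i) s - f (p j i) s) +
      (f i s - f (p J i) s) by rewrite telescope_sumr//; lra.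
  rewrite (le_trans (ler_normD _ _))// lerD//.
    rewrite (le_trans (ler_normD _ _))// lerD//.
      apply: (@ge_bigmaxr _ _ (fun i => `|f i s|)).
      by rewrite mem_undup map_f// mem_enum.
    rewrite (le_trans (ler_norm_sum _ _ _))//; apply: ler_sum => j _.
    apply: (@ge_bigmaxr _ (Q j) (fun i => `|f i.1 s - f i.2 s|) (p j.+1 i, p j i)).
    by rewrite mem_undup; apply/mapP; exists i; rewrite ?mem_enum.
  by apply: (@ge_bigmaxr _ _ (fun i => `|f i s - f (p J i) s|)); rewrite mem_enum.
(* Each sign moves the residual by at most [W * 2 ^- J]; this level is fine enough for all signs
   together to move it by at most [W]. *)
have [J hJ] : exists J, (size l)%:R * 2 ^- J <= 1 :> R.
  exists (size l); rewrite ler_pdivrMr ?exprn_gt0// mul1r -natrX ler_nat.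
  exact/ltnW/ltn_expl.
have EL : ravg l (L J) 0 <= W.
  have step a s t : a \in l -> (t = a \/ t = - a) -> L J (s + t) <= L J s + W * 2 ^- J.
    move=> al ta; apply: le_bigmaxr.
      by rewrite addr_ge0 ?bigmaxr_ge0// mulr_ge0// ltW.
    move=> i _; rewrite !fD.
    have -> : f i s + f i t - (f (p J i) s + f (p J i) t) =
      (f i s - f (p J i) s) + (f i t - f (p J i) t) by lra.
    rewrite (le_trans (ler_normD _ _))// lerD//.
      by apply: (@ge_bigmaxr _ _ (fun i => `|f i s - f (p J i) s|)); rewrite mem_enum.
    have -> : `|f i t - f (p J i) t| = `|f i a - f (p J i) a|.
      by case: ta => -> //; rewrite !fN -opprD normrN.
    rewrite -(@ler_pXn2r _ 2) ?nnegrE//; last by rewrite mulr_ge0// ltW.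
    rewrite real_normK ?num_real//; apply: le_trans ((hp J).2 i).
    by rewrite (big_rem a)//= lerDl sumr_ge0// => b _; rewrite sqr_ge0.
  have := @ravg_le_step l (L J) (W * 2 ^- J) 0.
  have -> : L J 0 = 0.
    apply/eqP; rewrite eq_le bigmaxr_ge0 andbT; apply: le_bigmaxr => // i _.
    by rewrite !f0 subr0 normr0.
  rewrite add0r => h; rewrite (le_trans (h _))//.
    by move=> a s al; split; apply: (step a) => //; [left|right].
  by rewrite mulrCA ger_pMr.
have E0 : ravg l M0 0 <= W * (A + 6).
  apply: rademacher_max => //.
    have := (hp 0%N).1; rewrite mulr0 addr0; exact.
(* A link joins points at distances [W * 2 ^- j] and half of that from a common index, hence the
   scale [2 * (W * 2 ^- j)]; the number of links is at most the product of the two net sizes. *)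
have EM j : ravg l (M j) 0 <= W * 2 ^- j * ((4 * A + 2 * B + 12) + (4 * B) * j%:R).
  have -> : W * 2 ^- j * ((4 * A + 2 * B + 12) + (4 * B) * j%:R) =
      (2 * (W * 2 ^- j)) * ((2 * A + B + 2 * B * j%:R) + 6) by set u := 2 ^- j; lra.
  apply: (@rademacher_max _ (Q j) l (fun i s => f i.1 s - f i.2 s)).
  - by move=> i a b; rewrite !fD; lra.
  - by move=> i a; rewrite !fN; lra.
  - by rewrite !mulr_gt0.
  - by rewrite !addr_ge0 ?mulr_ge0.
  - have h1 := (hp j).1; have := (hp j.+1).1; rewrite -[j.+1%:R]natr1 => h2.
    apply: (@le_trans _ _ ((size (undup (map (p j.+1) (enum I))))%:R *
        (size (undup (map (p j) (enum I))))%:R)).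
      by rewrite -natrM ler_nat size_undup_pairs.
    rewrite (_ : 2 * A + B + 2 * B * j%:R = (A + B * (j%:R + 1)) + (A + B * j%:R)); last lra.
    by rewrite expRD ler_pM.
  - move=> i; rewrite mem_undup => /mapP[i' _ ->] /=.
    have h1 := (hp j).2 i'; have h2 := (hp j.+1).2 i'.
    apply: (@le_trans _ _ (\sum_(a <- l) (2 * (f i' a - f (p j i') a) ^+ 2 +
        2 * (f i' a - f (p j.+1 i') a) ^+ 2))).
      apply: ler_sum => a _.
      have := sqr_ge0 ((f i' a - f (p j i') a) + (f i' a - f (p j.+1 i') a)).
      by rewrite !expr2; lra.
    rewrite big_split/= -!mulr_sumr.
    have e : 2 ^- j.+1 = 2^-1 * 2 ^- j :> R by rewrite exprS invfM.
    move: h1 h2; rewrite e; set u := 2 ^- j; rewrite !expr2 => h1 h2.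
    have := sqr_ge0 (W * u); rewrite expr2; lra.
apply: (@le_trans _ _ (ravg l (fun s => M0 s + \sum_(0 <= j < J) M j s + L J s) 0)).
  exact: ravg_le.
rewrite (ravgD l (fun s => M0 s + \sum_(0 <= j < J) M j s)) (ravgD l M0) ravg_sum.
have h1 : \sum_(0 <= j < J) ravg l (M j) 0 <=
    \sum_(0 <= j < J) (W * 2 ^- j) * ((4 * A + 2 * B + 12) + (4 * B) * j%:R).
  by apply: ler_sum => j _.
have := @geometric_chain (4 * A + 2 * B + 12) (4 * B) W J.
rewrite !addr_ge0 ?mulr_ge0// => /(_ isT isT (ltW W0)) h2; lra.
Qed.

End rademacher.

(** * Finite nets in a VC class and Rademacher sums of blocks *)

Section discrete_measure.
Context {R : realType} d {T : measurableType d}.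

(** [msum] sums over natural numbers, hence the [inord]. *)
Definition wdirac (n : nat) (w : 'I_n.+1 -> {nonneg R}) (x : 'I_n.+1 -> T) : {measure set T -> \bar R} :=
  msum (fun k => mscale (w (inord k)) (\d_(x (inord k)))) n.+1.

Lemma integral_wdirac n (w : 'I_n.+1 -> {nonneg R}) (x : 'I_n.+1 -> T) (f : T -> \bar R) :
  measurable_fun setT f -> (forall t, 0 <= f t)%E ->
  (\int[wdirac w x]_t f t = \sum_(k < n.+1) (w k)%:num%:E * f (x k))%E.
Proof.
move=> mf f0; rewrite ge0_integral_measure_sum//.
apply: eq_bigr => k _; rewrite ge0_integral_mscale// integral_dirac// diracT mul1e.
by rewrite inord_val.
Qed.

(** The covering condition of a VC class ranges over all probability measures carried by [E]; it
    will be applied to this discrete one. *)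
Lemma wdirac_probability n (w : 'I_n.+1 -> {nonneg R}) (x : 'I_n.+1 -> T) (E : set T) :
  \sum_(k < n.+1) (w k)%:num = 1 -> measurable E -> (forall k, E (x k)) ->
  exists Q : probability T R, Q E = 1%E /\
    forall f, measurable_fun setT f -> (forall t, 0 <= f t)%E ->
    (\int[Q]_t f t = \sum_(k < n.+1) (w k)%:num%:E * f (x k))%E.
Proof.
move=> w1 mE xE.
have wE A : measurable A -> (forall k, A (x k)) -> wdirac w x A = 1%E.
  move=> mA xA; rewrite /wdirac/= /msum.
  transitivity (\sum_(k < n.+1) (w k)%:num%:E)%E; last by rewrite sumEFin w1.
  apply: eq_bigr => k _.
  rewrite [LHS](_ : _ = (w (inord k))%:num%:E * (\1_A (x (inord k)))%:E)%E//.
  by rewrite indicE mem_set// mule1 inord_val.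
have w1' : wdirac w x setT = 1%E by exact: wE.
pose Q : probability T R := HB.pack (Measure.sort (wdirac w x)) (Measure_isProbability.Build _ _ _ (wdirac w x) w1').
exists Q; split; first exact: wE.
by move=> f mf f0; rewrite -integral_wdirac.
Qed.

End discrete_measure.

Section vc_covering.
Context {R : realType} d {T : measurableType d}.
Variables (E : set T) (G : set (T -> R)) (U C v : R).
Hypotheses (mE : measurable E) (GVC : vc_class E G U C v) (U0 : 0 < U).
Hypothesis E0 : E !=set0.

Lemma vc_C_ge1 : 1 <= C.
Proof.
case: GVC => _ _ v1 CV _; apply: le_trans CV.
have e1 : 1 <= Num.sqrt (expR 1 : R).
  by rewrite -[leLHS]sqrtr1 ler_sqrt ?expR_ge0//; have := expR_ge1Dx (1 : R); lra.
have h : 1 <= 3 * Num.sqrt (expR 1 : R) by lra.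
rewrite -[X in X `^ v]lnK ?posrE; last by lra.
rewrite -expRM -[leLHS]expR0 ler_expR mulr_ge0 ?ln_ge0//; lra.
Qed.

Lemma L2_dist_le (Q : probability T R) (f g : T -> R) (y : R) : 0 <= y ->
  (L2_dist Q E f g <= y%:E)%E ->
  (\int[Q]_x (((f \- g)%R \_ E) x ^+ 2)%:E <= (y ^+ 2)%:E)%E.
Proof.
move=> y0; rewrite /L2_dist => h.
have : ('N[Q]_2%:E[EFin \o ((f \- g)%R \_ E)] `^ 2 <= y%:E `^ 2)%E.
  by apply: gt0_ler_poweR; rewrite ?in_itv/= ?leey ?andbT ?Lnorm_ge0 ?lee_fin.
rewrite powR_Lnorm// poweR_EFin powR_mulrn//; apply: le_trans.
rewrite le_eqVlt; apply/orP; left; apply/eqP; apply: eq_integral => x _ /=.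
by rewrite powR_mulrn// real_normK ?num_real.
Qed.

(** The centres of a cover need not belong to the class, whereas the chaining needs nets of indices.
    Replacing a centre by an index attached to it doubles the radius, so the cover is taken at
    radius [2 ^- j.+1 * U]. *)
Lemma vc_finite_cover (r : nat) (g : 'I_r -> T -> R) (n : nat) (w : 'I_n -> R) (x : 'I_n -> T)
    (W : R) (j : nat) :
  (forall i, G (g i)) -> (forall k, 0 <= w k) -> \sum_k w k = W -> 0 < W ->
  exists p : 'I_r -> 'I_r,
    (size (undup (map p (enum 'I_r))))%:R <= expR (ln (2 * C) + v + v * j%:R) /\
    forall i, \sum_k w k * (((g i) \_ E) (x k) - ((g (p i)) \_ E) (x k)) ^+ 2 <= W * (U * 2 ^- j) ^+ 2.
Proof.
case: n w x => [|n] w x gG w0 wW W0.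
  by move: W0; rewrite -wW big_ord0 ltxx.
have [e Ee] := E0.
(* The measure must be carried by [E]. At a point outside [E] both restricted functions vanish, so
   its weight can be moved to [e]. *)
pose x' k := if x k \in E then x k else e.
have xE k : E (x' k) by rewrite /x'; case: ifPn => // /set_mem.
have wk0 k : 0 <= w k / W by rewrite divr_ge0// ltW.
have w1 : \sum_k (NngNum (wk0 k))%:num = 1.
  by rewrite -mulr_suml wW divff// gt_eqF.
have [Q [QE Qint]] := wdirac_probability w1 mE xE.
case: GVC => _ mG v1 CV /(_ Q QE (2 ^- j.+1)).
have j1 : 2 ^- j.+1 < 1 :> R by rewrite invf_lt1 ?exprn_gt0// exprn_egt1// ltr1n.
have j0 : 0 < 2 ^- j.+1 :> R by rewrite invr_gt0 exprn_gt0.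
rewrite j0 j1 => /(_ isT) cov.
have C1 := vc_C_ge1.
pose K := C * (2 ^- j.+1) `^ (- v).
have C0 : 0 < C by lra.
have l2 : 0 <= ln (2 : R) <= 1.
  rewrite ln_ge0 ?ler1n//= -[leRHS]expRK ler_ln ?posrE ?expR_gt0//.
  by have := expR_ge1Dx (1 : R); lra.
have KE' : K = expR (ln C + v * (j%:R + 1) * ln 2).
  rewrite /K expRD lnK ?posrE//; congr (_ * _).
  have -> : 2 ^- j.+1 = expR (- ((j%:R + 1) * ln 2)) :> R.
    by rewrite expRN natr1 expRM_natl lnK ?posrE.
  by rewrite -expRM; congr expR; lra.
have jl2 : 0 <= v * (j%:R + 1) * ln 2 <= v * (j%:R + 1).
  have vj : 0 <= v * (j%:R + 1) by rewrite mulr_ge0 ?addr_ge0//; lra.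
  by move/andP : l2 => [l20 l21]; rewrite mulr_ge0//= ler_piMr.
have K1 : 1 <= K.
  rewrite KE' -[leLHS]expR0 ler_expR addr_ge0//; last by case/andP: jl2.
  exact: ln_ge0.
(* The covering number is an infimum bounded by [K]; a cover of size below [K + 1] is extracted, and
   the factor 2 in [ln (2 * C)] absorbs the 1. *)
have KE : K + 1 <= expR (ln (2 * C) + v + v * j%:R).
  apply: (@le_trans _ _ (2 * K)); first lra.
  rewrite KE' -[in leLHS](@lnK _ 2) ?posrE// -expRD ler_expR lnM ?posrE//.
  rewrite expRK; move/andP : jl2 => []; lra.
have /ereal_inf_ltP[_ [k [c [cZ cov']] <-]] :
    (covering_number (L2_dist Q E) [set f | measurable_fun E f] G (2 ^- j.+1 * U) < (K + 1)%:E)%E.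
  by rewrite (le_lt_trans cov)// lte_fin ltrDl.
rewrite lte_fin => kK.
have /choice[a ha] : forall i, exists b : 'I_k, (L2_dist Q E (g i) (c b) <= (2 ^- j.+1 * U)%:E)%E.
  by move=> i; exact: cov'.
(* One representative index for each centre in use; [p] depends on [i] through [a i] only, so it
   takes at most [k] values. *)
pose p i := odflt i [pick i' | a i' == a i].
have ap i : a (p i) = a i.
  by rewrite /p; case: pickP => [i' /eqP //|/(_ i)]; rewrite eqxx.
have pp i i' : a i = a i' -> p i = p i'.
  move=> aii; rewrite /p aii; case: pickP => //= /(_ i').
  by rewrite eqxx.
exists p; split.
  apply: le_trans KE; apply: le_trans (ltW kK); rewrite ler_nat.
  rewrite -(size_map a) -[k in (_ <= k)%N]card_ord cardE; apply: uniq_leq_size; last by move=> b _; rewrite mem_enum.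
  rewrite map_inj_in_uniq ?undup_uniq// => i1 i2.
  by rewrite !mem_undup => /mapP[i1' _ ->] /mapP[i2' _ ->]; rewrite !ap; exact: pp.
move=> i.
have Qle i' : \sum_k0 w k0 / W * ((g i' \- c (a i')) \_ E) (x' k0) ^+ 2 <= (2 ^- j.+1 * U) ^+ 2.
  have y0 : 0 <= 2 ^- j.+1 * U by rewrite mulr_ge0 ?(ltW U0)// ltW.
  have := L2_dist_le y0 (ha i'); rewrite Qint.
  - by under eq_bigr do rewrite -EFinM; rewrite sumEFin lee_fin.
  - apply/measurable_EFinP; apply: measurable_funX.
    apply: (measurable_restrictT _ mE).1; apply: measurable_funB; [exact: (mG _ (gG _)).1|exact: cZ].
  - by move=> t; rewrite lee_fin sqr_ge0.
have h1 := Qle i; have := Qle (p i); rewrite ap => h2.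
have : \sum_k0 w k0 / W * ((g i \_ E) (x k0) - (g (p i) \_ E) (x k0)) ^+ 2 <= (U * 2 ^- j) ^+ 2.
  apply: (@le_trans _ _ (\sum_k0 (2 * (w k0 / W * ((g i \- c (a i)) \_ E) (x' k0) ^+ 2) +
     2 * (w k0 / W * ((g (p i) \- c (a i)) \_ E) (x' k0) ^+ 2)))).
    apply: ler_sum => k0 _; rewrite !patchE.
    have := wk0 k0; set a0 := w k0 / W => a00.
    rewrite (mem_set (xE k0)) /x'; case: ifPn => [_|xk].
      rewrite /=; set u := g i _; set u1 := c (a i) _; set u2 := g (p i) _.
      have := mulr_ge0 a00 (sqr_ge0 ((u - u1) + (u2 - u1))); rewrite !expr2 /=; lra.
    by rewrite subrr expr0n/= mulr0 addr_ge0// mulr_ge0// mulr_ge0// sqr_ge0.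
  rewrite big_split/= -!mulr_sumr.
  have e2 : 2 ^- j.+1 = 2^-1 * 2 ^- j :> R by rewrite exprS invfM.
  move: h1 h2; rewrite e2; set u := 2 ^- j; rewrite !expr2 => h1 h2; lra.
rewrite -(ler_pM2l W0); apply: le_trans.
rewrite mulr_sumr le_eqVlt; apply/orP; left; apply/eqP; apply: eq_bigr => k0 _.
by field; rewrite gt_eqF.
Qed.

Definition row_norm (r : nat) (s : 'rV[R]_r) : R := \big[Num.max/0]_(i <- enum 'I_r) `|s ord0 i|.

Lemma cauchy_schwarz_sum (J : Type) (q : seq J) (f : J -> R) :
  (\sum_(j <- q) f j) ^+ 2 <= (size q)%:R * \sum_(j <- q) f j ^+ 2.
Proof.
elim: q => [|j q IH]; first by rewrite !big_nil mul0r expr0n.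
rewrite !big_cons /= -[(size q).+1%:R]natr1.
set a := \sum_(j <- q) f j in IH *; set b := \sum_(j <- q) f j ^+ 2 in IH *; set k := (size q)%:R in IH *.
have b0 : 0 <= b by apply: sumr_ge0 => i _; rewrite sqr_ge0.
have k0 : 0 <= k by [].
suff : 2 * f j * a <= k * f j ^+ 2 + b by rewrite !expr2 in IH *; lra.
have [k00|k00] := eqVneq k 0.
  move: IH; rewrite k00 mul0r => IH; have -> : a = 0 by apply/eqP; rewrite -sqrf_eq0 eq_le IH sqr_ge0.
  by rewrite mulr0 mul0r add0r.
have kp : 0 < k by rewrite lt_def k00.
have h : a ^+ 2 / k <= b by rewrite ler_pdivrMr// mulrC.
have : 0 <= k * (f j - a / k) ^+ 2 by rewrite mulr_ge0// sqr_ge0.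
have -> : k * (f j - a / k) ^+ 2 = k * f j ^+ 2 - 2 * f j * a + a ^+ 2 / k by field.
by lra.
Qed.

Lemma ravg_map (S S' : zmodType) (h : S -> S') (l : seq S) (phi : S' -> R) s :
  (forall a b, h (a + b) = h a + h b) -> (forall a, h (- a) = - h a) ->
  ravg (map h l) phi (h s) = ravg l (phi \o h) s.
Proof.
move=> hD hN; elim: l s => [//|a l IH] s /=.
by rewrite -hN -!hD !IH.
Qed.

(** The chaining constant [9 * A + 12 * B + 31] at [A := ln (2 * C) + v] and [B := v], plus 6 for
    the Rademacher average of the block lengths. *)
Definition chain_const : R := 9 * (ln (2 * C) + v) + 12 * v + 37.

Lemma chain_const_ge0 : 0 <= chain_const.
Proof.
have := vc_C_ge1; case: GVC => _ _ v1 _ _ C1.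
have : 0 <= ln (2 * C) by apply: ln_ge0; lra.
by rewrite /chain_const; lra.
Qed.

(** The centring constants [m i] are outside the covering condition, so a block is split by [h] into
    its uncentred sums and its length; the lengths form a one-dimensional average. By Cauchy-Schwarz
    the squared sum over a block is at most its length times a sum of squares, which is an L2
    distance for the measure giving each point the length of its block. *)
Lemma rademacher_blocks (r : nat) (g : 'I_r -> T -> R) (m : 'I_r -> R) (bs : seq (seq T)) :
  (forall i, G (g i)) -> (forall i, `|m i| <= U) ->
  ravg [seq \row_i \sum_(x <- b) ((g i \_ E) x - m i) | b <- bs] (@row_norm r) 0 <=
  U * chain_const * Num.sqrt (\sum_(b <- bs) (size b)%:R ^+ 2).
Proof.
move=> gG mU.
set L2 := \sum_(b <- bs) _.
have L20 : 0 <= L2 by apply: sumr_ge0 => b _; rewrite sqr_ge0.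
pose h (s : 'rV[R]_r * R) : 'rV[R]_r := s.1 - \row_i (s.2 * m i).
pose bv (b : seq T) : 'rV[R]_r * R := (\row_i \sum_(x <- b) (g i \_ E) x, (size b)%:R).
have hD a b : h (a + b) = h a + h b by apply/rowP => i; rewrite !mxE/=; lra.
have hN a : h (- a) = - h a by apply/rowP => i; rewrite !mxE/=; lra.
have -> : [seq \row_i \sum_(x <- b) ((g i \_ E) x - m i) | b <- bs] = map h (map bv bs).
  rewrite -map_comp; apply: eq_map => b /=; apply/rowP => i; rewrite !mxE big_split/=.
  by congr (_ + _); rewrite big_const_seq count_predT iter_addr_0 mulNrn mulr_natl.
have h0 : 0 = h 0 by apply/rowP => i; rewrite !mxE/=; lra.
rewrite [X in ravg _ _ X]h0 ravg_map//.
pose N1 (s : 'rV[R]_r * R) : R := \big[Num.max/0]_(i <- enum 'I_r) `|s.1 ord0 i|.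
pose N2 (s : 'rV[R]_r * R) : R := \big[Num.max/0]_(i <- [:: tt]) `|s.2|.
have N2E s : N2 s = `|s.2| by rewrite /N2 big_cons big_nil; apply/max_idPl.
have hle s : row_norm (h s) <= N1 s + U * N2 s.
  rewrite N2E; apply: le_bigmaxr.
    by rewrite addr_ge0 ?bigmaxr_ge0// mulr_ge0// ltW.
  move=> i _; rewrite !mxE (le_trans (ler_normB _ _))// lerD//.
    by apply: (@ge_bigmaxr _ _ _ (fun i => `|s.1 ord0 i|)); rewrite mem_enum.
  by rewrite normrM mulrC ler_wpM2r.
apply: (le_trans (ravg_le _ _ hle)).
rewrite (ravgD (map bv bs) N1) ravgZ.
(* The Rademacher bounds ask for a positive scale. If it vanishes, all blocks are empty and both
   sides are 0. *)
have [/eqP L2z|L2nz] := boolP (L2 == 0).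
  have bz b : b \in bs -> b = [::].
    move=> bin; move: L2z; rewrite /L2 (big_rem b)//= => /eqP.
    rewrite paddr_eq0 ?sqr_ge0//; last by apply: sumr_ge0 => b' _; rewrite sqr_ge0.
    by rewrite sqrf_eq0 pnatr_eq0 => /andP[/nilP -> _].
  have -> : map bv bs = map (cst 0) bs.
    apply/eq_in_map => b bin; rewrite /bv (bz b bin); congr pair.
    by apply/rowP => i; rewrite !mxE big_nil.
  have rz (phi : 'rV[R]_r * R -> R) : ravg (map (cst 0) bs) phi 0 = phi 0.
    by elim: (bs) => [//|b s' IH] /=; rewrite subr0 addr0 IH; lra.
  rewrite !rz L2z sqrtr0 mulr0 N2E normr0 mulr0 addr0.
  by apply: le_bigmaxr => // i _; rewrite mxE normr0.
have L2p : 0 < L2 by rewrite lt_def L2nz.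
set Lam := Num.sqrt L2.
have Lp : 0 < Lam by rewrite sqrtr_gt0.
have LE : Lam ^+ 2 = L2 by rewrite sqr_sqrtr.
have v1 : 1 <= v by case: GVC.
have C1 := vc_C_ge1.
have lC : 0 <= ln (2 * C) by apply: ln_ge0; lra.
have H2 : ravg (map bv bs) N2 0 <= Lam * (0 + 6).
  apply: (@rademacher_max _ _ unit [:: tt] _ (fun _ s => s.2)) => //=.
    by rewrite expR0.
  by move=> _ _; rewrite LE big_map.
have H1 : ravg (map bv bs) N1 0 <= (U * Lam) * (9 * (ln (2 * C) + v) + 12 * v + 31).
  apply: (@rademacher_chain R ('rV[R]_r * R)%type 'I_r (map bv bs)
      (fun (i : 'I_r) (s : 'rV[R]_r * R) => s.1 ord0 i) (U * Lam) (ln (2 * C) + v) v).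
  - by move=> i a b; rewrite !mxE.
  - by move=> i a; rewrite !mxE.
  - by rewrite mulr_gt0.
  - by rewrite addr_ge0//; lra.
  - lra.
  - move=> i; rewrite big_map exprMn LE /L2 mulr_sumr; apply: ler_sum => b _.
    rewrite /= mxE (le_trans (cauchy_schwarz_sum _ _))//.
    rewrite [leRHS]mulrC expr2 -mulrA ler_wpM2l//.
    rewrite -sum1_size natr_sum mulr_suml; apply: ler_sum => x _; rewrite mul1r.
    rewrite -real_normK ?num_real// ler_pXn2r ?nnegrE ?(ltW U0)//.
    rewrite patchE; case: ifPn => [/set_mem Ex|_]; last by rewrite normr0 ltW.
    by case: GVC => _ /(_ _ (gG i))[_ /(_ _ Ex)].
  - move=> j.
    (* Every point carries the length of its block as weight; the total mass is then [L2], the sum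
       of the squared lengths. *)
    pose pts := flatten [seq [seq ((size b)%:R : R, x) | x <- b] | b <- bs].
    pose tp := in_tuple pts.
    have sumE (F : R -> T -> R) : \sum_(k < size pts) F (tnth tp k).1 (tnth tp k).2 =
        \sum_(b <- bs) \sum_(x <- b) F (size b)%:R x.
      rewrite -(big_tuple _ _ tp xpredT (fun k => F k.1 k.2)) /= /pts big_flatten/= big_map.
      by apply: eq_bigr => b _; rewrite big_map.
    have [|||p [p1 p2]] := @vc_finite_cover r g (size pts) (fun k => (tnth tp k).1) (fun k => (tnth tp k).2) L2 j gG.
    + move=> k; have : tnth tp k \in pts by rewrite -[pts]/(tval tp) mem_tnth.
      by move=> /flattenP[_ /mapP[b _ ->]] /mapP[x _ ->].
    + rewrite (sumE (fun w _ => w)) /L2; apply: eq_bigr => b _.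
      by rewrite big_const_seq count_predT iter_addr_0 expr2 mulr_natl.
    + exact: L2p.
    exists p; split => // i.
    rewrite big_map.
    have := p2 i; rewrite (sumE (fun w x => w * ((g i \_ E) x - (g (p i) \_ E) x) ^+ 2)).
    rewrite -LE -exprMn => h2.
    apply: le_trans (le_trans h2 _); last by rewrite mulrCA mulrA.
    apply: ler_sum => b _; rewrite /= !mxE -sumrB -mulr_sumr.
    exact: cauchy_schwarz_sum.
have UH : U * ravg (map bv bs) N2 0 <= U * (Lam * (0 + 6)) by rewrite ler_pM2l.
rewrite /chain_const; lra.
Qed.

End vc_covering.

(** * Regeneration and symmetrization *)

Section row_norm_theory.
Context {R : realType} {r : nat}.
Implicit Types s t : 'rV[R]_r.

Lemma row_norm_ge0 s : 0 <= row_norm s. Proof. exact: bigmaxr_ge0. Qed.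

Lemma ler_row_norm s i : `|s ord0 i| <= row_norm s.
Proof. by apply: (@ge_bigmaxr _ _ _ (fun i => `|s ord0 i|)); rewrite mem_enum. Qed.

Lemma row_norm_le s c : 0 <= c -> (forall i, `|s ord0 i| <= c) -> row_norm s <= c.
Proof. by move=> c0 h; apply: le_bigmaxr. Qed.

Lemma row_normD s t : row_norm (s + t) <= row_norm s + row_norm t.
Proof.
apply: row_norm_le => [|i]; first by rewrite addr_ge0 ?row_norm_ge0.
by rewrite mxE (le_trans (ler_normD _ _))// lerD ?ler_row_norm.
Qed.

Lemma row_normN s : row_norm (- s) = row_norm s.
Proof. by rewrite /row_norm; apply: eq_bigr => i _; rewrite mxE normrN. Qed.

Lemma row_norm0 : row_norm (0 : 'rV[R]_r) = 0.
Proof.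
apply/eqP; rewrite eq_le row_norm_ge0 andbT; apply: row_norm_le => // i.
by rewrite mxE normr0.
Qed.

Lemma row_normZ (a : R) s : 0 <= a -> row_norm (a *: s) = a * row_norm s.
Proof.
have h b t : 0 <= b -> row_norm (b *: t) <= b * row_norm t.
  move=> b0; apply: row_norm_le => [|i]; first by rewrite mulr_ge0 ?row_norm_ge0.
  by rewrite mxE normrM ger0_norm// ler_wpM2l// ler_row_norm.
move=> a0; apply/eqP; rewrite eq_le h//=.
have [->|anz] := eqVneq a 0; first by rewrite mul0r row_norm_ge0.
have ap : 0 < a by rewrite lt_def anz.
rewrite -[s in X in X <= _](scalerK anz) -ler_pdivlMl//; apply: h.
by rewrite invr_ge0.
Qed.

Lemma measurable_row_norm : measurable_fun setT (@row_norm R r).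
Proof.
rewrite /row_norm; elim: (enum _) => [|i q IH].
  by under eq_fun do rewrite big_nil; exact: measurable_cst.
under eq_fun do rewrite big_cons.
apply: measurable_maxr => //.
apply: measurableT_comp => //.
exact: (measurable_row_coord i).
Qed.

Lemma measurable_rowZ d (V : measurableType d) (c : R) (a : V -> 'rV[R]_r) :
  measurable_fun setT a -> measurable_fun setT (fun x => c *: a x).
Proof.
move=> ma; apply: measurable_fun_row => i.
under eq_fun do rewrite mxE.
by apply: measurable_funM => //; exact: (measurableT_comp (measurable_row_coord i)).
Qed.

End row_norm_theory.

(** Serves for quantities evaluated at the random time [rt], from their measurability at each fixed
    time. *)
Lemma measurable_fun_natdep d d' (T : measurableType d) (V : measurableType d')
    (n : T -> nat) (F : nat -> T -> V) :
  (forall i, measurable (n @^-1` [set i])) -> (forall i, measurable_fun setT (F i)) ->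
  measurable_fun setT (fun x => F (n x) x).
Proof.
move=> mn mF _ B mB; rewrite setTI.
rewrite [X in measurable X](_ : _ = \bigcup_i (n @^-1` [set i] `&` F i @^-1` B)).
  apply: bigcup_measurable => i _; apply: measurableI => //.
  by rewrite -[X in measurable X]setTI; exact: mF.
apply/seteqP; split => [x Bx|x [i _ [/= <-]]//].
by exists (n x).
Qed.

Lemma int_cst d (T : measurableType d) (R : realType) (P : probability T R) (c : \bar R) :
  (\int[P]_w c = c)%E.
Proof.
transitivity (c * P setT)%E; first exact: integral_cst.
by rewrite probability_setT mule1.
Qed.

Section first_return.
Context d dO {T : measurableType d} {Omega : measurableType dO}.
Variables (Z : nat -> Omega -> T) (A : set T).
Hypotheses (mA : measurable A) (mZ : forall n, measurable_fun setT (Z n)).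

Definition first_at (n : nat) (w : Omega) : Prop :=
  [/\ (0 < n)%N, A (Z n w) & forall j, (0 < j < n)%N -> ~ A (Z j w)].

(* [0] when [A] is never visited at a positive time. *)
Definition rt (w : Omega) : nat := xget 0%N [set n | first_at n w].

Lemma first_at_uniq n m w : first_at n w -> first_at m w -> n = m.
Proof.
move=> [n0 An hn] [m0 Am hm]; case: (ltngtP n m) => // nm.
  by exfalso; apply: (hm n) => //; rewrite n0.
by exfalso; apply: (hn m) => //; rewrite m0.
Qed.

Lemma rt_first n w : first_at n w -> rt w = n.
Proof.
move=> h; rewrite /rt; case: xgetP => [m -> hm|/(_ n) //].
exact: (first_at_uniq hm h).
Qed.

Lemma rt_gt0 w : (0 < rt w)%N -> first_at (rt w) w.
Proof. by rewrite /rt; case: xgetP => [m -> //|]. Qed.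

Lemma rt_eqE n : (0 < n)%N -> rt @^-1` [set n] = stays Z (~` A) 0 n.-1 `&` Z n @^-1` A.
Proof.
move=> n0; apply/seteqP; split => w /=.
  move=> rn; have [_ An hn] : first_at n w by rewrite -rn; apply: rt_gt0; rewrite rn.
  split => // i /andP[i0 ilen]; apply: hn; rewrite i0/= (leq_ltn_trans ilen)//.
  by rewrite prednK.
move=> [h An]; apply: rt_first; split => // j /andP[j0 jn]; apply: h.
by rewrite j0 -ltnS prednK.
Qed.

Lemma rt_eq0E : rt @^-1` [set 0%N] = \bigcap_n stays Z (~` A) 0 n.
Proof.
apply/seteqP; split => w /=.
  move=> r0 n _; elim/ltn_ind: n => n IH i /andP[i0 ilen] Ai.
  have [j /andP[j0 jn] Aj] : exists2 j, (0 < j < i)%N & A (Z j w).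
    apply: contrapT => hn; have : rt w = i.
      apply: rt_first; split => // j jn Aj; apply: hn; by exists j.
    by rewrite r0 => i00; rewrite -i00 in i0.
  have [|] := leqP n j => nj.
    by move: (leq_ltn_trans nj jn); rewrite ltnNge ilen.
  by apply: (IH j nj j) => //; rewrite j0 leqnn.
move=> h; apply/eqP; rewrite -leqn0 leqNgt; apply/negP => r0.
have [_ Ar _] := rt_gt0 r0.
by apply: (h (rt w) Logic.I (rt w)) => //; rewrite r0 leqnn.
Qed.

Lemma rt_gtE n : [set w | rt w = 0%N \/ (n < rt w)%N] = stays Z (~` A) 0 n.
Proof.
apply/seteqP; split => w /=.
  case=> [r0|nr].
    have : (rt @^-1` [set 0%N]) w by [].
    by rewrite rt_eq0E => /(_ n Logic.I).
  have [_ _ h] := rt_gt0 (leq_ltn_trans (leq0n _) nr).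
  by move=> i /andP[i0 ilen]; apply: h; rewrite i0 (leq_ltn_trans ilen).
move=> h; case: (posnP (rt w)) => [|r0]; [by left|right].
rewrite ltnNge; apply/negP => rn; have [_ Ar _] := rt_gt0 r0.
by apply: (h (rt w)) => //; rewrite r0.
Qed.

Lemma measurable_hist_rt n : (0 < n)%N -> measurable (rt @^-1` [set n] : set (hist Z n)).
Proof.
move=> n0; rewrite rt_eqE//.
apply: (@measurableI _ (hist Z n)).
  by apply: (@hist_sub _ _ _ _ Z n.-1 n _ (leq_pred n)); apply: measurable_hist_stays; exact: measurableC.
by have := measurable_hist (X:=Z) (leqnn n) measurableT mA; rewrite setTI.
Qed.

Lemma measurable_rt n : measurable (rt @^-1` [set n]).
Proof.
case: n => [|n]; last by apply: (measurable_of_hist mZ); exact: measurable_hist_rt.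
rewrite rt_eq0E; apply: bigcapT_measurable => n.
by apply: (measurable_of_hist mZ); apply: measurable_hist_stays; exact: measurableC.
Qed.

Lemma return_timeE (R : realType) w : return_time R Z A w =
  if rt w == 0%N then +oo%E else ((rt w)%:R)%:E.
Proof.
rewrite /return_time; case: ifPn => [/eqP r0|].
  rewrite (_ : [set _ | _ in _] = set0) ?ereal_inf0//.
  apply/seteqP; split => // x [n /= [n0 An] _].
  have : (rt @^-1` [set 0%N]) w by [].
  by rewrite rt_eq0E => /(_ n Logic.I n); rewrite n0 leqnn => /(_ isT).
rewrite -lt0n => r0; have [_ Ar hr] := rt_gt0 r0.
apply/eqP; rewrite eq_le; apply/andP; split.
  by apply: ereal_inf_lbound; exists (rt w).
apply: le_ereal_inf_tmp => _ [n /= [n0 An] <-]; rewrite lee_fin ler_nat leqNgt.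
by apply/negP => nr; apply: (hr n) => //; rewrite n0.
Qed.

Lemma tail_stays (R : realType) (P : probability Omega R) n :
  tail P (return_time R Z A) n = P (stays Z (~` A) 0 n).
Proof.
rewrite /tail -rt_gtE; congr (P _); apply/seteqP; split => w /=; rewrite return_timeE.
  by case: ifPn => [/eqP|_]; [left|rewrite lte_fin ltr_nat; right].
by case=> [->|nr]; [rewrite ltry|case: ifP => [_|_]; rewrite ?ltry// lte_fin ltr_nat].
Qed.

End first_return.

Section regeneration.
Context (R : realType) (d dO : measure_display) (T : measurableType d)
  (Omega : measurableType dO).
Variables (A : set T) (k : R.-fker T ~> T) (Z : nat -> Omega -> T).
Variables (PA : probability Omega R) (muA : set T -> \bar R).
Hypotheses (mA : measurable A) (muA1 : muA A = 1%E)
  (atom : forall x y B, A x -> A y -> measurable B -> k x B = k y B)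
  (MCA : markov_chain PA (fun x => k x : set T -> \bar R) muA Z).
Variables (r : nat) (g : T -> 'rV[R]_r).
Hypothesis mg : measurable_fun setT g.

Local Notation S := (psum Z g 0).
Local Notation rt := (rt Z A).

Let mZ n : measurable_fun setT (Z n). Proof. by case: MCA. Qed.

Lemma measurable_psum m n : measurable_fun setT (psum Z g m n).
Proof.
have [mn|nm] := leqP m n.
  by apply: (measurable_fun_of_hist mZ); exact: (measurable_hist_psum mg mn).
rewrite (_ : psum _ _ _ _ = cst 0); first exact: measurable_cst.
by apply/funext => w; rewrite /psum big_geq// ltnW.
Qed.

(** With [phi] the norm, this is the function [h_j] of the overview. *)
Definition aval (phi : 'rV[R]_r -> \bar R) (j : nat) (s : 'rV[R]_r) : \bar R :=
  (\int[PA]_w phi (s + S j w)%R)%E.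

(** Times 1 to [rt w], so the visit that ends the block is included and the starting point is not;
    the value is 0 when there is no return. *)
Definition block (w : Omega) : 'rV[R]_r := S (rt w) w.

Lemma measurable_block : measurable_fun setT block.
Proof.
apply: (@measurable_fun_natdep _ _ _ _ rt (fun n => S n)).
  by move=> i; exact: measurable_rt.
by move=> i; exact: measurable_psum.
Qed.

Lemma aval_ge0 phi j s : (forall x, 0 <= phi x)%E -> (0 <= aval phi j s)%E.
Proof. by move=> p0; exact: integral_ge0. Qed.

Lemma measurable_aval phi j : (forall x, 0 <= phi x)%E ->
  measurable_fun setT phi -> measurable_fun setT (aval phi j).
Proof.
move=> p0 mp.
apply: (@measurable_fun_fubini_tonelli_F _ _ _ Omega R PA (fun z : 'rV[R]_r * Omega => phi (z.1 + S j z.2))).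
  apply: (measurableT_comp mp); apply: measurable_rowD => //.
  exact: (measurableT_comp (measurable_psum 0 j) measurable_snd).
by move=> z.
Qed.

Let Vj (phi : 'rV[R]_r -> \bar R) j := iter j (aop k g) (fun z => phi z.2).

Let atom_int (f : T -> \bar R) x y : A x -> A y ->
  (\int[k x]_z f z = \int[k y]_z f z)%E.
Proof. by move=> Ax Ay; apply: eq_measure_integral => B mB _; exact: atom. Qed.

Let Vj_atom phi j x y s : A x -> A y -> Vj phi j (x, s) = Vj phi j (y, s).
Proof. by case: j => [//|j] Ax Ay; rewrite /Vj /= /aop /=; exact: atom_int. Qed.

(** Time 0 does not enter the sum, and the kernel is constant on the atom, so the starting point
    matters only through being in [A]; [muA] is carried by [A]. *)
Let aval_Vj phi j x s : (forall x, 0 <= phi x)%E -> measurable_fun setT phi ->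
  A x -> aval phi j s = Vj phi j (x, s).
Proof.
move=> p0 mp Ax.
have mp2 : measurable_fun setT (fun z : T * 'rV[R]_r => phi z.2).
  exact: (measurableT_comp mp measurable_snd).
have mT : measurable ([set: Omega] : set (hist Z 0)) by exact: measurableT.
have h := @markov_psum _ _ _ _ _ PA k muA Z MCA r g mg setT 0 0 j
  (fun z => phi z.2) s (leqnn 0) mT mp2 (fun z => p0 _).
rewrite /aval; transitivity (\int[PA]_w phi (s + psum Z g 0 (0 + j) w)%R)%E.
  by rewrite add0n.
rewrite /= in h; rewrite h.
have mV : measurable_fun setT (fun w => Vj phi j (Z 0 w, s + psum Z g 0 0 w)).
  apply: (measurableT_comp (measurable_iter_aop k mg j mp2 (fun z => p0 _))).
  apply: measurable_fun_pair => //; apply: measurable_rowD => //.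
  exact: measurable_psum.
have V0 z : (0 <= Vj phi j z)%E by apply: iter_aop_ge0.
transitivity (\int[PA]_w Vj phi j (x, s))%E; last first.
  by rewrite int_cst.
apply: ge0_ae_eq_integral; [exact: measurableT|exact: mV|exact: measurable_cst|
  by move=> w _; exact: V0|by move=> w _; exact: V0|].
exists (Z 0%N @^-1` (~` A)); split.
- by rewrite -[X in measurable X]setTI; apply: mZ => //; exact: measurableC.
- have mZA : measurable (Z 0%N @^-1` A) by rewrite -[X in measurable X]setTI; exact: mZ.
  have := probability_setC PA mZA; case: MCA => _ init _; rewrite init// muA1 subee//.
- move=> w /= /not_implyP[_ h1] Aw; apply: h1.
  by rewrite psum_nil /= addr0; exact: Vj_atom.
Qed.

Section regeneration_time.
Variables (P : probability Omega R) (mu : set T -> \bar R).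
Hypothesis MC : markov_chain P (fun x => k x : set T -> \bar R) mu Z.

(** The conditional mean of [phi (s + S m)] given the path up to the first regeneration; without a
    regeneration strictly before [m] nothing is averaged. *)
Definition regen (phi : 'rV[R]_r -> \bar R) (m : nat) (s : 'rV[R]_r) (w : Omega) : \bar R :=
  if (0 < rt w < m)%N then aval phi (m - rt w) (s + block w) else phi (s + S m w).

Lemma regen_ge0 phi m s w : (forall x, 0 <= phi x)%E -> (0 <= regen phi m s w)%E.
Proof. by move=> p0; rewrite /regen; case: ifP => // _; exact: aval_ge0. Qed.

Lemma measurable_regen phi m s : (forall x, 0 <= phi x)%E -> measurable_fun setT phi ->
  measurable_fun setT (regen phi m s).
Proof.
move=> p0 mp.
apply: (@measurable_fun_natdep _ _ _ _ rt (fun n w => if (0 < n < m)%N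
   then aval phi (m - n) (s + block w) else phi (s + S m w))).
  by move=> i; exact: measurable_rt.
move=> i; case: (0 < i < m)%N.
  apply: (measurableT_comp (measurable_aval _ p0 mp)); apply: measurable_rowD => //.
  exact: measurable_block.
apply: (measurableT_comp mp); apply: measurable_rowD => //.
exact: measurable_psum.
Qed.

(** The strong Markov property at [rt], obtained by cutting along the events [rt = n], each of which
    belongs to [hist Z n]. The initial law is arbitrary: it is used both for the atom and for the
    law of the theorem. *)
Lemma regeneration (phi : 'rV[R]_r -> \bar R) m s :
  (forall x, 0 <= phi x)%E -> measurable_fun setT phi ->
  (\int[P]_w phi (s + S m w)%R = \int[P]_w regen phi m s w)%E.
Proof.
move=> p0 mp.
have mp2 : measurable_fun setT (fun z : T * 'rV[R]_r => phi z.2).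
  exact: (measurableT_comp mp measurable_snd).
have mR n : measurable (rt @^-1` [set n]) by exact: measurable_rt.
have cover : [set: Omega] = \bigcup_n rt @^-1` [set n].
  by apply/esym; rewrite -subTset => w _; exists (rt w).
have tr : trivIset setT (fun n => rt @^-1` [set n]).
  by apply/trivIsetP => i j _ _ ij; apply/seteqP; split => // w [/= -> /eqP]; rewrite (negbTE ij).
have mS : measurable_fun setT (fun w => phi (s + S m w)).
  apply: (measurableT_comp mp); apply: measurable_rowD => //.
  exact: measurable_psum.
have mY : measurable_fun setT (regen phi m s) by exact: measurable_regen.
rewrite cover in mS mY *; rewrite (ge0_integral_bigcup P mR mS (fun w _ => p0 _) tr).
rewrite (ge0_integral_bigcup P mR mY (fun w _ => regen_ge0 m s w p0) tr).
apply: eq_eseriesr => n _.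
have [/andP[n0 nm]|nn] := boolP (0 < n < m)%N; last first.
  by apply: eq_integral => w /set_mem /=; rewrite /regen => ->; rewrite (negbTE nn).
have := @markov_psum _ _ _ _ _ P k mu Z MC r g mg (rt @^-1` [set n]) 0 n (m - n)
  (fun z => phi z.2) s (leq0n _) (measurable_hist_rt mA n0) mp2 (fun z => p0 _).
rewrite subnKC ?(ltnW nm)//= => ->.
apply: eq_integral => w /set_mem /= rn.
rewrite /regen rn n0 nm /= /block rn (aval_Vj _ _ p0 mp (x := Z n w))//.
have [_ + _] := @rt_gt0 _ _ _ _ Z A w (ltac:(by rewrite rn)).
by rewrite rn.
Qed.

End regeneration_time.

Section symmetrization.
Local Open Scope ereal_scope.
Implicit Types phi : 'rV[R]_r -> \bar R.

Let h2 : \bar R := (2^-1)%:E.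
Let h2_ge0 : 0 <= h2. Proof. by rewrite lee_fin. Qed.

Definition flip phi (a s : 'rV[R]_r) : \bar R := h2 * phi (s + a)%R + h2 * phi (s - a)%R.

Lemma flip_ge0 phi a s : (forall x, 0 <= phi x) -> 0 <= flip phi a s.
Proof. by move=> p0; rewrite adde_ge0// mule_ge0. Qed.

Lemma measurable_flip d' (V : measurableType d') phi (a b : V -> 'rV[R]_r) :
  measurable_fun setT phi -> measurable_fun setT a -> measurable_fun setT b ->
  measurable_fun setT (fun x => flip phi (a x) (b x)).
Proof.
move=> mp ma mb; apply: emeasurable_funD; apply: measurable_funeM.
  by apply: (measurableT_comp mp); exact: measurable_rowD.
apply: (measurableT_comp mp); apply: measurable_rowD => //.
under eq_fun do rewrite -scaleN1r.
exact: measurable_rowZ.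
Qed.

Let mblock2 : measurable_fun setT (fun w => 2 *: block w)%R.
Proof. exact: measurable_rowZ measurable_block. Qed.

(** Adds twice a block with a random sign; the factor 2 comes from the midpoint convexity in
    [int_block_le_symop]. *)
Definition symop phi (s : 'rV[R]_r) : \bar R := \int[PA]_w flip phi (2 *: block w)%R s.

Lemma symop_ge0 phi s : (forall x, 0 <= phi x) -> 0 <= symop phi s.
Proof. by move=> p0; apply: integral_ge0 => w _; exact: flip_ge0. Qed.

Lemma measurable_symop phi : (forall x, 0 <= phi x) ->
  measurable_fun setT phi -> measurable_fun setT (symop phi).
Proof.
move=> p0 mp.
apply: (@measurable_fun_fubini_tonelli_F _ _ _ Omega R PA
  (fun z : 'rV[R]_r * Omega => flip phi (2 *: block z.2)%R z.1)).
  apply: measurable_flip => //.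
  exact: (measurableT_comp mblock2 measurable_snd).
by move=> z; exact: flip_ge0.
Qed.

(* The convexity that survives averaging: midpoint convexity and Jensen's
   inequality for the block law. *)
Definition sym_class phi := [/\ measurable_fun setT phi, (forall s, 0 <= phi s),
  (forall s a, phi s <= flip phi a s) &
  (forall s, phi s <= \int[PA]_w phi (s - block w)%R)].

(** Both convexity properties are inequalities between averages over translations, and these commute
    with the average defining [symop]; Tonelli gives the exchange for the second. *)
Lemma sym_class_symop phi : sym_class phi -> sym_class (symop phi).
Proof.
move=> [mp p0 pm pJ].
have msub d' (V : measurableType d') (a b : V -> 'rV[R]_r) :
    measurable_fun setT a -> measurable_fun setT b -> measurable_fun setT (fun x => a x - b x)%R.
  move=> ma mb; apply: measurable_rowD => //.
  by under eq_fun do rewrite -scaleN1r; exact: measurable_rowZ.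
split.
- exact: measurable_symop.
- by move=> s; exact: symop_ge0.
- move=> s a; rewrite /flip /symop.
  have mf t : measurable_fun setT (fun w => flip phi (2 *: block w)%R t) by exact: measurable_flip.
  have f0 t w : 0 <= flip phi (2 *: block w)%R t by exact: flip_ge0.
  rewrite -!(ge0_intZl PA measurableT (mf _) (f0 _))//.
  rewrite -(ge0_intD PA measurableT (measurable_funeM _ (mf _)) _ (measurable_funeM _ (mf _))); last 2 first.
  - by move=> w; rewrite mule_ge0.
  - by move=> w; rewrite mule_ge0.
  apply: (ge0_int_le PA measurableT (mf _)) => //.
    by apply: emeasurable_funD; apply: measurable_funeM.
  move=> w; rewrite {1}/flip.
  apply: (@le_trans _ _ (h2 * flip phi a (s + 2 *: block w)%R + h2 * flip phi a (s - 2 *: block w)%R)).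
    by apply: leeD; apply: lee_wpmul2l.
  rewrite /flip !ge0_muleDr ?mule_ge0// addeACA.
  by rewrite (addrAC s _ a) (addrAC s _ a) (addrAC s _ (- a)%R) (addrAC s _ (- a)%R).
- move=> s; rewrite /symop.
  have mF : measurable_fun setT (fun z : Omega * Omega => flip phi (2 *: block z.1)%R (s - block z.2)%R).
    apply: measurable_flip => //; first exact: (measurableT_comp mblock2 measurable_fst).
    apply: msub => //; exact: (measurableT_comp measurable_block measurable_snd).
  have F0 z : 0 <= flip phi (2 *: block z.1)%R (s - block z.2)%R by exact: flip_ge0.
  rewrite -(@fubini_tonelli _ _ _ _ _ PA PA _ mF)//=.
  apply: (ge0_int_le PA measurableT).
  + exact: measurable_flip.
  + exact: (@measurable_fun_fubini_tonelli_F _ _ _ _ _ PA _ mF).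
  + by move=> w; exact: flip_ge0.
  move=> w; rewrite {2}/flip.
  have mfb t : measurable_fun setT (fun y => phi (s - block y + t)%R).
    apply: (measurableT_comp mp); apply: measurable_rowD => //.
    by apply: msub => //; exact: measurable_block.
  rewrite (ge0_intD PA measurableT (measurable_funeM _ (mfb _)) _ (measurable_funeM _ (mfb _))); last 2 first.
  + by move=> y; rewrite mule_ge0.
  + by move=> y; rewrite mule_ge0.
  rewrite !(ge0_intZl PA measurableT (mfb _))// /flip.
  have e t : phi (s + t)%R <= \int[PA]_y phi (s - block y + t)%R.
    apply: (le_trans (pJ _)); rewrite le_eqVlt; apply/orP; left; apply/eqP.
    by apply: eq_integral => y _; rewrite addrAC.
  by apply: leeD; apply: lee_wpmul2l.
Qed.

Lemma le_symop phi s : sym_class phi -> phi s <= symop phi s.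
Proof.
move=> [mp p0 pm pJ].
rewrite -[leLHS](int_cst PA).
apply: (ge0_int_le PA measurableT) => //; exact: measurable_flip.
Qed.

(** Symmetrization with the independent copy replaced by a second integral. Jensen's inequality
    inserts [- block y], and [s + block w - block y] is the midpoint of [s + 2 *: block w] and
    [s - 2 *: block y], which involve one block each. *)
Lemma int_block_le_symop phi s : sym_class phi ->
  \int[PA]_w phi (s + block w)%R <= symop phi s.
Proof.
move=> [mp p0 pm pJ].
have msub d' (V : measurableType d') (a b : V -> 'rV[R]_r) :
    measurable_fun setT a -> measurable_fun setT b -> measurable_fun setT (fun x => a x - b x)%R.
  move=> ma mb; apply: measurable_rowD => //.
  by under eq_fun do rewrite -scaleN1r; exact: measurable_rowZ.
have mb := measurable_block.
have m1 (w : Omega) : measurable_fun setT (fun y => phi (s + block w - block y)%R).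
  by apply: (measurableT_comp mp); exact: msub.
have mS : measurable_fun setT (fun w => phi (s + 2 *: block w)%R).
  by apply: (measurableT_comp mp); exact: measurable_rowD.
have mD : measurable_fun setT (fun w => phi (s - 2 *: block w)%R).
  by apply: (measurableT_comp mp); exact: msub.
apply: (@le_trans _ _ (\int[PA]_w \int[PA]_y phi (s + block w - block y)%R)).
  apply: (ge0_int_le PA measurableT) => //.
    by apply: (measurableT_comp mp); exact: measurable_rowD.
  apply: (@measurable_fun_fubini_tonelli_F _ _ _ _ _ PA (fun z : Omega * Omega => phi (s + block z.1 - block z.2)%R)) => //.
  apply: (measurableT_comp mp); apply: msub; last exact: (measurableT_comp mb measurable_snd).
  by apply: measurable_rowD => //; exact: (measurableT_comp mb measurable_fst).
apply: (@le_trans _ _ (\int[PA]_w (h2 * phi (s + 2 *: block w)%R + \int[PA]_y (h2 * phi (s - 2 *: block y)%R)))).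
  apply: (ge0_int_le PA measurableT).
  - apply: (@measurable_fun_fubini_tonelli_F _ _ _ _ _ PA (fun z : Omega * Omega => phi (s + block z.1 - block z.2)%R)) => //.
    apply: (measurableT_comp mp); apply: msub; last exact: (measurableT_comp mb measurable_snd).
    by apply: measurable_rowD => //; exact: (measurableT_comp mb measurable_fst).
  - by apply: emeasurable_funD => //; apply: measurable_funeM; exact: mS.
  - by move=> w; exact: integral_ge0.
  move=> w.
  have -> : h2 * phi (s + 2 *: block w)%R = \int[PA]_y (h2 * phi (s + 2 *: block w)%R).
    by rewrite int_cst.
  rewrite -(ge0_intD PA measurableT (measurable_cst _) _ (measurable_funeM _ mD)); last 2 first.
  - by move=> y; rewrite mule_ge0.
  - by move=> y; rewrite mule_ge0.
  apply: (ge0_int_le PA measurableT) => //.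
    by apply: emeasurable_funD => //; apply: measurable_funeM; exact: mD.
  (* Adding and subtracting [block w + block y] yields the two endpoints. *)
  move=> y; apply: (le_trans (pm _ (block w + block y)%R)); rewrite /flip.
  rewrite le_eqVlt; apply/orP; left; apply/eqP; congr (h2 * phi _ + h2 * phi _).
    by apply/rowP => i; rewrite !mxE; lra.
  by apply/rowP => i; rewrite !mxE; lra.
rewrite (ge0_intD PA measurableT (measurable_funeM _ mS) _ (measurable_cst _)); last 2 first.
- by move=> y; rewrite mule_ge0.
- by move=> y; apply: integral_ge0 => z _; rewrite mule_ge0.
rewrite int_cst /symop /flip.
rewrite -(ge0_intD PA measurableT (measurable_funeM _ mS) _ (measurable_funeM _ mD))//.
- by move=> y; rewrite mule_ge0.
- by move=> y; rewrite mule_ge0.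
Qed.

End symmetrization.
Section expectation.
Variables (B Kc : R) (EA2 : R).
Hypotheses (B0 : 0 <= B) (gB : forall x, row_norm (g x) <= B).
Hypothesis Kc0 : 0 <= Kc.
Hypothesis det : forall l : seq Omega,
  ravg (map block l) (@row_norm R r) 0 <= Kc * Num.sqrt (\sum_(w <- l) (rt w)%:R ^+ 2).
Hypothesis rt2 : (\int[PA]_w ((rt w)%:R ^+ 2)%:E = EA2%:E)%E.
Hypothesis rt_pos : PA (rt @^-1` [set 0%N]) = 0%E.
Hypothesis centred : forall i, PA.-integrable setT (fun w => (block w ord0 i)%:E) /\
  (\int[PA]_w (block w ord0 i)%:E = 0)%E.

Let N : 'rV[R]_r -> \bar R := fun s => (row_norm s)%:E.

Lemma measurable_rtR (h : nat -> R) : measurable_fun setT (fun w => h (rt w)).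
Proof.
apply: (@measurable_fun_natdep _ _ _ _ rt (fun n _ => h n)) => // i.
exact: measurable_rt.
Qed.

Let mN : measurable_fun setT N.
Proof. by apply/measurable_EFinP; exact: measurable_row_norm. Qed.

Let N0 s : (0 <= N s)%E. Proof. by rewrite lee_fin row_norm_ge0. Qed.

Lemma row_norm_psum m n w : row_norm (psum Z g m n w) <= B * (n - m)%:R.
Proof.
have [mn|nm] := leqP n m.
  by rewrite /psum big_geq ?ltnS// row_norm0 mulr_ge0.
elim: n nm => [//|n IH]; rewrite ltnS leq_eqVlt => /orP[/eqP ->|mn].
  by rewrite psumS// psum_nil add0r subSnn mulr1.
rewrite psumS ?(ltnW mn)// (le_trans (row_normD _ _))// subSn ?(ltnW mn)// -natr1 mulrDr mulr1.
by rewrite lerD// IH.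
Qed.

Lemma psum_cat m n w : (m <= n)%N -> S n w = S m w + psum Z g m n w.
Proof. by move=> mn; rewrite /psum -big_cat_nat. Qed.

(** The Jensen part is checked on coordinates: [s ord0 i] is the mean of that coordinate of
    [s - block w], because the blocks are centred, and the norm is the largest coordinate in
    absolute value. *)
Lemma sym_class_norm : sym_class N.
Proof.
split => //.
- move=> s a; rewrite /flip /N -!EFinM -EFinD lee_fin.
  have := row_normD (s + a) (s - a).
  have -> : s + a + (s - a) = 2 *: s by apply/rowP => i; rewrite !mxE; lra.
  by rewrite row_normZ//; lra.
- move=> s.
  have mNs : measurable_fun setT (fun w => N (s - block w)).
    apply: (measurableT_comp mN); apply: measurable_rowD => //.
    by under eq_fun do rewrite -scaleN1r; apply: measurable_rowZ; exact: measurable_block.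
  have I0 : (0 <= \int[PA]_w N (s - block w))%E by exact: integral_ge0.
  have key i : (`|s ord0 i|%:E <= \int[PA]_w N (s - block w))%E.
    have [inti c0] := centred i.
    have ints : PA.-integrable setT (fun w => (s ord0 i)%:E - (block w ord0 i)%:E)%E.
      by apply: integrableB => //; exact: finite_measure_integrable_cst.
    have E : (\int[PA]_w ((s ord0 i)%:E - (block w ord0 i)%:E) = (s ord0 i)%:E)%E.
      rewrite integralB//; last exact: finite_measure_integrable_cst.
      by rewrite c0 sube0 int_cst.
    rewrite -abse_EFin -E; apply: (le_trans (le_abse_integral _ _ _)) => //.
      exact: measurable_int ints.
    apply: ge0_le_integral => //.
    + by apply: measurableT_comp => //; exact: measurable_int ints.
    + by move=> w _; rewrite /N -EFinB lee_fin -(_ : (s - block w) ord0 i = s ord0 i - block w ord0 i) ?ler_row_norm// !mxE.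
  move: I0 key; move: (\int[PA]_w N (s - block w))%E => [y| |]; [|by move=> _ _; rewrite leey|by rewrite leeNy_eq].
  rewrite !lee_fin => y0 key; apply: row_norm_le => // i.
Qed.

Lemma sym_class_iter j : sym_class (iter j symop N).
Proof. by elim: j => [|j IH] /=; [exact: sym_class_norm|exact: sym_class_symop]. Qed.

Lemma iter_symop_nd i j s : (i <= j)%N -> (iter i symop N s <= iter j symop N s)%E.
Proof.
move=> /subnK <-; elim: (j - i)%N => [//|n IH]; rewrite addSn /=.
by rewrite (le_trans IH)// le_symop//; exact: sym_class_iter.
Qed.

(* The total error made when the last, incomplete block is replaced by a
   complete one. *)
Definition overshoot (m : nat) : \bar R :=
  (\int[PA]_w (B * (rt w)%:R * (minn (rt w) m)%:R)%:E)%E.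

(** [minn (rt w) m] counts the [j < m] with [j < rt w]: going from horizon [m] to [m.+1] adds the
    cost of a block longer than [m]. The total stays below the second moment whatever the
    horizon. *)
Lemma overshootS m : (overshoot m.+1 = overshoot m +
  \int[PA]_w (B * (rt w)%:R * ((m < rt w)%N : nat)%:R)%:E)%E.
Proof.
rewrite /overshoot -(ge0_intD PA measurableT); last 4 first.
- by apply/measurable_EFinP; exact: (measurable_rtR (fun n => B * n%:R * (minn n m)%:R)).
- by move=> w; rewrite lee_fin !mulr_ge0.
- by apply/measurable_EFinP; exact: (measurable_rtR (fun n => B * n%:R * ((m < n)%N : nat)%:R)).
- by move=> w; rewrite lee_fin !mulr_ge0.
apply: eq_integral => w _; rewrite -EFinD -mulrDr -natrD; congr ((_ * _%:R)%:E).
by case: (ltnP m (rt w)) => h; rewrite ?addn1 ?addn0 /minn; case: ltnP => //; case: ltnP => //; lia.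
Qed.

Lemma overshoot_le m : (overshoot m <= (B * EA2)%:E)%E.
Proof.
rewrite EFinM -rt2 -(ge0_intZl PA measurableT)//; last first.
  by apply/measurable_EFinP; exact: (measurable_rtR (fun n => n%:R ^+ 2)).
apply: (ge0_int_le PA measurableT).
- by apply/measurable_EFinP; exact: (measurable_rtR (fun n => B * n%:R * (minn n m)%:R)).
- apply/measurable_EFinP; exact: (measurable_rtR (fun n => B * n%:R ^+ 2)).
- by move=> w; rewrite lee_fin !mulr_ge0.
move=> w; rewrite -EFinM lee_fin expr2 mulrA ler_wpM2l ?mulr_ge0// ler_nat.
exact: geq_minl.
Qed.

Lemma overshoot_nd i j : (i <= j)%N -> (overshoot i <= overshoot j)%E.
Proof.
move=> ij; apply: (ge0_int_le PA measurableT).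
- by apply/measurable_EFinP; exact: (measurable_rtR (fun n => B * n%:R * (minn n i)%:R)).
- by apply/measurable_EFinP; exact: (measurable_rtR (fun n => B * n%:R * (minn n j)%:R)).
- by move=> w; rewrite lee_fin !mulr_ge0.
by move=> w; rewrite lee_fin ler_wpM2l ?mulr_ge0// ler_nat leq_min geq_minl/= (leq_trans (geq_minr _ _)).
Qed.

Lemma rt_pos_ae (Q : Omega -> Prop) : (forall w, (0 < rt w)%N -> Q w) -> {ae PA, forall w, Q w}.
Proof.
move=> h; exists (rt @^-1` [set 0%N]); split => //; first exact: measurable_rt.
by move=> w /= nQ; apply/eqP; rewrite -leqn0 leqNgt; apply/negP => /h.
Qed.

(** Strong induction on the horizon. A first block of length at most [m] leaves a horizon of at most
    [m], and both terms are nondecreasing in the horizon, so the random remainder can be replaced by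
    [m]; a longer block is completed at the cost counted by [overshoot]. *)
Lemma aval_le m s : (aval N m s <= iter m symop N s + overshoot m)%E.
Proof.
have ov0 j : (0 <= overshoot j)%E by apply: integral_ge0 => w _; rewrite lee_fin !mulr_ge0.
elim/ltn_ind: m s => -[|m] IH s.
  rewrite /aval; under eq_integral do rewrite psum_nil /= addr0.
  by rewrite int_cst leeDl.
have [mI I0 _ _] := sym_class_iter m.
rewrite /aval (regeneration MCA)//.
have mIb : measurable_fun setT (fun w => iter m symop N (s + block w)).
  by apply: (measurableT_comp mI); apply: measurable_rowD => //; exact: measurable_block.
have mind : measurable_fun setT (fun w => (B * (rt w)%:R * ((m < rt w)%N : nat)%:R)%:E).
  by apply/measurable_EFinP; exact: (measurable_rtR (fun n => B * n%:R * ((m < n)%N : nat)%:R)).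
have ind0 w : (0 <= (B * (rt w)%:R * ((m < rt w)%N : nat)%:R)%:E)%E by rewrite lee_fin !mulr_ge0.
apply: (@le_trans _ _ (\int[PA]_w (iter m symop N (s + block w)%R + (overshoot m +
   (B * (rt w)%:R * ((m < rt w)%N : nat)%:R)%:E)))%E).
  apply: ae_ge0_le_integral => //.
  - by move=> w _; exact: regen_ge0.
  - exact: measurable_regen.
  - by move=> w _; apply: adde_ge0 => //; exact: adde_ge0.
  - by apply: emeasurable_funD => //; apply: emeasurable_funD.
  apply: rt_pos_ae => w rw _; rewrite /regen rw/= ltnS.
  have [rm|mr] := leqP (rt w) m.
    rewrite mulr0 adde0; apply: (le_trans (IH _ _ _)); first by lia.
    by apply: leeD; [apply: iter_symop_nd|apply: overshoot_nd]; lia.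
  rewrite mulr1.
  apply: (@le_trans _ _ (N (s + block w) + (B * (rt w)%:R)%:E)%E).
    (* The sum up to [m.+1] is the whole block minus its part [p] after that time, of norm at most
       [B * rt w]. *)
    rewrite /N -EFinD lee_fin /block (psum_cat w mr).
    set p := psum Z g m.+1 (rt w) w.
    have -> : s + S m.+1 w = (s + (S m.+1 w + p)) - p by rewrite addrA addrK.
    rewrite (le_trans (row_normD _ _))// row_normN lerD2l.
    by rewrite (le_trans (row_norm_psum _ _ _))// ler_wpM2l// ler_nat leq_subr.
  by apply: leeD; [exact: (iter_symop_nd (i := 0))|rewrite leeDr].
rewrite (ge0_intD PA measurableT mIb (fun w => I0 _) _ _); last 2 first.
- by apply: emeasurable_funD.
- by move=> w; rewrite adde_ge0.
rewrite (ge0_intD PA measurableT (measurable_cst _) (fun w => ov0 m) mind ind0) int_cst -overshootS.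
by apply: leeD => //=; apply: int_block_le_symop; exact: sym_class_iter.
Qed.

Fixpoint eravg (l : seq 'rV[R]_r) (phi : 'rV[R]_r -> \bar R) : 'rV[R]_r -> \bar R :=
  if l is a :: l' then flip (eravg l' phi) a else phi.

Lemma eravg_EFin l (f : 'rV[R]_r -> R) s : eravg l (EFin \o f) s = (ravg l f s)%:E.
Proof.
elim: l s => [//|a l IH] s /=; rewrite /flip !IH -!EFinM -EFinD; congr EFin; lra.
Qed.

Lemma eravg_ge0 l phi s : (forall x, 0 <= phi x)%E -> (0 <= eravg l phi s)%E.
Proof. by move=> p0; elim: l s => [//|a l IH] s; exact: flip_ge0. Qed.

Lemma flipC phi a b s : (forall x, 0 <= phi x)%E -> flip (flip phi a) b s = flip (flip phi b) a s.
Proof.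
move=> p0; rewrite /flip !ge0_muleDr ?mule_ge0 ?lee_fin// addeACA.
by rewrite (addrAC s b a) (addrAC s b (- a)) (addrAC s (- b) a) (addrAC s (- b) (- a)).
Qed.

(** The signs can be drawn in any order; the freshly drawn block then counts as the head of the list
    in [iter_symop_le]. *)
Lemma eravg_flip l phi a s : (forall x, 0 <= phi x)%E ->
  eravg l (flip phi a) s = flip (eravg l phi) a s.
Proof.
move=> p0; elim: l s => [//|b l IH] s /=.
have -> : eravg l (flip phi a) = flip (eravg l phi) a by apply/funext.
by apply: flipC => x; exact: eravg_ge0.
Qed.

Lemma measurable_eravg l (F : Omega -> 'rV[R]_r -> \bar R) s :
  (forall s, measurable_fun setT (F ^~ s)) ->
  measurable_fun setT (fun w => eravg l (F w) s).
Proof.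
move=> mF; elim: l s => [//|a l IH] s /=; rewrite /flip.
by apply: emeasurable_funD; apply: measurable_funeM; exact: IH.
Qed.

Lemma eravg_int l (F : Omega -> 'rV[R]_r -> \bar R) s :
  (forall s, measurable_fun setT (F ^~ s)) -> (forall w s, 0 <= F w s)%E ->
  eravg l (fun s => \int[PA]_w F w s)%E s = (\int[PA]_w eravg l (F w) s)%E.
Proof.
move=> mF F0; elim: l s => [//|a l IH] s /=; rewrite /flip !IH.
have m1 t := measurable_eravg l t mF.
have p1 t w : (0 <= eravg l (F w) t)%E by exact: eravg_ge0.
rewrite (ge0_intD PA measurableT (measurable_funeM _ (m1 _)) _ (measurable_funeM _ (m1 _)) _); last 2 first.
- by move=> w; rewrite mule_ge0// lee_fin.
- by move=> w; rewrite mule_ge0// lee_fin.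
by rewrite !(ge0_intZl PA measurableT (m1 _) (p1 _)).
Qed.

Lemma sqrt_tangent (c x mu : R) : 0 <= c -> 0 <= x -> 0 < mu ->
  Num.sqrt (c + x) <= Num.sqrt (c + mu) + (x - mu) / (2 * Num.sqrt (c + mu)).
Proof.
move=> c0 x0 mu0; set q := Num.sqrt (c + mu); set y := Num.sqrt (c + x).
have q0 : 0 < q by rewrite sqrtr_gt0; lra.
have qE : q ^+ 2 = c + mu by rewrite sqr_sqrtr//; lra.
have yE : y ^+ 2 = c + x by rewrite sqr_sqrtr//; lra.
have h : 0 <= (y - q) ^+ 2 by rewrite sqr_ge0.
rewrite -(ler_pM2r (_ : 0 < 2 * q)); last by rewrite mulr_gt0.
have -> : (q + (x - mu) / (2 * q)) * (2 * q) = 2 * q * q + (x - mu).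
  by field; rewrite gt_eqF.
move: h qE yE; rewrite !expr2; lra.
Qed.

Hypothesis EA2_ge1 : 1 <= EA2.

(* The blocks are drawn one at a time, [l] listing those already drawn; the
   tangent of the square root at the mean of tau^2 absorbs the next one. *)
Lemma iter_symop_le n l :
  (eravg (map (fun w => 2 *: block w) l) (iter n symop N) 0 <=
   (2 * Kc * Num.sqrt (\sum_(w <- l) (rt w)%:R ^+ 2 + n%:R * EA2))%:E)%E.
Proof.
elim: n l => [|n IH] l.
  rewrite eravg_EFin lee_fin mul0r addr0.
  have -> : map (fun w => 2 *: block w) l = map (fun s => 2 *: s) (map block l) by rewrite -map_comp.
  rewrite -[X in ravg _ _ X](scaler0 _ 2) ravg_map; last 2 first.
  - by move=> a b; rewrite scalerDr.
  - by move=> a; rewrite scalerN.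
  have -> : (@row_norm R r \o (fun s => 2 *: s)) = (fun s => 2 * row_norm s).
    by apply/funext => s /=; rewrite row_normZ.
  by rewrite ravgZ -mulrA ler_pM2l.
have [mI I0 _ _] := sym_class_iter n.
rewrite /= /symop eravg_int; last 2 first.
- by move=> s; apply: measurable_flip => //; apply: measurable_rowZ; exact: measurable_block.
- by move=> w s; exact: flip_ge0.
set c := \sum_(w <- l) (rt w)%:R ^+ 2 + n%:R * EA2.
have c0 : 0 <= c.
  by apply: addr_ge0; [apply: sumr_ge0 => w _; rewrite sqr_ge0|rewrite mulr_ge0// (le_trans ler01 EA2_ge1)].
have mrt2 : measurable_fun setT (fun w => ((rt w)%:R ^+ 2)%:E : \bar R).
  by apply/measurable_EFinP; exact: (measurable_rtR (fun n => n%:R ^+ 2)).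
apply: (@le_trans _ _ (\int[PA]_w (2 * Kc * Num.sqrt (c + (rt w)%:R ^+ 2))%:E)%E).
  apply: (ge0_int_le PA measurableT).
  - apply: measurable_eravg => s.
    by apply: measurable_flip => //; apply: measurable_rowZ; exact: measurable_block.
  - by apply/measurable_EFinP; exact: (measurable_rtR (fun n => 2 * Kc * Num.sqrt (c + n%:R ^+ 2))).
  - by move=> w; apply: eravg_ge0 => s; exact: flip_ge0.
  move=> w; rewrite eravg_flip//.
  have := IH (w :: l); rewrite /= big_cons /c => h; apply: (le_trans h).
  by rewrite le_eqVlt; apply/orP; left; apply/eqP; congr (_ * Num.sqrt _)%:E; lra.
set q := Num.sqrt (c + EA2).
have q0 : 0 < q by rewrite sqrtr_gt0 (ltr_wpDl c0)// (lt_le_trans ltr01 EA2_ge1).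
have Kc2 : 0 <= 2 * Kc by rewrite mulr_ge0.
have -> : \sum_(w <- l) (rt w)%:R ^+ 2 + n.+1%:R * EA2 = c + EA2.
  by rewrite /c -[n.+1%:R]natr1; lra.
rewrite -/q.
(* The tangent has the negative constant term [- t]. It is moved to the other side so that only
   nonnegative functions are integrated, and cancels once the second moment is inserted. *)
pose t := EA2 / (2 * q); have t0 : 0 <= t by rewrite divr_ge0// ?(le_trans ler01 EA2_ge1)// mulr_ge0// ltW.
have q2 : 0 <= (2 * q)^-1 by rewrite invr_ge0 mulr_ge0// ltW.
have key : (\int[PA]_w ((2 * Kc * Num.sqrt (c + (rt w)%:R ^+ 2))%:E + (2 * Kc * t)%:E) <=
   \int[PA]_w ((2 * Kc * q)%:E + (2 * Kc * (2 * q)^-1)%:E * ((rt w)%:R ^+ 2)%:E))%E.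
  apply: (ge0_int_le PA measurableT).
  - apply: emeasurable_funD => //.
    by apply/measurable_EFinP; exact: (measurable_rtR (fun n => 2 * Kc * Num.sqrt (c + n%:R ^+ 2))).
  - by apply: emeasurable_funD => //; exact: measurable_funeM.
  - by move=> w; rewrite -EFinD lee_fin addr_ge0// mulr_ge0// sqrtr_ge0.
  move=> w; rewrite -EFinM -!EFinD lee_fin.
  have := @sqrt_tangent c ((rt w)%:R ^+ 2) EA2 c0 (sqr_ge0 _) (lt_le_trans ltr01 EA2_ge1).
  rewrite -/q => h; have := ler_wpM2l Kc2 h; rewrite mulrBl -/t; lra.
move: key; rewrite (ge0_intD PA measurableT _ _ (measurable_cst _)); last 3 first.
- by apply/measurable_EFinP; exact: (measurable_rtR (fun n => 2 * Kc * Num.sqrt (c + n%:R ^+ 2))).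
- by move=> w; rewrite lee_fin mulr_ge0// sqrtr_ge0.
- by move=> w; rewrite lee_fin mulr_ge0.
rewrite (ge0_intD PA measurableT (measurable_cst _) _ (measurable_funeM _ mrt2)); last 2 first.
- by move=> w; rewrite lee_fin mulr_ge0// ltW.
- by move=> w; rewrite -EFinM lee_fin !mulr_ge0// sqr_ge0.
rewrite (ge0_intZl PA measurableT mrt2)//; last by rewrite mulr_ge0.
rewrite rt2 !int_cst -EFinM.
have -> : 2 * Kc * (2 * q)^-1 * EA2 = 2 * Kc * t by rewrite /t; lra.
by rewrite leeD2rE.
Qed.

Lemma aval_norm_le m : (aval N m 0 <= (2 * Kc * Num.sqrt (m%:R * EA2) + B * EA2)%:E)%E.
Proof.
apply: (le_trans (aval_le m 0)); rewrite EFinD; apply: leeD; last exact: overshoot_le.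
by have := iter_symop_le m [::]; rewrite /= big_nil add0r.
Qed.

End expectation.
End regeneration.

(** * Exponential concentration *)

Section concentration.
Context (R : realType) (d dO : measure_display) (T : measurableType d)
  (Omega : measurableType dO).
Variables (A : set T) (k : R.-fker T ~> T) (Z : nat -> Omega -> T).
Variables (PA : probability Omega R) (muA : set T -> \bar R).
Hypotheses (mA : measurable A) (muA1 : muA A = 1%E)
  (atom : forall x y B, A x -> A y -> measurable B -> k x B = k y B)
  (MCA : markov_chain PA (fun x => k x : set T -> \bar R) muA Z).
Variables (r : nat) (g : T -> 'rV[R]_r).
Hypothesis mg : measurable_fun setT g.
Variable B : R.
Hypotheses (B0 : 0 <= B) (gB : forall x, row_norm (g x) <= B).

Local Notation S := (psum Z g 0).
Local Notation rt := (rt Z A).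
Local Notation blk := (block A Z g).
Let N : 'rV[R]_r -> \bar R := fun s => (row_norm s)%:E.
Local Notation aval := (aval Z PA g).

Let mZ n : measurable_fun setT (Z n). Proof. by case: MCA. Qed.

Let mN : measurable_fun setT N.
Proof. by apply/measurable_EFinP; exact: measurable_row_norm. Qed.

Let N0 s : (0 <= N s)%E. Proof. by rewrite lee_fin row_norm_ge0. Qed.

Let mS m (s : 'rV[R]_r) : measurable_fun setT (fun w => s + S m w).
Proof. by apply: measurable_rowD => //; exact: (measurable_psum MCA mg). Qed.

Let mNS m s : measurable_fun setT (fun w => N (s + S m w)).
Proof. exact: measurableT_comp mN (mS m s). Qed.

Let normS m w : row_norm (S m w) <= B * m%:R.
Proof. by have := row_norm_psum Z B0 gB 0 m w; rewrite subn0. Qed.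

Definition hval (m : nat) (s : 'rV[R]_r) : R := fine (aval N m s).

Lemma avalE m s : aval N m s = (hval m s)%:E.
Proof.
rewrite /hval fineK// ge0_fin_numE; last exact: integral_ge0.
apply: (@le_lt_trans _ _ (\int[PA]_w (row_norm s + B * m%:R)%:E)%E); last by rewrite int_cst ltry.
apply: (ge0_int_le PA measurableT) => // w.
by rewrite lee_fin (le_trans (row_normD _ _))// lerD2l.
Qed.

Lemma hval_ge0 m s : 0 <= hval m s.
Proof. by rewrite -lee_fin -avalE; exact: integral_ge0. Qed.

Let hval_le m n s t c : 0 <= c ->
  (forall w, row_norm (s + S m w) <= row_norm (t + S n w) + c) ->
  hval m s <= hval n t + c.
Proof.
move=> c0 h; rewrite -lee_fin EFinD -!avalE /aval -[c%:E](int_cst PA).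
rewrite -(ge0_intD PA measurableT (mNS n t) (fun w => N0 _) (measurable_cst _)); last by move=> w; rewrite lee_fin.
by apply: (ge0_int_le PA measurableT (mNS m s)) => //; exact: emeasurable_funD.
Qed.

Lemma hval0 s : hval 0 s = row_norm s.
Proof.
apply/EFin_inj; rewrite -avalE /aval; under eq_integral do rewrite psum_nil /= addr0.
by rewrite int_cst.
Qed.

Lemma hval_lip m s t : hval m s <= hval m t + row_norm (s - t).
Proof.
apply: hval_le => [|w]; first exact: row_norm_ge0.
have -> : s + S m w = (t + S m w) + (s - t) by apply/rowP => i; rewrite !mxE; lra.
exact: row_normD.
Qed.

Let Sdist l m w : (l <= m)%N -> row_norm (psum Z g l m w) <= B * (m - l)%:R.
Proof. by move=> _; exact: row_norm_psum. Qed.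

Lemma hval_up l m s : (l <= m)%N -> hval m s <= hval l s + B * (m - l)%:R.
Proof.
move=> lm; apply: hval_le => [|w]; first by rewrite mulr_ge0.
by rewrite (psum_cat Z g w lm) addrA (le_trans (row_normD _ _))// lerD2l Sdist.
Qed.

Lemma hval_down l m s : (l <= m)%N -> hval l s <= hval m s + B * (m - l)%:R.
Proof.
move=> lm; apply: hval_le => [|w]; first by rewrite mulr_ge0.
rewrite (psum_cat Z g w lm) addrA; set p := psum Z g l m w.
rewrite -{1}(addrK p (s + S l w)).
by rewrite (le_trans (row_normD _ _))// row_normN lerD2l Sdist.
Qed.

Definition regval (m : nat) (s : 'rV[R]_r) (w : Omega) : R :=
  if (0 < rt w < m)%N then hval (m - rt w) (s + blk w) else row_norm (s + S m w).

Lemma regen_norm m s w : regen A Z PA g N m s w = (regval m s w)%:E.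
Proof. by rewrite /regen /regval; case: ifP => // _; rewrite avalE. Qed.

Lemma measurable_regval m s : measurable_fun setT (regval m s).
Proof.
apply/measurable_EFinP.
rewrite (_ : EFin \o _ = regen A Z PA g N m s); last by apply/funext => w; rewrite regen_norm.
exact: (measurable_regen mA MCA mg).
Qed.

Lemma regval_ge0 m s w : 0 <= regval m s w.
Proof. by rewrite /regval; case: ifP => _; [exact: hval_ge0|exact: row_norm_ge0]. Qed.

Lemma int_regval m s : (\int[PA]_w (regval m s w)%:E = (hval m s)%:E)%E.
Proof.
rewrite -avalE /aval (regeneration mA muA1 atom MCA mg MCA)//.
by apply: eq_integral => w _; rewrite regen_norm.
Qed.

(** One block shifts the starting point by at most [B * rt w] and shortens the horizon by [rt w],
    worth another [B * rt w]. If the block is not finished by [m], both values are within [B * m] of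
    [row_norm s]. *)
Lemma regval_dist m s w : (0 < rt w)%N -> `|regval m s w - hval m s| <= 2 * B * (rt w)%:R.
Proof.
move=> r0; have nb : row_norm (blk w) <= B * (rt w)%:R by exact: normS.
rewrite /regval r0 /=; case: ltnP => h.
  have e : (m - (m - rt w) = rt w)%N by lia.
  have u := @hval_up (m - rt w) m s (leq_subr _ _); rewrite e in u.
  have v := @hval_down (m - rt w) m s (leq_subr _ _); rewrite e in v.
  have a := hval_lip (m - rt w) (s + blk w) s.
  have a' := hval_lip (m - rt w) s (s + blk w).
  have eb : s + blk w - s = blk w by rewrite (addrC s) addrK.
  rewrite eb in a; rewrite opprD addNKr row_normN in a'.
  by rewrite ler_norml; apply/andP; split; lra.
have Bm : B * m%:R <= B * (rt w)%:R by rewrite ler_wpM2l// ler_nat.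
have u := @hval_up 0 m s isT; have v := @hval_down 0 m s isT.
rewrite subn0 hval0 in u v.
have a := row_normD s (S m w); have b := normS m w.
have c : row_norm s <= row_norm (s + S m w) + row_norm (S m w).
  by have := row_normD (s + S m w) (- S m w); rewrite addrK row_normN.
by rewrite ler_norml; apply/andP; split; lra.
Qed.

Section exponential_moment.
Variables (theta EA2 : R).
Hypotheses (theta0 : 0 <= theta) (EA20 : 0 <= EA2).
Hypothesis rt_pos : PA (rt @^-1` [set 0%N]) = 0%E.
Hypothesis rt2exp : (\int[PA]_w ((rt w)%:R ^+ 2 * expR (2 * B * theta * (rt w)%:R))%:E
  <= (2 * EA2)%:E)%E.

(** The mean of [(2 * B * theta * rt) ^+ 2 * expR (2 * B * theta * rt)], where [rt2exp] bounds the
    tilted second moment by [2 * EA2]. *)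
Let kap : R := 8 * B ^+ 2 * EA2 * theta ^+ 2.
Let phi : 'rV[R]_r -> \bar R := fun s => (expR (theta * row_norm s))%:E.

Let kap0 : 0 <= kap.
Proof. by rewrite /kap !mulr_ge0 ?sqr_ge0// exprn_ge0. Qed.

Let mphi : measurable_fun setT phi.
Proof.
apply/measurable_EFinP; apply: (measurableT_comp (@measurable_expR R)).
by apply: measurable_funM => //; exact: measurable_row_norm.
Qed.

Let phi0 s : (0 <= phi s)%E. Proof. by rewrite lee_fin expR_ge0. Qed.

(** By [int_regval] the mean of [regval m s] is [hval m s], so the linear term of the quadratic
    bound on the exponential disappears. *)
Lemma int_expR_regval m s :
  (\int[PA]_w (expR (theta * regval m s w))%:E <= (expR (theta * hval m s + kap))%:E)%E.
Proof.
set h := hval m s; have h0 : 0 <= h by exact: hval_ge0.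
pose W w : R := (rt w)%:R ^+ 2 * expR (2 * B * theta * (rt w)%:R).
have mW : measurable_fun setT (fun w => (W w)%:E).
  by apply/measurable_EFinP; exact: (measurable_rtR mA MCA (fun n => n%:R ^+ 2 * expR (2 * B * theta * n%:R))).
have W0 w : 0 <= W w by rewrite mulr_ge0 ?sqr_ge0 ?expR_ge0.
have mY := measurable_regval m s.
pose X w : R := expR (theta * (regval m s w - h)).
have mX : measurable_fun setT (fun w => (X w)%:E).
  apply/measurable_EFinP; apply: (measurableT_comp (@measurable_expR R)).
  by apply: measurable_funM => //; exact: measurable_funB.
have X0 w : (0 <= (X w)%:E)%E by rewrite lee_fin expR_ge0.
have th0 : 0 <= theta * h by rewrite mulr_ge0.
have cc : 0 <= 4 * B ^+ 2 * theta ^+ 2 by rewrite !mulr_ge0// sqr_ge0.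
(* Adding [theta * h] on both sides keeps all integrands nonnegative. *)
have key : (\int[PA]_w ((X w)%:E + (theta * h)%:E) <=
    \int[PA]_w ((1 + theta%:E * (regval m s w)%:E) + (4 * B ^+ 2 * theta ^+ 2)%:E * (W w)%:E))%E.
  apply: ae_ge0_le_integral => //.
  - by move=> w _; rewrite adde_ge0// lee_fin.
  - by apply: emeasurable_funD.
  - by move=> w _; rewrite -!EFinM -!EFinD lee_fin !addr_ge0// mulr_ge0// regval_ge0.
  - apply: emeasurable_funD; last exact: measurable_funeM.
    by apply: emeasurable_funD => //; apply: measurable_funeM; exact/measurable_EFinP.
  apply: (rt_pos_ae mA MCA rt_pos) => w rw _.
  rewrite -!EFinM -!EFinD lee_fin.
  have dst := regval_dist m s rw; rewrite -/h in dst.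
  set x := theta * (regval m s w - h).
  have xle : `|x| <= 2 * B * theta * (rt w)%:R.
    rewrite /x normrM ger0_norm// (_ : _ * theta * _ = theta * (2 * B * (rt w)%:R)); last by ring.
    exact: ler_wpM2l.
  have x2 : x ^+ 2 <= 4 * B ^+ 2 * theta ^+ 2 * (rt w)%:R ^+ 2.
    rewrite -real_normK ?num_real// (_ : _ * _ * _ = (2 * B * theta * (rt w)%:R) ^+ 2); last by ring.
    by apply: lerXn2r; rewrite ?nnegrE// (le_trans _ xle).
  have e := expR_le_quadratic x.
  have f : x ^+ 2 * expR `|x| <= 4 * B ^+ 2 * theta ^+ 2 * W w.
    rewrite /W mulrA; apply: ler_pM; rewrite ?sqr_ge0 ?expR_ge0//.
    by rewrite ler_expR.
  rewrite /X -/x; have : x = theta * regval m s w - theta * h by rewrite /x mulrBr.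
  lra.
move: key.
rewrite (ge0_intD PA measurableT mX X0 (measurable_cst _)); last by move=> w; rewrite lee_fin.
rewrite (ge0_intD PA measurableT _ _ (measurable_funeM _ mW)); last 3 first.
- by apply: emeasurable_funD => //; apply: measurable_funeM; exact/measurable_EFinP.
- by move=> w; rewrite -EFinM -EFinD lee_fin addr_ge0// mulr_ge0// regval_ge0.
- by move=> w; rewrite -EFinM lee_fin mulr_ge0.
rewrite (ge0_intD PA measurableT (measurable_cst _)); last 3 first.
- by move=> w; rewrite lee_fin.
- by apply: measurable_funeM; exact/measurable_EFinP.
- by move=> w; rewrite -EFinM lee_fin mulr_ge0// regval_ge0.
rewrite (ge0_intZl PA measurableT mW)// (ge0_intZl PA measurableT); last 3 first.
- exact/measurable_EFinP.
- by move=> w; rewrite lee_fin regval_ge0.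
- exact: theta0.
rewrite int_regval !int_cst -/h => key.
have IX : (\int[PA]_w (X w)%:E <= (1 + kap)%:E)%E.
  have : (\int[PA]_w (X w)%:E + (theta * h)%:E <= (1 + kap)%:E + (theta * h)%:E)%E.
    apply: (le_trans key).
    apply: (@le_trans _ _ (1 + theta%:E * h%:E + (4 * B ^+ 2 * theta ^+ 2)%:E * (2 * EA2)%:E)%E).
      by apply: leeD => //; apply: lee_wpmul2l.
    by rewrite -!EFinM -!EFinD lee_fin /kap; lra.
  by rewrite leeD2rE.
have -> : (\int[PA]_w (expR (theta * regval m s w))%:E = (expR (theta * h))%:E * \int[PA]_w (X w)%:E)%E.
  rewrite -(ge0_intZl PA measurableT mX X0); last exact: expR_ge0.
  apply: eq_integral => w _; rewrite -EFinM -expRD; congr (expR _)%:E.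
  by rewrite mulrBr addrC subrK.
apply: (@le_trans _ _ ((expR (theta * h))%:E * (1 + kap)%:E)%E).
  by apply: lee_wpmul2l => //; rewrite lee_fin expR_ge0.
by rewrite -EFinM lee_fin expRD ler_pM2l ?expR_gt0// expR_ge1Dx.
Qed.

(** The first block costs one [kap]; the remaining horizon is at most [m] out of [m.+1] steps and
    costs at most [m%:R * kap]. *)
Lemma aval_expR_le m s : (aval phi m s <= (expR (theta * hval m s + m%:R * kap))%:E)%E.
Proof.
elim/ltn_ind: m s => -[|m] IH s.
  rewrite /aval; under eq_integral do rewrite psum_nil /= addr0.
  by rewrite int_cst /phi hval0 mul0r addr0.
rewrite /aval (regeneration mA muA1 atom MCA mg MCA)//.
apply: (@le_trans _ _ (\int[PA]_w ((expR (m%:R * kap))%:E * (expR (theta * regval m.+1 s w))%:E))%E).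
  apply: ae_ge0_le_integral => //.
  - by move=> w _; apply: regen_ge0.
  - exact: (measurable_regen mA MCA mg).
  - apply: measurable_funeM; apply/measurable_EFinP; apply: (measurableT_comp (@measurable_expR R)).
    by apply: measurable_funM => //; exact: measurable_regval.
  apply: (rt_pos_ae mA MCA rt_pos) => w rw _.
  rewrite -EFinM -expRD /regen /regval rw/=; case: ltnP => h.
    apply: (le_trans (IH _ _ _)); first by lia.
    rewrite lee_fin ler_expR addrC lerD2r ler_wpM2r// ler_nat; lia.
  by rewrite lee_fin ler_expR lerDr mulr_ge0.
have mX : measurable_fun setT (fun w => (expR (theta * regval m.+1 s w))%:E).
  apply/measurable_EFinP; apply: (measurableT_comp (@measurable_expR R)).
  by apply: measurable_funM => //; exact: measurable_regval.
rewrite (ge0_intZl PA measurableT mX); last 2 first.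
- by move=> w; rewrite lee_fin expR_ge0.
- exact: expR_ge0.
apply: (@le_trans _ _ ((expR (m%:R * kap))%:E * (expR (theta * hval m.+1 s + kap))%:E)%E).
  by apply: lee_wpmul2l; [rewrite lee_fin expR_ge0|exact: int_expR_regval].
by rewrite -EFinM lee_fin -expRD ler_expR -[m.+1%:R]natr1; lra.
Qed.

End exponential_moment.

Section initial_law.
Variables (P : probability Omega R) (mu : set T -> \bar R).
Hypothesis MC : markov_chain P (fun x => k x : set T -> \bar R) mu Z.
Hypothesis rt_posP : P (rt @^-1` [set 0%N]) = 0%E.
Variables (n : nat) (H : R).
Hypotheses (H0 : 0 <= H) (hH : forall j, (j <= n)%N -> hval j 0 <= H).

Let hval_block j w : (j <= n)%N -> hval j (0 + blk w) <= H + B * (rt w)%:R.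
Proof.
move=> jn; apply: (le_trans (hval_lip j _ 0)); rewrite subr0 add0r lerD ?hH//.
exact: normS.
Qed.

(** The stretch before the first regeneration has another law than the later blocks and is bounded
    by its length; after it the chain starts from the atom. *)
Lemma int_norm_le :
  (\int[P]_w N (S n w) <= B%:E * \int[P]_w ((rt w)%:R)%:E + H%:E)%E.
Proof.
have mr : measurable_fun setT (fun w => ((rt w)%:R)%:E : \bar R).
  by apply/measurable_EFinP; exact: (measurable_rtR mA MC (fun n => n%:R)).
rewrite -(ge0_intZl P measurableT mr)// -[X in (_ <= _ + X)%E](int_cst P).
rewrite -(ge0_intD P measurableT (measurable_funeM _ mr) _ (measurable_cst _)); last 2 first.
- by move=> w; rewrite lee_fin mulr_ge0.
- by move=> w; rewrite lee_fin.
have -> : (\int[P]_w N (S n w) = \int[P]_w N (0 + S n w)%R)%E.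
  by apply: eq_integral => w _; rewrite add0r.
rewrite (regeneration mA muA1 atom MCA mg MC)//.
apply: ae_ge0_le_integral => //.
- by move=> w _; apply: regen_ge0.
- exact: (measurable_regen mA MCA mg).
- by move=> w _; rewrite -EFinM -EFinD lee_fin addr_ge0// mulr_ge0.
- by apply: emeasurable_funD => //; exact: measurable_funeM.
apply: (rt_pos_ae mA MC rt_posP) => w rw _.
rewrite -EFinM -EFinD regen_norm lee_fin /regval rw/= addrC; case: ltnP => h.
  by rewrite addrC [leRHS]addrC; exact: (hval_block _ (leq_subr _ _)).
by rewrite add0r (le_trans (normS n w))// ler_wpDr// ler_wpM2l// ler_nat.
Qed.

Variables (theta EA2 : R).
Hypotheses (theta0 : 0 <= theta) (EA20 : 0 <= EA2).
Hypothesis rt_pos : PA (rt @^-1` [set 0%N]) = 0%E.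
Hypothesis rt2exp : (\int[PA]_w ((rt w)%:R ^+ 2 * expR (2 * B * theta * (rt w)%:R))%:E
  <= (2 * EA2)%:E)%E.

Lemma int_expR_norm_le :
  (\int[P]_w (expR (theta * row_norm (S n w)))%:E <=
   (expR (theta * H + n%:R * (8 * B ^+ 2 * EA2 * theta ^+ 2)))%:E *
   \int[P]_w (expR (theta * B * (rt w)%:R))%:E)%E.
Proof.
set kap := 8 * B ^+ 2 * EA2 * theta ^+ 2.
have kap0 : 0 <= kap by rewrite /kap !mulr_ge0 ?sqr_ge0// exprn_ge0.
pose phi : 'rV[R]_r -> \bar R := fun s => (expR (theta * row_norm s))%:E.
have mphi : measurable_fun setT phi.
  apply/measurable_EFinP; apply: (measurableT_comp (@measurable_expR R)).
  by apply: measurable_funM => //; exact: measurable_row_norm.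
have phi0 s : (0 <= phi s)%E by rewrite lee_fin expR_ge0.
have me : measurable_fun setT (fun w => (expR (theta * B * (rt w)%:R))%:E).
  by apply/measurable_EFinP; exact: (measurable_rtR mA MC (fun n => expR (theta * B * n%:R))).
rewrite -(ge0_intZl P measurableT me); last 2 first.
- by move=> w; rewrite lee_fin expR_ge0.
- exact: expR_ge0.
have -> : (\int[P]_w (expR (theta * row_norm (S n w)))%:E = \int[P]_w phi (0 + S n w)%R)%E.
  by apply: eq_integral => w _; rewrite add0r.
rewrite (regeneration mA muA1 atom MCA mg MC)//.
apply: ae_ge0_le_integral => //.
- by move=> w _; apply: regen_ge0.
- exact: (measurable_regen mA MCA mg).
- exact: measurable_funeM.
apply: (rt_pos_ae mA MC rt_posP) => w rw _.
rewrite -EFinM -expRD /regen rw/=; case: ltnP => h.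
  apply: (le_trans (aval_expR_le theta0 EA20 rt_pos rt2exp _ _)).
  rewrite lee_fin ler_expR -/kap.
  have := ler_wpM2l theta0 (hval_block w (leq_subr (rt w) n)).
  have : (n - rt w)%:R * kap <= n%:R * kap by rewrite ler_wpM2r// ler_nat leq_subr.
  lra.
rewrite lee_fin ler_expR add0r -mulrA.
have a : theta * row_norm (S n w) <= theta * (B * (rt w)%:R).
  apply: ler_wpM2l => //; apply: (le_trans (normS _ _)).
  by rewrite ler_wpM2l// ler_nat.
have b : 0 <= theta * H by rewrite mulr_ge0.
have c : 0 <= n%:R * kap by rewrite mulr_ge0.
lra.
Qed.

End initial_law.
End concentration.

Lemma finite_kernel_of (R : realType) (d d' : measure_display)
    (T : measurableType d) (V : measurableType d') (K : T -> set V -> \bar R) :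
  (forall x, K x set0 = 0%E) ->
  (forall x A, measurable A -> (0 <= K x A)%E) ->
  (forall x, semi_sigma_additive (K x)) ->
  (forall A, measurable A -> measurable_fun setT (K ^~ A)) ->
  (forall x, (K x setT <= 1)%E) ->
  exists k : R.-fker T ~> V, forall x A, measurable A -> k x A = K x A.
Proof.
move=> K0 Kge0 Kadd mK K1.
(* [K] is known to be nonnegative on measurable sets only, while a measure must be nonnegative on
   all sets. *)
pose m x A := maxe 0%E (K x A).
have mE x A : measurable A -> m x A = K x A.
  by move=> mA; rewrite /m; apply/max_idPr; exact: Kge0.
have m0 x : m x set0 = 0%E by rewrite mE.
have mge0 x A : (0 <= m x A)%E by rewrite /m le_max lexx.
have madd x : semi_sigma_additive (m x).
  move=> F mF tF mUF; rewrite mE//.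
  under eq_fun do under eq_bigr do rewrite mE//.
  exact: Kadd.
pose k x : {measure set V -> \bar R} :=
  HB.pack (m x) (isMeasure.Build _ _ _ (m x) (m0 x) (mge0 x) (madd x)).
have mk U : measurable U -> measurable_fun setT (fun x => k x U).
  move=> mU; rewrite (_ : (fun x => k x U) = K ^~ U); first exact: mK.
  by apply/funext => x; rewrite -(mE x U mU).
pose kk : R.-ker T ~> V := HB.pack k (isKernel.Build _ _ _ _ _ k mk).
have fk : measure_fam_uub kk.
  by exists 2 => x; rewrite /= mE//; apply: (le_lt_trans (K1 x)); rewrite lte_fin ltr1n.
pose kf : R.-fker T ~> V := HB.pack k kk (Kernel_isFinite.Build _ _ _ _ _ (Kernel.sort kk) fk).
exists kf => x A mA; exact: mE.
Qed.

(** * Kernel operators and recurrence *)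

Section markov_chain_ext.
Context (R : realType) (d dO : measure_display) (T : measurableType d)
  (Omega : measurableType dO).

Lemma markov_chain_ext (P : probability Omega R) (K K' : T -> set T -> \bar R) mu
    (X : nat -> Omega -> T) :
  (forall x A, measurable A -> K x A = K' x A) ->
  markov_chain P K mu X -> markov_chain P K' mu X.
Proof.
move=> KK' [mX X0 MC]; split=> // n F A mF mA.
by rewrite MC//; apply: eq_integral => w _; exact: KK'.
Qed.

End markov_chain_ext.

Section initial_law.
Context (R : realType) (d dO : measure_display) (T : measurableType d)
  (Omega : measurableType dO).

Lemma markov_init (P : probability Omega R) (K : T -> set T -> \bar R)
    (mu : {measure set T -> \bar R}) (X : nat -> Omega -> T) (f : T -> \bar R) :
  markov_chain P K mu X -> measurable_fun setT f -> (forall x, 0 <= f x)%E ->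
  (\int[P]_w f (X 0%N w) = \int[mu]_x f x)%E.
Proof.
move=> [mX X0 _] mf f0.
rewrite -(@ge0_integral_pushforward _ _ _ _ R (X 0%N) (mX 0%N) P setT f)//.
by apply: eq_measure_integral => A mA _; exact: X0.
Qed.

End initial_law.

Lemma null_bigcup (R : realType) (d : measure_display) (T : measurableType d)
    (mu : {measure set T -> \bar R}) (F : (set T)^nat) :
  (forall i, measurable (F i)) -> (forall i, mu (F i) = 0%E) ->
  mu (\bigcup_i F i) = 0%E.
Proof.
move=> mF F0; apply/negligibleP; first exact: bigcupT_measurable.
by apply: negligible_bigcup => i; exists (F i); split.
Qed.

Lemma le_meas (R : realType) (d : measure_display) (T : measurableType d)
    (mu : {measure set T -> \bar R}) (A B : set T) :
  measurable A -> measurable B -> A `<=` B -> (mu A <= mu B)%E.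
Proof. by move=> mA mB AB; apply: le_measure => //; exact: mem_set. Qed.

Lemma le_measU_null (R : realType) (d : measure_display) (T : measurableType d)
    (mu : {measure set T -> \bar R}) (A B : set T) :
  measurable A -> measurable B -> mu B = 0%E -> (mu (A `|` B) <= mu A)%E.
Proof. by move=> mA mB B0; rewrite measureU0. Qed.

Section measure_mixture.
Context (R : realType) (d : measure_display) (T : measurableType d).

Lemma ge0_int_mix (mu mu1 mu2 : {measure set T -> \bar R}) (a b : R) (f : T -> \bar R) :
  0 <= a -> 0 <= b ->
  (forall A, measurable A -> mu A = a%:E * mu1 A + b%:E * mu2 A)%E ->
  measurable_fun setT f -> (forall x, 0 <= f x)%E ->
  (\int[mu]_x f x = a%:E * \int[mu1]_x f x + b%:E * \int[mu2]_x f x)%E.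
Proof.
move=> a0 b0 h mf f0.
pose na : {nonneg R} := NngNum a0; pose nb : {nonneg R} := NngNum b0.
transitivity (\int[measure_add (mscale na mu1) (mscale nb mu2)]_x f x)%E.
  apply: eq_measure_integral => A mA _; rewrite h//.
  by rewrite -[RHS]/(measure_add (mscale na mu1) (mscale nb mu2) A) measure_addE.
rewrite ge0_integral_measure_add// ge0_integral_mscale// ge0_integral_mscale//.
Qed.

Lemma int_pushforward d' (V : measurableType d') (mu : {measure set T -> \bar R})
    (phi : T -> V) (f : V -> \bar R) : measurable_fun setT phi ->
  measurable_fun setT f -> (forall x, 0 <= f x)%E ->
  (\int[pushforward mu phi]_y f y = \int[mu]_x f (phi x))%E.
Proof. by move=> mp mf f0; rewrite ge0_integral_pushforward. Qed.

Lemma int0_null (mu : {measure set T -> \bar R}) (f : T -> \bar R) :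
  measurable_fun setT f -> (forall x, 0 <= f x)%E -> (\int[mu]_x f x = 0)%E ->
  mu [set x | f x != 0%E] = 0%E.
Proof.
move=> mf f0 If; have : (\int[mu]_x `|f x| = 0)%E.
  by under eq_integral do rewrite gee0_abs//.
move/(ae_eq_integral_abs _ measurableT mf) => [B [mB B0 hB]].
apply: (@subset_measure0 _ _ _ _ _ B) => //.
  by have := emeasurable_neq measurableT mf 0%E; rewrite setTI.
by move=> x /= /eqP fx; apply: hB => /= /(_ Logic.I).
Qed.

Lemma ge0_int_mix_pushforward d' (V : measurableType d') (mu : {measure set T -> \bar R})
    (mu1 mu2 : {measure set V -> \bar R}) (phi1 phi2 : V -> T) (a b : R) (f : T -> \bar R) :
  measurable_fun setT phi1 -> measurable_fun setT phi2 -> 0 <= a -> 0 <= b ->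
  (forall A, measurable A -> mu A = a%:E * mu1 (phi1 @^-1` A) + b%:E * mu2 (phi2 @^-1` A))%E ->
  measurable_fun setT f -> (forall x, 0 <= f x)%E ->
  (\int[mu]_x f x = a%:E * \int[mu1]_x f (phi1 x) + b%:E * \int[mu2]_x f (phi2 x))%E.
Proof.
move=> m1 m2 a0 b0 h mf f0.
rewrite -(ge0_integral_pushforward m1 mu1 measurableT mf (fun x _ => f0 x)).
rewrite -(ge0_integral_pushforward m2 mu2 measurableT mf (fun x _ => f0 x)).
exact: ge0_int_mix.
Qed.

Lemma integral_ind (mu : {measure set T -> \bar R}) (A : set T) : measurable A ->
  (\int[mu]_x (\1_A x)%:E = mu A)%E.
Proof. by move=> mA; rewrite integral_indic// setIT. Qed.

End measure_mixture.

Section kernel_operator.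
Context (R : realType) (d : measure_display) (T : measurableType d)
  (k : R.-fker T ~> T).
Implicit Types f g : T -> \bar R.

Definition pop f x := (\int[k x]_y f y)%E.

Lemma pop_ge0 f : (forall x, 0 <= f x)%E -> forall x, (0 <= pop f x)%E.
Proof. exact: kop_ge0. Qed.

Lemma measurable_pop f : measurable_fun setT f -> (forall x, 0 <= f x)%E ->
  measurable_fun setT (pop f).
Proof. by move=> mf f0; exact: measurable_kop. Qed.

Lemma iter_pop_ge0 f n : (forall x, 0 <= f x)%E -> forall x, (0 <= iter n pop f x)%E.
Proof. exact: iter_kop_ge0. Qed.

Lemma measurable_iter_pop f n : measurable_fun setT f -> (forall x, 0 <= f x)%E ->
  measurable_fun setT (iter n pop f).
Proof. by move=> mf f0; exact: (measurable_iter_kop k n measurableT mf). Qed.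

Lemma le_pop f g : measurable_fun setT f -> measurable_fun setT g ->
  (forall x, 0 <= f x)%E -> (forall x, f x <= g x)%E -> forall x, (pop f x <= pop g x)%E.
Proof. by move=> mf mg f0 fg x; exact: (ge0_int_le _ measurableT). Qed.

Lemma popD f g : measurable_fun setT f -> measurable_fun setT g ->
  (forall x, 0 <= f x)%E -> (forall x, 0 <= g x)%E ->
  forall x, (pop (fun x => f x + g x) x = pop f x + pop g x)%E.
Proof. by move=> mf mg f0 g0 x; exact: (ge0_intD _ measurableT). Qed.

Lemma popZ c f : measurable_fun setT f -> (forall x, 0 <= f x)%E -> 0 <= c ->
  forall x, (pop (fun x => c%:E * f x) x = c%:E * pop f x)%E.
Proof. by move=> mf f0 c0 x; exact: (ge0_intZl _ measurableT). Qed.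

Lemma le_iter_pop f g n : measurable_fun setT f -> measurable_fun setT g ->
  (forall x, 0 <= f x)%E -> (forall x, f x <= g x)%E ->
  forall x, (iter n pop f x <= iter n pop g x)%E.
Proof.
move=> mf mg f0 fg; have g0 x : (0 <= g x)%E by rewrite (le_trans (f0 x)).
elim: n => [//|n IH] x /=.
by apply: le_pop => //; [exact: measurable_iter_pop|exact: measurable_iter_pop|exact: iter_pop_ge0].
Qed.

Lemma iter_popD f g n : measurable_fun setT f -> measurable_fun setT g ->
  (forall x, 0 <= f x)%E -> (forall x, 0 <= g x)%E ->
  forall x, (iter n pop (fun x => f x + g x) x = iter n pop f x + iter n pop g x)%E.
Proof.
move=> mf mg f0 g0; elim: n => [//|n IH] x /=.
rewrite -popD; last 4 first.
- exact: measurable_iter_pop.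
- exact: measurable_iter_pop.
- exact: iter_pop_ge0.
- exact: iter_pop_ge0.
by apply: eq_integral => y _; exact: IH.
Qed.

Lemma iter_popZ c f n : measurable_fun setT f -> (forall x, 0 <= f x)%E -> 0 <= c ->
  forall x, (iter n pop (fun x => c%:E * f x) x = c%:E * iter n pop f x)%E.
Proof.
move=> mf f0 c0; elim: n => [//|n IH] x /=.
rewrite -popZ//; last 2 first.
- exact: measurable_iter_pop.
- exact: iter_pop_ge0.
by apply: eq_integral => y _; exact: IH.
Qed.

Lemma iter_pop_cst c n : (forall x, k x setT = 1%E) -> 0 <= c ->
  forall x, (iter n pop (fun=> c%:E) x = c%:E)%E.
Proof.
move=> k1 c0; elim: n => [//|n IH] x /=.
rewrite /pop; under eq_integral do rewrite IH.
by rewrite integral_cst//= k1 mule1.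
Qed.

End kernel_operator.

Section recurrence.
Context (R : realType) (d dO : measure_display) (T : measurableType d)
  (Omega : measurableType dO).
Variables (P : R.-fker T ~> T) (X : nat -> Omega -> T).
Variables (Pr : probability T R -> probability Omega R).
Hypothesis P1 : forall x, P x setT = 1%E.
Hypothesis MF : markov_family (fun x => P x : set T -> \bar R) X Pr.
Variables (pi : probability T R) (E S : set T) (m : nat) (c : R).
Hypotheses (mS : measurable S) (mE : measurable E) (SE : S `<=` E) (c0 : 0 < c).
Hypothesis inv : forall f : T -> \bar R, measurable_fun setT f -> (forall x, 0 <= f x)%E ->
  (\int[pi]_x pop P f x = \int[pi]_x f x)%E.
Hypothesis minor : forall x B, E x -> measurable B ->
  (c%:E * pi B <= iter m (pop P) (fun y => (\1_B y)%:E) x)%E.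
Hypothesis return_fin : forall x, S x ->
  (\int[Pr \d_x]_w return_time R X S w < +oo)%E.

Lemma int_iter_pop n (f : T -> \bar R) : measurable_fun setT f -> (forall x, 0 <= f x)%E ->
  (\int[pi]_x iter n (pop P) f x = \int[pi]_x f x)%E.
Proof.
move=> mf f0; elim: n => [//|n IH] /=.
by rewrite inv//; [exact: measurable_iter_pop|exact: iter_pop_ge0].
Qed.

Let mX n : measurable_fun setT (X n).
Proof. by have [] := MF pi. Qed.

Let m1 (B : set T) : measurable B -> measurable_fun setT (fun y => (\1_B y)%:E : \bar R).
Proof. by move=> mB; apply/measurable_EFinP; exact: measurable_indic. Qed.

Let i0 (B : set T) y : (0 <= (\1_B y)%:E :> \bar R)%E.
Proof. by rewrite lee_fin. Qed.


Let mst l n : measurable (stays X (~` S) l n).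
Proof. exact: (measurable_stays (MF pi) l n (measurableC mS)). Qed.

Let ind_pre (B : set T) n w : \1_(X n @^-1` B) w = \1_B (X n w) :> R.
Proof. by rewrite !indicE; congr (nat_of_bool _)%:R; apply/idP/idP; rewrite !inE. Qed.

Lemma hitting_null n : pi S = 0%E ->
  pi [set x | iter n (pop P) (fun y => (\1_S y)%:E) x != 0%E] = 0%E.
Proof.
move=> piS; set u := iter n _ _.
apply: int0_null; first by apply: measurable_iter_pop => //; exact: m1.
  by move=> x; exact: iter_pop_ge0.
by rewrite /u int_iter_pop//; [rewrite integral_ind|exact: m1].
Qed.

Lemma int_stays (P0 : probability Omega R) (mu : set T -> \bar R) n :
  markov_chain P0 (fun x => P x : set T -> \bar R) mu X ->
  forall (F : set Omega) l, measurable (F : set (hist X l)) ->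
  (P0 (F `&` stays X (~` S) l (l + n)) =
  \int[P0]_(w in F) iter n (kop P (~` S)) (cst 1%E) (X l w))%E.
Proof.
move=> MC F l mF.
rewrite -(markov_stays MC n (measurableC mS) mF (measurable_cst 1%E) (fun _ => lee01)).
by rewrite integral_cst ?mul1e//; apply: measurableI => //; exact: (measurable_of_hist mX mF).
Qed.

(** The taboo probabilities decrease to the probability of never returning, which vanishes because
    [return_time] is [+oo] there and has finite mean. *)
Lemma taboo_cvg0 x : S x -> (fun n => iter n (kop P (~` S)) (cst 1%E) x) @ \oo --> 0%E.
Proof.
move=> Sx; have MC := MF \d_x.
have mt n : measurable_fun setT (iter n (kop P (~` S)) (cst 1%E)).
  by apply: measurable_iter_kop => //; exact: measurableC.
have t0 n y : (0 <= iter n (kop P (~` S)) (cst 1%E) y)%E by apply: iter_kop_ge0.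
have E1 n : iter n (kop P (~` S)) (cst 1%E) x = Pr \d_x (stays X (~` S) 0 n).
  have mT : measurable ([set: Omega] : set (hist X 0)) by exact: measurableT.
  have := int_stays n MC mT; rewrite add0n setTI => ->.
  rewrite (@markov_init _ _ _ _ _ _ _ \d_x X _ MC (mt n) (t0 n)).
  by rewrite integral_dirac// diracT mul1e.
under eq_fun do rewrite E1.
have -> : 0%E = Pr \d_x (\bigcap_n stays X (~` S) 0 n).
  apply/esym; rewrite -rt_eq0E//.
  have mr : measurable (rt X S @^-1` [set 0%N]) by exact: measurable_rt.
  apply: contrapT => /eqP p0; have := return_fin Sx.
  apply/negP; rewrite -leNgt.
  have mrt : measurable_fun setT (return_time R X S).
    rewrite (_ : return_time R X S = fun w => if rt X S w == 0%N then +oo%E else ((rt X S w)%:R)%:E); last first.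
      by apply/funext => w; exact: return_timeE.
    apply: (@measurable_fun_natdep _ _ _ _ (rt X S) (fun n _ => if n == 0%N then +oo%E else (n%:R)%:E)) => i.
      exact: measurable_rt.
    by case: (i == 0%N); exact: measurable_cst.
  have rt0 w : (0 <= return_time R X S w)%E.
    by rewrite return_timeE; case: ifP => _; rewrite ?leey// lee_fin.
  apply: (@le_trans _ _ (\int[Pr \d_x]_(w in rt X S @^-1` [set 0%N]) return_time R X S w)%E); last first.
    exact: ge0_subset_integral.
  rewrite (eq_integral (cst +oo%E)); last first.
    by move=> w /set_mem /= r0; rewrite return_timeE r0.
  by rewrite integral_cst// gt0_mulye// lt0e p0 measure_ge0.
apply: nonincreasing_cvg_mu => //.
- by rewrite (le_lt_trans (probability_le1 _ _))// ltry.
- exact: bigcapT_measurable.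
- move=> i j ij; apply/subsetPset => w h l /andP[l0 li]; apply: h.
  by rewrite l0 (leq_trans li).
Qed.

(** By the Markov property at [l], the probability of avoiding [S] during the next [n] steps is an
    integral of taboo probabilities over [S]; dominated convergence sends it to 0. *)
Lemma no_last_visit (P0 : probability Omega R) (mu : set T -> \bar R) l :
  markov_chain P0 (fun x => P x : set T -> \bar R) mu X ->
  P0 (X l @^-1` S `&` \bigcap_n stays X (~` S) l (l + n)) = 0%E.
Proof.
move=> MC.
have mt n : measurable_fun setT (iter n (kop P (~` S)) (cst 1%E)).
  by apply: measurable_iter_kop => //; exact: measurableC.
have t0 n y : (0 <= iter n (kop P (~` S)) (cst 1%E) y)%E by apply: iter_kop_ge0.
have t1 n y : (iter n (kop P (~` S)) (cst 1%E) y <= 1)%E.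
  elim: n y => [//|n IH] y /=; rewrite /kop.
  apply: (@le_trans _ _ (\int[P y]_(z in ~` S) cst 1 z)%E).
    by apply: ge0_int_le => //; exact: measurableC.
  rewrite integral_cst ?mul1e; last exact: measurableC.
  rewrite -(P1 y); exact: (le_measure (P y) (mem_set (measurableC mS)) (mem_set measurableT) (@subsetT _ _)).
have mF : measurable (X l @^-1` S : set (hist X l)).
  by have := measurable_hist (X:=X) (leqnn l) measurableT mS; rewrite setTI.
have mFO := measurable_of_hist mX mF.
have h n : (P0 (X l @^-1` S `&` \bigcap_n stays X (~` S) l (l + n)) <=
    \int[P0]_(w in X l @^-1` S) iter n (kop P (~` S)) (cst 1%E) (X l w))%E.
  rewrite -(int_stays n MC mF); apply: le_measure.
  - by apply/mem_set; apply: measurableI => //; apply: bigcapT_measurable => j.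
  - by apply/mem_set; exact: measurableI.
  - by move=> w [Sw hw]; split => //; exact: hw.
have [_ _ C] := @dominated_convergence _ _ _ P0 (X l @^-1` S) mFO
  (fun n w => iter n (kop P (~` S)) (cst 1%E) (X l w)) (cst 0%E) (cst 1%E)
  (fun n => measurable_funTS (measurableT_comp (mt n) (mX l))) (measurable_cst _)
  (ltac:(by apply: aeW => w Sw; exact: taboo_cvg0))
  (ltac:(apply: (integrableS measurableT) => //; exact: finite_measure_integrable_cst))
  (ltac:(by apply: aeW => w n Sw; rewrite gee0_abs)).
rewrite integral0 in C.
apply/eqP; rewrite eq_le measure_ge0 andbT.
rewrite -(cvg_lim (@ereal_hausdorff R) C).
apply: lime_ge; first by apply/cvg_ex; exists 0%E.
by apply: nearW => n; exact: h.
Qed.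

(** If [pi S = 0], invariance makes [S] unreachable from [pi]-almost every point. By the
    minorization the chain started at [x0] is at such a point at time [m] with probability at least
    [c]; it would then have a last visit to [S]. *)
Lemma recurrent_set_charged x0 : S x0 -> pi S != 0%E.
Proof.
move=> Sx0; apply/eqP => piS; have MC := MF \d_x0.
pose u n := iter n (pop P) (fun y => (\1_S y)%:E).
have mu n : measurable_fun setT (u n) by apply: measurable_iter_pop => //; exact: m1.
have u0 n x : (0 <= u n x)%E by exact: iter_pop_ge0.
(* The points from which [S] is hit with positive probability at some time. *)
pose N := \bigcup_n [set x | u n x != 0%E].
have mun n : measurable [set x | u n x != 0%E].
  by have := emeasurable_neq measurableT (mu n) 0%E; rewrite setTI.
have mN : measurable N by apply: bigcupT_measurable.
have piN : pi N = 0%E.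
  by apply: null_bigcup => // n; exact: hitting_null.
have piNC : pi (~` N) = 1%E by rewrite probability_setC// piN sube0.
have mNC := measurableC mN.
have mT : measurable ([set: Omega] : set (hist X 0)) by exact: measurableT.
pose F := X m @^-1` (~` N).
have mFh : measurable (F : set (hist X m)).
  by have := measurable_hist (X:=X) (leqnn m) measurableT mNC; rewrite setTI.
have mF : measurable F := measurable_of_hist mX mFh.
have PF : (c%:E <= Pr \d_x0 F)%E.
  have := @markov_stays _ _ _ _ _ _ P _ X MC setT setT 0 m (fun y => (\1_(~` N) y)%:E)
    measurableT mT (m1 mNC) (i0 _).
  rewrite add0n setTI (_ : stays X setT 0 m = setT); last by apply/seteqP; split.
  rewrite (markov_init (f := iter m (kop P setT) (fun y => (\1_(~` N) y)%:E)) MC); last 2 first.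
  - by apply: measurable_iter_pop => //; exact: m1.
  - exact: iter_pop_ge0.
  rewrite integral_dirac//; last by apply: measurable_iter_pop => //; exact: m1.
  rewrite diracT mul1e => h.
  have -> : Pr \d_x0 F = (\int[Pr \d_x0]_w (\1_(~` N) (X m w))%:E)%E.
    rewrite -(integral_ind _ mF); apply: eq_integral => w _.
    by rewrite ind_pre.
  rewrite h; apply: le_trans (minor (SE Sx0) mNC).
  by rewrite piNC mule1.
have later j : Pr \d_x0 (F `&` X (m + j)%N @^-1` S) = 0%E.
  have := @markov_stays _ _ _ _ _ _ P _ X MC setT F m j (fun y => (\1_S y)%:E)
    measurableT mFh (m1 mS) (i0 _).
  rewrite (_ : stays X setT m (m + j) = setT); last by apply/seteqP; split.
  have -> : (\int[Pr \d_x0]_(w in F) iter j (kop P setT) (fun y => (\1_S y)%:E) (X m w) = 0)%E.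
    rewrite (eq_integral (cst 0%E)) ?integral0// => w /set_mem Fw.
    by apply: contrapT => h; apply: Fw; exists j => //=; exact/eqP.
  rewrite setIT => h.
  have mFS : measurable (F `&` X (m + j)%N @^-1` S).
    by apply: measurableI => //; rewrite -[X in measurable X]setTI; exact: mX.
  rewrite -(integral_ind _ mFS) -h [RHS]integral_mkcond; apply: eq_integral => w _.
  by rewrite patchE -ind_pre !indicE in_setI; case: (w \in F).
have last l : Pr \d_x0 (X l @^-1` S `&` \bigcap_n stays X (~` S) l (l + n)) = 0%E.
  exact: no_last_visit MC.
suff : Pr \d_x0 F = 0%E by move=> F0; move: PF; rewrite F0 lee_fin leNgt c0.
(* On [F] one of three null events occurs: a visit to [S] after time [m], a last visit at some time
   [l], or a start outside [S]. *)
apply: (@subset_measure0 _ _ _ (Pr \d_x0) _ ((\bigcup_j (F `&` X (m + j)%N @^-1` S)) `|`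
  ((\bigcup_l (X l @^-1` S `&` \bigcap_n stays X (~` S) l (l + n))) `|` X 0%N @^-1` (~` S)))) => //.
- apply: measurableU; first by apply: bigcupT_measurable => j; apply: measurableI => //; rewrite -[X in measurable X]setTI; exact: mX.
  apply: measurableU; last by rewrite -[X in measurable X]setTI; apply: mX => //; exact: measurableC.
  apply: bigcupT_measurable => l; apply: measurableI; first by rewrite -[X in measurable X]setTI; exact: mX.
  exact: bigcapT_measurable.
- move=> w Fw; have [[j Sj]|nS] := pselect (exists j, S (X (m + j)%N w)).
    by left; exists j.
  right; have [S0|] := pselect (S (X 0%N w)); last by right.
  left.
  have [l Sl lmax] : exists2 l, S (X l w) & forall i, (l < i)%N -> ~ S (X i w).
    have ex : exists n, `[< S (X n w) >] by exists 0%N; exact/asboolP.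
    have ub n : `[< S (X n w) >] -> (n <= m)%N.
      move=> /asboolP Sn; rewrite leqNgt; apply/negP => mn.
      by apply: nS; exists (n - m)%N; rewrite subnKC// ltnW.
    case: (ex_maxnP ex ub) => l /asboolP Sl lmax; exists l => // i li /asboolP Si.
    by have := lmax i Si; rewrite leqNgt li.
  by exists l => //; split => // n _ i /andP[li _]; exact: lmax.
have mj j : measurable (F `&` X (m + j)%N @^-1` S).
  by apply: measurableI => //; rewrite -[X in measurable X]setTI; exact: mX.
have ml l : measurable (X l @^-1` S `&` \bigcap_n stays X (~` S) l (l + n)).
  apply: measurableI; first by rewrite -[X in measurable X]setTI; exact: mX.
  exact: bigcapT_measurable.
have m0 : measurable (X 0%N @^-1` (~` S)).
  by rewrite -[X in measurable X]setTI; apply: mX => //; exact: measurableC.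
apply: null_set_setU; [exact: bigcupT_measurable|apply: measurableU => //; exact: bigcupT_measurable| |].
  exact: null_bigcup.
apply: null_set_setU; [exact: bigcupT_measurable|exact: m0| |].
  exact: null_bigcup.
have [_ init _] := MC; apply: (etrans (init _ (measurableC mS))).
by rewrite /= diracE memNset.
Qed.

End recurrence.

(** * The split chain *)

Section split_chain.
Context (R : realType) (d : measure_display) (T : measurableType d).
Variables (P : R.-fker T ~> T) (K : R.-fker (T * bool)%type ~> (T * bool)%type).
Variables (S : set T) (delta0 : R) (Psi : probability T R).
Hypothesis P1 : forall x, P x setT = 1%E.
Hypotheses (mS : measurable S) (d0 : 0 < delta0) (d1 : delta0 <= 1).
Hypothesis Kle1 : forall z, (K z setT <= 1)%E.
Hypothesis Kprod : forall z C, measurable C ->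
  K z C = (delta0%:E * K z (fst @^-1` ((fun x => (x, true)) @^-1` C)) +
           (1 - delta0)%:E * K z (fst @^-1` ((fun x => (x, false)) @^-1` C)))%E.
Hypothesis KPsi : forall x B, S x -> measurable B -> K (x, true) (fst @^-1` B) = Psi B.
Hypothesis KP : forall x B, measurable B ->
  P x B = (delta0%:E * K (x, true) (fst @^-1` B) + (1 - delta0)%:E * K (x, false) (fst @^-1` B))%E.

Let A : set (T * bool) := S `*` [set true].

Let e0 : 0 <= delta0. Proof. exact: ltW. Qed.
Let e1 : 0 <= 1 - delta0. Proof. by rewrite subr_ge0. Qed.

Let mA : measurable A. Proof. exact: measurableX. Qed.

Let mpair b : measurable_fun setT (fun x : T => (x, b) : T * bool).
Proof. exact: measurable_fun_pair. Qed.

(* Integrates out the Bernoulli coordinate of the split chain; [vopA] does so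
   off the atom. *)
Definition vop (F : T * bool -> \bar R) (x : T) : \bar R :=
  (delta0%:E * F (x, true) + (1 - delta0)%:E * F (x, false))%E.

Lemma vop_ge0 F : (forall z, 0 <= F z)%E -> forall x, (0 <= vop F x)%E.
Proof. by move=> F0 x; rewrite adde_ge0// mule_ge0. Qed.

Lemma measurable_vop F : measurable_fun setT F -> measurable_fun setT (vop F).
Proof.
by move=> mF; apply: emeasurable_funD; apply: measurable_funeM; exact: (measurableT_comp mF (mpair _)).
Qed.

Lemma vop_fst f : vop (fun z => f z.1) = f.
Proof.
apply/funext => x; rewrite /vop /=; case: (f x) => [r| |].
- by rewrite -!EFinM -EFinD; congr EFin; lra.
- move: e1; rewrite le_eqVlt => /orP[/eqP <-|h]; rewrite ?mul0e ?adde0 ?gt0_muley//.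
- move: e1; rewrite le_eqVlt => /orP[/eqP <-|h]; rewrite ?mul0e ?adde0 ?gt0_muleNy//.
Qed.

(** The new Bernoulli label is independent of the new state given the current pair. *)
Lemma pop_vop F z : measurable_fun setT F -> (forall z, 0 <= F z)%E ->
  pop K F z = pop K (fun u => vop F u.1) z.
Proof.
move=> mF F0.
have mp (b : bool) : measurable_fun setT (fun u : T * bool => (u.1, b)).
  exact: (measurableT_comp (mpair b) measurable_fst).
rewrite /pop (ge0_int_mix_pushforward (mp true) (mp false) e0 e1 (fun C mC => Kprod z mC) mF F0) /vop.
have mFb b : measurable_fun setT (fun u : T * bool => F (u.1, b)) by exact: (measurableT_comp mF (mp b)).
rewrite (ge0_intD _ measurableT (measurable_funeM _ (mFb _)) _ (measurable_funeM _ (mFb _))); last 2 first.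
- by move=> u; rewrite mule_ge0.
- by move=> u; rewrite mule_ge0.
by rewrite !(ge0_intZl _ measurableT (mFb _)).
Qed.

Lemma pop_atom x (f : T -> \bar R) : S x -> measurable_fun setT f -> (forall x, 0 <= f x)%E ->
  pop K (fun u => f u.1) (x, true) = (\int[Psi]_y f y)%E.
Proof.
move=> Sx mf f0; rewrite /pop -int_pushforward//.
by apply: eq_measure_integral => B mB _; exact: KPsi.
Qed.

Lemma vop_pop_fst x (f : T -> \bar R) : measurable_fun setT f -> (forall x, 0 <= f x)%E ->
  vop (pop K (fun u => f u.1)) x = pop P f x.
Proof.
move=> mf f0; rewrite /pop.
by rewrite (ge0_int_mix_pushforward measurable_fst measurable_fst e0 e1 (fun B mB => KP x mB) mf f0).
Qed.

(** An intertwining relation: with the label averaged out, the split chain moves like the original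
    one. *)
Lemma vop_pop F : measurable_fun setT F -> (forall z, 0 <= F z)%E ->
  vop (pop K F) = pop P (vop F).
Proof.
move=> mF F0; apply/funext => x; rewrite -vop_pop_fst; last 2 first.
- exact: measurable_vop.
- exact: vop_ge0.
by rewrite /vop !(pop_vop _ mF F0).
Qed.

Definition vopA (F : T * bool -> \bar R) (x : T) : \bar R :=
  ((delta0 * \1_(~` S) x)%:E * F (x, true) + (1 - delta0)%:E * F (x, false))%E.

Lemma vop_restrict F x : vop (F \_ (~` A)) x = vopA F x.
Proof.
rewrite /vop /vopA !patchE.
have -> : ((x, false) \in ~` A) = true by apply/mem_set => -[].
have -> : ((x, true) \in ~` A) = (x \in ~` S).
  apply/idP/idP => /set_mem h; apply/mem_set.
    by move=> Sx; apply: h.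
  by move=> [].
rewrite indicE; case: (x \in ~` S); first by rewrite mulr1.
by rewrite mulr0 mul0e mule0.
Qed.

Lemma vop_vopA F x : (forall z, 0 <= F z)%E ->
  (vop F x = vopA F x + (delta0 * \1_S x)%:E * F (x, true))%E.
Proof.
move=> F0; rewrite /vop /vopA !indicE in_setC; case: (x \in S).
  by rewrite mulr1 mulr0 mul0e add0e addeC.
by rewrite mulr0 mulr1 mul0e adde0.
Qed.

Lemma int_bernoulli_vop (nu : probability T R) (F : T * bool -> \bar R) : measurable_fun setT F ->
  (forall z, 0 <= F z)%E ->
  (\int[nu \x bernoulli_prob delta0]_z F z = \int[nu]_x vop F x)%E.
Proof.
move=> mF F0; rewrite (fubini_tonelli1 F mF F0) /fubini_F.
apply: eq_integral => x _; rewrite integral_bernoulli_prob//.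
by rewrite e0 d1.
Qed.

Section law_transfer.
Context dO dO' (Omega : measurableType dO) (Omega' : measurableType dO').
Variables (nu : probability T R) (PX : probability Omega R) (PZ : probability Omega' R).
Variables (X : nat -> Omega -> T) (Z : nat -> Omega' -> T * bool).
Hypothesis MX : markov_chain PX (fun x => P x : set T -> \bar R) nu X.
Hypothesis MZ : markov_chain PZ (fun z => K z : set (T * bool) -> \bar R)
  (nu \x bernoulli_prob delta0)%E Z.
Variables (r : nat) (g : T -> 'rV[R]_r).
Hypothesis mg : measurable_fun setT g.

Let mg' : measurable_fun setT (fun z : T * bool => g z.1).
Proof. exact: (measurableT_comp mg measurable_fst). Qed.

(** The two chains are not coupled; both sides are written as iterated transition operators, which
    the intertwining relation matches step by step. *)
Lemma psum_law_transfer (phi : 'rV[R]_r -> \bar R) n s : measurable_fun setT phi ->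
  (forall s, 0 <= phi s)%E ->
  (\int[PX]_w phi (s + psum X g 0 n w)%R =
   \int[PZ]_w phi (s + psum Z (fun z => g z.1) 0 n w)%R)%E.
Proof.
move=> mp p0.
have mpX : measurable_fun setT (fun z : T * 'rV[R]_r => phi z.2).
  exact: (measurableT_comp mp measurable_snd).
have mpZ : measurable_fun setT (fun z : T * bool * 'rV[R]_r => phi z.2).
  exact: (measurableT_comp mp measurable_snd).
have mTX : measurable ([set: Omega] : set (hist X 0)) by exact: measurableT.
have mTZ : measurable ([set: Omega'] : set (hist Z 0)) by exact: measurableT.
have := @markov_psum _ _ _ _ _ PX P _ X MX r g mg setT 0 0 n _ s (leqnn 0) mTX mpX (fun z => p0 z.2).
rewrite add0n /= => ->.
have := @markov_psum _ _ _ _ _ PZ K _ Z MZ r _ mg' setT 0 0 n _ s (leqnn 0) mTZ mpZ (fun z => p0 z.2).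
rewrite add0n /= => ->.
rewrite psum_nil /= psum_nil /=.
set G := iter n (aop P g) _; set H := iter n (aop K _) _.
have mG : measurable_fun setT (fun x => G (x, (s + 0)%R)).
  apply: (measurableT_comp (measurable_iter_aop P mg n mpX (fun z => p0 z.2))).
  exact: measurable_fun_pair.
have mH (u : 'rV[R]_r) : measurable_fun setT (fun z => H (z, u)).
  apply: (measurableT_comp (measurable_iter_aop K mg' n mpZ (fun z => p0 z.2))).
  exact: measurable_fun_pair.
rewrite (markov_init (f := fun x => G (x, (s + 0)%R)) MX mG); last by move=> x; exact: iter_aop_ge0.
rewrite (markov_init (f := fun z => H (z, (s + 0)%R)) MZ (mH _)); last by move=> x; exact: iter_aop_ge0.
rewrite int_bernoulli_vop//; last by move=> x; exact: iter_aop_ge0.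
apply: eq_integral => x _; rewrite {mG mH}/G {}/H.
elim: n x (s + 0)%R => [|n IH] x u /=; first by rewrite (vop_fst (fun=> phi u)).
have mHn : measurable_fun setT (fun y => iter n (aop K (fun z => g z.1)) (fun z => phi z.2) (y, (u + g y.1)%R)).
  apply: (measurableT_comp (measurable_iter_aop K mg' n mpZ (fun z => p0 z.2))).
  by apply: measurable_fun_pair => //; exact: measurable_rowD.
rewrite -[RHS]/(vop (pop K (fun y => iter n (aop K (fun z => g z.1)) (fun z => phi z.2) (y, (u + g y.1)%R))) x).
rewrite vop_pop//; last by move=> y; exact: iter_aop_ge0.
by apply: eq_integral => y _; rewrite IH.
Qed.

End law_transfer.

Let a0 x : 0 <= delta0 * \1_(~` S) x.
Proof. by rewrite mulr_ge0. Qed.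

Lemma measurable_vopA F : measurable_fun setT F -> measurable_fun setT (vopA F).
Proof.
move=> mF; apply: emeasurable_funD; last first.
  by apply: measurable_funeM; exact: (measurableT_comp mF (mpair _)).
apply: emeasurable_funM; last exact: (measurableT_comp mF (mpair _)).
apply/measurable_EFinP; apply: measurable_funM => //.
by apply: measurable_indic; exact: measurableC.
Qed.

Lemma vopA_ge0 F : (forall z, 0 <= F z)%E -> forall x, (0 <= vopA F x)%E.
Proof. by move=> F0 x; rewrite adde_ge0// mule_ge0// lee_fin. Qed.

(** This is [P x B] minus [delta0 * Psi B] on [S], the kernel killed at visits to the atom. Built as
    a combination of the two conditional laws rather than as a difference, it is a measure by
    construction. *)
Lemma taboo_kernel : exists Q : R.-fker T ~> T, forall x B, measurable B ->
  Q x B = vopA (fun z => K z (fst @^-1` B)) x.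
Proof.
have m1 (B : set T) : measurable B -> measurable (fst @^-1` B : set (T * bool)).
  by move=> mB; rewrite -[X in measurable X]setTI; exact: measurable_fst.
apply: finite_kernel_of.
- by move=> x; rewrite /vopA preimage_set0 !measure0 !mule0 adde0.
- by move=> x B mB; rewrite vopA_ge0.
- move=> x.
  have mf : measurable_fun setT (fst : T * bool -> T) by exact: measurable_fst.
  pose mu : {measure set T -> \bar R} :=
     measure_add (mscale (NngNum (a0 x)) (pushforward (K (x, true)) fst))
     (mscale (NngNum e1) (pushforward (K (x, false)) fst)).
  have -> : (fun B : set T => vopA (fun z => K z (fst @^-1` B)) x) = (mu mf mf : set T -> \bar R).
    by apply/funext => B; rewrite /mu /= -[RHS]/(measure_add _ _ B) measure_addE.
  exact: measure_semi_sigma_additive.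
- move=> B mB; apply: measurable_vopA.
  exact: (measurable_kernel K _ (m1 _ mB)).
- move=> x; rewrite preimage_setT /vopA.
  apply: (@le_trans _ _ (delta0%:E * 1 + (1 - delta0)%:E * 1)%E).
    apply: leeD; last by apply: lee_wpmul2l => //; rewrite lee_fin.
    apply: lee_pmul => //; rewrite lee_fin ?a0// ler_piMr//.
  by rewrite !mule1 -EFinD addrC subrK.
Qed.

(** * The killed kernel: geometric decay and Kac's formula *)

Section taboo.
Variable Q : R.-fker T ~> T.
Hypothesis QE : forall x B, measurable B -> Q x B = vopA (fun z => K z (fst @^-1` B)) x.
Implicit Types (f : T -> \bar R) (F : T * bool -> \bar R).

Lemma vopA_pop_fst f : measurable_fun setT f -> (forall x, 0 <= f x)%E ->
  vopA (pop K (fun u => f u.1)) = pop Q f.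
Proof.
move=> mf f0; apply/funext => x; rewrite /pop.
by rewrite (ge0_int_mix_pushforward measurable_fst measurable_fst (a0 x) e1 (fun B mB => QE x mB) mf f0).
Qed.

Lemma restrict_ge0 F : (forall z, 0 <= F z)%E -> forall z, (0 <= (F \_ (~` A)) z)%E.
Proof. by move=> F0 z; rewrite patchE; case: ifP. Qed.

Lemma measurable_restrictA F : measurable_fun setT F -> measurable_fun setT (F \_ (~` A)).
Proof.
move=> mF; apply/(measurable_restrictT _ _).1; first exact: measurableC.
exact: measurable_funTS.
Qed.

Lemma kop_vopA F z : measurable_fun setT F -> (forall z, 0 <= F z)%E ->
  kop K (~` A) F z = pop K (fun u => vopA F u.1) z.
Proof.
move=> mF F0; rewrite /kop integral_mkcond.
rewrite -[LHS]/(pop K (F \_ (~` A)) z) (pop_vop z (measurable_restrictA mF) (restrict_ge0 F0)).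
by congr (pop K _ z); apply/funext => u; exact: vop_restrict.
Qed.

Lemma vopA_iter_kop F n : measurable_fun setT F -> (forall z, 0 <= F z)%E ->
  vopA (iter n (kop K (~` A)) F) = iter n (pop Q) (vopA F).
Proof.
move=> mF F0; have mAc := measurableC mA; elim: n => [//|n IH] /=.
have mI : measurable_fun setT (iter n (kop K (~` A)) F) by apply: measurable_iter_kop.
have I0 z : (0 <= iter n (kop K (~` A)) F z)%E by apply: iter_kop_ge0.
rewrite -IH -vopA_pop_fst; last 2 first.
- exact: measurable_vopA.
- exact: vopA_ge0.
by apply/funext => x; rewrite /vopA !kop_vopA.
Qed.

(** Nummelin's decomposition of [P] into the killed part and the regeneration. *)
Lemma pop_taboo f x : measurable_fun setT f -> (forall x, 0 <= f x)%E ->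
  (pop P f x = pop Q f x + (delta0 * \1_S x)%:E * \int[Psi]_y f y)%E.
Proof.
move=> mf f0; rewrite -vopA_pop_fst// -vop_pop_fst//.
have g0 : forall z, (0 <= pop K (fun u => f u.1) z)%E by exact: pop_ge0.
rewrite (vop_vopA x g0); congr (_ + _)%E.
have [Sx|Sx] := pselect (S x); first by rewrite pop_atom.
by rewrite indicE memNset// mulr0 !mul0e.
Qed.

Lemma pop_taboo_le f x : measurable_fun setT f -> (forall x, 0 <= f x)%E ->
  (pop Q f x <= pop P f x)%E.
Proof.
move=> mf f0; rewrite pop_taboo// leeDl// mule_ge0//; first by rewrite lee_fin mulr_ge0.
exact: integral_ge0.
Qed.

Lemma iter_pop_taboo_le f n x : measurable_fun setT f -> (forall x, 0 <= f x)%E ->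
  (iter n (pop Q) f x <= iter n (pop P) f x)%E.
Proof.
move=> mf f0; elim: n x => [//|n IH] x /=.
apply: (le_trans (pop_taboo_le _ _ _)).
- exact: measurable_iter_pop.
- exact: iter_pop_ge0.
apply: le_pop => //; [exact: measurable_iter_pop|exact: measurable_iter_pop|exact: iter_pop_ge0].
Qed.


Section geometric.
Variables (pi : probability T R) (E : set T) (m : nat) (c : R).
Hypotheses (mE : measurable E) (SE : S `<=` E) (c0 : 0 < c).
Hypothesis inv : forall f : T -> \bar R, measurable_fun setT f -> (forall x, 0 <= f x)%E ->
  (\int[pi]_x pop P f x = \int[pi]_x f x)%E.
Hypothesis minor : forall x B, E x -> measurable B ->
  (c%:E * pi B <= iter m (pop P) (fun y => (\1_B y)%:E) x)%E.
Hypotheses (piE : pi (~` E) = 0%E) (piS : pi S != 0%E).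

Let v j := iter j (pop P) (fun y => (\1_(~` E) y)%:E).

Let m1 (B : set T) : measurable B -> measurable_fun setT (fun y => (\1_B y)%:E : \bar R).
Proof. by move=> mB; apply/measurable_EFinP; exact: measurable_indic. Qed.

Let i0 (B : set T) y : (0 <= (\1_B y)%:E :> \bar R)%E.
Proof. by rewrite lee_fin. Qed.

Let mv j : measurable_fun setT (v j).
Proof. by apply: measurable_iter_pop => //; apply: m1; exact: measurableC. Qed.

Let v0 j x : (0 <= v j x)%E. Proof. exact: iter_pop_ge0. Qed.

(* The points from which the chain almost surely never leaves [E]. *)
Definition core : set T := [set x | forall j, v j x = 0%E].

Let coreC : ~` core = \bigcup_j [set x | v j x != 0%E].
Proof.
apply/seteqP; split => x /=; first by move=> /existsNP[j /eqP h]; exists j.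
by move=> [j _ /= /eqP h] /(_ j).
Qed.

Let mvj j : measurable [set x | v j x != 0%E].
Proof. by have := emeasurable_neq measurableT (mv j) 0%E; rewrite setTI. Qed.

Lemma measurable_coreC : measurable (~` core).
Proof. by rewrite coreC; exact: bigcupT_measurable. Qed.

Lemma null_coreC (mu : {measure set T -> \bar R}) :
  (forall j, \int[mu]_x v j x = 0)%E -> mu (~` core) = 0%E.
Proof. by move=> h; rewrite coreC; apply: null_bigcup => // j; exact: int0_null. Qed.

Lemma core_sub : core `<=` E.
Proof.
move=> x /(_ 0%N) /= [] /eqP; rewrite indicE; case: (boolP (x \in ~` E)) => [_|].
  by rewrite oner_eq0.
by rewrite notin_setE /= => /contrapT.
Qed.

Lemma core_absorbing x : core x -> P x (~` core) = 0%E.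
Proof. by move=> cx; apply: null_coreC => j; exact: (cx j.+1). Qed.

Lemma pi_coreC : pi (~` core) = 0%E.
Proof.
apply: null_coreC => j; rewrite -piE -(integral_ind _ (measurableC mE)).
elim: j => [//|j IH]; rewrite -IH; apply: inv => //.
Qed.

(** As [pi] charges [S] but not the complement of [core], some point of [S] lies in [core]; from
    there [P] does not leave [core], and [P] dominates [delta0] times [Psi]. *)
Lemma Psi_coreC : Psi (~` core) = 0%E.
Proof.
have [x [Sx cx]] : exists x, S x /\ core x.
  apply: contrapT => h; move/eqP: piS; apply.
  apply: (@subset_measure0 _ _ _ _ _ (~` core)) => //; first exact: measurable_coreC.
    by move=> x Sx cx; apply: h; exists x.
  exact: pi_coreC.
have := KP x measurable_coreC; rewrite core_absorbing// KPsi//; last exact: measurable_coreC.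
move/esym/eqP; rewrite padde_eq0 ?mule_ge0// => /andP[+ _].
by rewrite mule_eq0 eqe gt_eqF//= => /eqP.
Qed.

Let Q_coreC x : core x -> Q x (~` core) = 0%E.
Proof.
move=> cx; apply/eqP; rewrite eq_le measure_ge0 andbT -(core_absorbing cx).
rewrite -!(integral_ind _ measurable_coreC).
by apply: pop_taboo_le => //; apply: m1; exact: measurable_coreC.
Qed.

Lemma ae_core (mu : {measure set T -> \bar R}) (H : T -> Prop) :
  mu (~` core) = 0%E -> (forall x, core x -> H x) -> {ae mu, forall x, H x}.
Proof.
move=> mu0 h; exists (~` core); split => //; first exact: measurable_coreC.
by move=> x /= nH cx; apply: nH; exact: h.
Qed.

Lemma le_pop_taboo_core f h s x : measurable_fun setT f -> (forall x, 0 <= f x)%E ->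
  measurable_fun setT h -> (forall x, 0 <= h x)%E -> 0 <= s ->
  (forall y, core y -> (f y <= s%:E * h y)%E) -> core x ->
  (pop Q f x <= s%:E * pop Q h x)%E.
Proof.
move=> mf f0 mh h0 s0 fh cx; rewrite -popZ// /pop.
apply: ae_ge0_le_integral => //.
- by move=> y _; rewrite mule_ge0.
- exact: measurable_funeM.
by apply: (ae_core (Q_coreC cx)) => y cy _; exact: fh.
Qed.

Lemma le_iter_pop_taboo_core n f h s x : measurable_fun setT f -> (forall x, 0 <= f x)%E ->
  measurable_fun setT h -> (forall x, 0 <= h x)%E -> 0 <= s ->
  (forall y, core y -> (f y <= s%:E * h y)%E) -> core x ->
  (iter n (pop Q) f x <= s%:E * iter n (pop Q) h x)%E.
Proof.
move=> mf f0 mh h0 s0 fh; elim: n x => [|n IH] x cx /=; first exact: fh.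
apply: le_pop_taboo_core => //.
- exact: measurable_iter_pop.
- exact: iter_pop_ge0.
- exact: measurable_iter_pop.
- exact: iter_pop_ge0.
Qed.

Let one : T -> \bar R := cst 1%E.
Let mone : measurable_fun setT one. Proof. exact: measurable_cst. Qed.
Let one0 x : (0 <= one x)%E. Proof. exact: lee01. Qed.

Let popQ1 x : (pop Q one x <= one x)%E.
Proof.
apply: (le_trans (pop_taboo_le _ _ _)) => //.
by rewrite /pop integral_cst// P1 mule1.
Qed.

Lemma iter_taboo_ni i j x : (i <= j)%N -> (iter j (pop Q) one x <= iter i (pop Q) one x)%E.
Proof.
move=> /subnK <-; elim: (j - i)%N => [//|n IH]; apply: le_trans IH.
rewrite addSn iterSr.
exact: (le_iter_pop Q _ (measurable_pop Q mone one0) mone (pop_ge0 Q one0) popQ1).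
Qed.

(** The minorization leads to [S] after [m] steps with probability at least [c * pi S], and the
    label is 1 with probability [delta0]. *)
Let a := delta0 * c * fine (pi S).

Let piSE : pi S = (fine (pi S))%:E.
Proof. by rewrite fineK// fin_num_measure. Qed.

Let a_gt0 : 0 < a.
Proof. by rewrite !mulr_gt0// fine_gt0// lt0e piS measure_ge0/= -ge0_fin_numE ?fin_num_measure. Qed.

(* Every [m.+1] steps the atom is hit with probability at least [a]. *)
Let taboo_block x : E x -> (iter m.+1 (pop Q) one x <= (1 - a)%:E)%E.
Proof.
move=> Ex; pose s0 y : \bar R := ((1 - delta0 * \1_S y)%:E).
have s00 y : (0 <= s0 y)%E.
  rewrite lee_fin subr_ge0 -[leRHS]mulr1 ler_pM//.
have ms0 : measurable_fun setT s0.
  apply/measurable_EFinP; apply: measurable_funB => //.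
  by apply: measurable_funM => //; exact: measurable_indic.
have h y : (pop Q one y <= s0 y)%E.
  have e := pop_taboo y mone one0.
  have eP : pop P one y = 1%E by rewrite /pop integral_cst// mul1e P1.
  have eQ : pop Q one y = Q y setT by rewrite /pop integral_cst// mul1e.
  rewrite eP int_cst mule1 in e.
  have f : Q y setT \is a fin_num.
    rewrite ge0_fin_numE//; rewrite -eQ; apply: (le_lt_trans (popQ1 y)).
    by rewrite /one ltry.
  by rewrite /s0 EFinB -[X in (X - _)%E]/(1%E : \bar R) e eQ addeK.
rewrite iterSr; apply: (le_trans (le_iter_pop Q m (measurable_pop Q mone one0) ms0 (pop_ge0 Q one0) h x)).
apply: (le_trans (iter_pop_taboo_le m x ms0 s00)).
have mS1 : measurable_fun setT (fun y => delta0%:E * (\1_S y)%:E : \bar R)%E.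
  by apply: measurable_funeM; exact: m1.
have S10 y : (0 <= delta0%:E * (\1_S y)%:E :> \bar R)%E by rewrite mule_ge0.
have := iter_popD P m ms0 mS1 s00 S10 x.
rewrite (_ : (fun x => s0 x + _)%E = (fun=> 1%:E)); last first.
  by apply/funext => y; rewrite /s0 -EFinM -EFinD subrK.
rewrite iter_pop_cst// iter_popZ//; last exact: m1.
set q := iter m _ _ x; set q2 := iter m _ _ x => e.
have q2a : (a%:E <= delta0%:E * q2)%E.
  by rewrite /a -mulrA EFinM lee_pmul2l// EFinM -piSE; exact: minor.
have q0 : (0 <= q)%E by exact: iter_pop_ge0.
move: e q2a q0; case: q => [q| |]; case: (delta0%:E * q2)%E => [y| |]//= [].
  by rewrite !lee_fin => e ya q0; lra.
Qed.

Lemma taboo_geometric_block j x : core x ->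
  (iter (m.+1 * j) (pop Q) one x <= ((1 - a) ^+ j)%:E)%E.
Proof.
have a1 y : core y -> 0 <= 1 - a.
  move=> cy; rewrite -lee_fin; apply: le_trans (taboo_block (core_sub cy)).
  exact: iter_pop_ge0.
elim: j x => [|j IH] x cx; first by rewrite muln0 expr0.
rewrite mulnS iterD exprSr EFinM.
apply: (@le_trans _ _ (((1 - a) ^+ j)%:E * iter m.+1 (pop Q) one x)%E).
  apply: le_iter_pop_taboo_core => //.
  - exact: measurable_iter_pop.
  - exact: iter_pop_ge0.
  - by rewrite exprn_ge0// (a1 x).
  - by move=> y cy; rewrite mule1; exact: IH.
by apply: lee_wpmul2l; [rewrite lee_fin exprn_ge0// (a1 x)|exact/taboo_block/core_sub].
Qed.

Lemma taboo_geometric : exists c' rho : R, [/\ 0 <= c', 0 < rho < 1 &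
  forall n x, core x -> (iter n (pop Q) one x <= (c' * rho ^+ n)%:E)%E].
Proof.
(* The rate per [m.+1] steps becomes a rate per step without roots: for [rho := 1 - a' / m.+1],
   Bernoulli's inequality gives [1 - a' <= rho ^+ m.+1]. The minimum with one half keeps [1 - a']
   positive; its inverse pays for the incomplete group of steps. *)
pose a' := Num.min a 2^-1; have a'0 : 0 < a' by rewrite lt_min a_gt0/=.
have a'2 : a' <= 2^-1 by rewrite ge_min lexx orbT.
have a'a : a' <= a by rewrite ge_min lexx.
pose q := a' / m.+1%:R; pose rho : R := 1 - q.
have q0 : 0 < q by rewrite divr_gt0.
have qa : q <= a' by rewrite ler_pdivrMr// ler_peMr ?(ltW a'0)// ler1n.
have rho0 : 0 < rho by rewrite /rho; lra.
have bern n : 1 - n%:R * q <= rho ^+ n.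
  elim: n => [|n IH]; first by rewrite mul0r subr0.
  have := ler_wpM2l (ltW rho0) IH; rewrite exprS => h; apply: le_trans h.
  have : 0 <= n%:R * q * q by rewrite !mulr_ge0// ltW.
  by rewrite /rho -[n.+1%:R]natr1 !mulrBl !mulrBr !mul1r mulrDl mul1r mulr1; lra.
have rm : 1 - a' <= rho ^+ m.+1.
  by apply: le_trans (bern _); rewrite /q mulrCA mulfV// mulr1.
exists (1 - a')^-1, rho; split.
- by rewrite invr_ge0; lra.
- by rewrite rho0/= /rho; lra.
move=> n x cx; apply: (@le_trans _ _ (iter (m.+1 * (n %/ m.+1)) (pop Q) one x)).
  by apply: iter_taboo_ni; rewrite mulnC leq_trunc_div.
apply: (le_trans (taboo_geometric_block _ cx)); rewrite lee_fin.
have a1 : 0 <= 1 - a.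
  rewrite -lee_fin; apply: le_trans (taboo_block (core_sub cx)).
  exact: iter_pop_ge0.
have le1 : (1 - a) ^+ (n %/ m.+1) <= rho ^+ (m.+1 * (n %/ m.+1)).
  rewrite exprM; apply: lerXn2r; rewrite ?nnegrE//; first by rewrite exprn_ge0// ltW.
  by apply: le_trans rm; lra.
apply: (le_trans le1).
have -> : rho ^+ n = rho ^+ (m.+1 * (n %/ m.+1)) * rho ^+ (n %% m.+1).
  by rewrite -exprD mulnC -divn_eq.
rewrite mulrCA ler_peMr//; first by rewrite exprn_ge0// ltW.
rewrite mulrC ler_pdivlMr ?mul1r; last by lra.
apply: (le_trans rm); apply: ler_wiXn2l; first exact: ltW.
- by rewrite /rho; lra.
- by rewrite ltnW// ltn_pmod.
Qed.

(** Kac's formula for the killed kernel. Invariance and [pop_taboo] express [pi] as its image under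
    [Q] plus [delta0 * pi S] times [Psi]; iterating produces the series, and the geometric decay
    removes the remainder. *)
Lemma int_taboo_series (f : T -> \bar R) (M : R) : measurable_fun setT f ->
  (forall x, 0 <= f x)%E -> (forall x, f x <= M%:E)%E ->
  (delta0%:E * pi S * \sum_(0 <= i <oo) \int[Psi]_x iter i (pop Q) f x = \int[pi]_x f x)%E.
Proof.
move=> mf f0 fM.
have mI n : measurable_fun setT (iter n (pop Q) f) by exact: measurable_iter_pop.
have I0 n x : (0 <= iter n (pop Q) f x)%E by exact: iter_pop_ge0.
pose u i := (\int[Psi]_x iter i (pop Q) f x)%E.
have u0 i : (0 <= u i)%E by exact: integral_ge0.
have k0 : (0 <= delta0%:E * pi S)%E by rewrite mule_ge0.
have step n : (\int[pi]_x iter n (pop Q) f x =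
    \int[pi]_x iter n.+1 (pop Q) f x + delta0%:E * pi S * u n)%E.
  rewrite -[LHS](inv (mI n) (I0 n)).
  under eq_integral do rewrite (pop_taboo _ (mI n) (I0 n)).
  have mS1 : measurable_fun setT (fun y => (delta0 * \1_S y)%:E : \bar R).
    by apply/measurable_EFinP; apply: measurable_funM => //; exact: measurable_indic.
  rewrite (ge0_intD _ measurableT (mI n.+1) (I0 n.+1)); last 2 first.
  - exact: emeasurable_funM.
  - by move=> x; apply: mule_ge0; [rewrite lee_fin mulr_ge0|exact: integral_ge0].
  congr (_ + _)%E; rewrite ge0_integralZr//; last 2 first.
  - by move=> x _; rewrite lee_fin mulr_ge0.
  - exact: u0.
  congr (_ * _)%E; under eq_integral do rewrite EFinM.
  rewrite (ge0_intZl _ measurableT (m1 mS) (i0 _))//.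
  by rewrite integral_ind.
have sums N : (\int[pi]_x f x = \int[pi]_x iter N (pop Q) f x +
    delta0%:E * pi S * \sum_(0 <= i < N) u i)%E.
  elim: N => [|N IH]; first by rewrite big_nil mule0 adde0.
  rewrite IH step -addeA big_nat_recr// [in RHS]ge0_muleDr; last 2 first.
  - by apply: sume_ge0 => i _; exact: u0.
  - exact: u0.
  by rewrite [X in (_ + X)%E]addeC.
have [x0 Ex0] : exists x, E x.
  apply: contrapT => h; move/eqP: piS; apply; rewrite (_ : S = set0) ?measure0//.
  by apply/seteqP; split => // x /SE Ex; apply: h; exists x.
have M0 : 0 <= M by rewrite -lee_fin (le_trans (f0 x0)).
have [c' [rho [c'0 /andP[rho0 rho1] geo]]] := taboo_geometric.
have rest N : (\int[pi]_x iter N (pop Q) f x <= (M * (c' * rho ^+ N))%:E)%E.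
  rewrite -[leRHS](int_cst pi); apply: ae_ge0_le_integral => //.
    by move=> x _; rewrite lee_fin !mulr_ge0// exprn_ge0// ltW.
  apply: (ae_core pi_coreC) => x cx _.
  apply: (@le_trans _ _ (M%:E * iter N (pop Q) one x)%E).
    by apply: le_iter_pop_taboo_core => // y _; rewrite mule1.
  by rewrite EFinM; apply: lee_wpmul2l; [rewrite lee_fin|exact: geo].
have cvs : cvgn (fun N => \sum_(0 <= i < N) u i)%E by apply: is_cvg_nneseries.
apply/eqP; rewrite eq_le; apply/andP; split.
  rewrite -limeMl//; last by rewrite fin_numM// fin_num_measure.
  apply: lime_le; first by apply: is_cvgeMl => //; rewrite fin_numM// fin_num_measure.
  by apply: nearW => N; rewrite (sums N) leeDr//; exact: integral_ge0.
apply/lee_addgt0Pr => e e_gt0.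
have /cvgrPdist_lt/(_ e e_gt0) [N _ /(_ N (leqnn N))] : (fun N => M * c' * rho ^+ N) @ \oo --> (0 : R).
  rewrite -[X in _ --> X](mulr0 (M * c')); apply: cvgMr.
  by apply: cvg_expr; rewrite ger0_norm// ltW.
rewrite /= sub0r normrN ger0_norm; last by rewrite !mulr_ge0// exprn_ge0// ltW.
move=> Ne; rewrite (sums N) addeC; apply: leeD.
  apply: lee_wpmul2l => //; exact: nneseries_lim_ge.
by apply: (le_trans (rest N)); rewrite lee_fin mulrA ltW.
Qed.

Section chain.
Context dO (Omega : measurableType dO).
Variables (Z : nat -> Omega -> T * bool) (PA : probability Omega R).

Lemma vopA1_le x : (vopA (cst 1%E) x <= 1)%E.
Proof.
rewrite /vopA /= !mule1 -EFinD lee_fin.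
have h : delta0 * \1_(~` S) x <= delta0 by rewrite ler_piMr.
lra.
Qed.

Lemma iter_kop_atom (F : T * bool -> \bar R) n z : measurable_fun setT F ->
  (forall z, 0 <= F z)%E -> A z ->
  iter n.+1 (kop K (~` A)) F z = (\int[Psi]_x iter n (pop Q) (vopA F) x)%E.
Proof.
move=> mF F0; case: z => x b [/= Sx ->].
have mAc := measurableC mA.
rewrite /= kop_vopA; last 2 first.
- by apply: measurable_iter_kop.
- by move=> z; apply: iter_kop_ge0.
rewrite pop_atom//; last 2 first.
- by apply: measurable_vopA; apply: measurable_iter_kop.
- by move=> y; apply: vopA_ge0 => z; apply: iter_kop_ge0.
by rewrite vopA_iter_kop.
Qed.

Section atom_start.
Variable muA : probability (T * bool)%type R.
Hypothesis muA1 : muA A = 1%E.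
Hypothesis MCA : markov_chain PA (fun z => K z : set (T * bool) -> \bar R) muA Z.

Let mZ n : measurable_fun setT (Z n). Proof. by case: MCA. Qed.

Let mst n : measurable (stays Z (~` A) 0 n).
Proof. exact: (measurable_stays MCA 0 n (measurableC mA)). Qed.

Let init_atom (F : T * bool -> \bar R) (b : \bar R) : measurable_fun setT F ->
  (forall z, 0 <= F z)%E -> (0 <= b)%E -> (forall z, A z -> F z = b) ->
  (\int[PA]_w F (Z 0 w) = b)%E.
Proof.
move=> mF F0 b0 FA; rewrite (markov_init MCA mF F0) -[RHS](int_cst muA).
apply: ge0_ae_eq_integral => //.
exists (~` A); split; first exact: measurableC.
- by have := probability_setC muA mA; rewrite muA1 subee.
- by move=> z /= h Az; apply: h => _; exact: FA.
Qed.

Lemma tail_atom n : (PA (stays Z (~` A) 0 n.+1) <= \int[Psi]_x iter n (pop Q) one x)%E.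
Proof.
have mAc := measurableC mA.
have mT : measurable ([set: Omega] : set (hist Z 0)) by exact: measurableT.
have := @markov_stays _ _ _ _ _ PA K _ Z MCA (~` A) setT 0 n.+1 (cst 1%E) mAc mT (measurable_cst _) (fun _ => lee01).
rewrite add0n setTI integral_cst// mul1e => ->.
rewrite (init_atom _ _ _ (fun z Az => iter_kop_atom n (measurable_cst 1%E) (fun _ => lee01) Az)); last 3 first.
- by apply: measurable_iter_kop.
- by move=> z; apply: iter_kop_ge0.
- apply: integral_ge0 => x _; apply: iter_pop_ge0 => y; apply: vopA_ge0 => z; exact: lee01.
have mv1 : measurable_fun setT (vopA (cst 1%E)) by apply: measurable_vopA.
have v10 x : (0 <= vopA (cst 1%E) x)%E by apply: vopA_ge0 => z; exact: lee01.
apply: (ge0_int_le _ measurableT).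
- exact: measurable_iter_pop.
- exact: measurable_iter_pop.
- exact: iter_pop_ge0.
by apply: le_iter_pop => // x; exact: vopA1_le.
Qed.

(** Kac's formula along the path: the term of index [i.+1] belongs to the block when the atom is
    avoided at times 1 to [i], and by the Markov property its mean is the [i]-th term of
    [int_taboo_series]. *)
Lemma int_block_sum (f : T -> \bar R) (M : R) : measurable_fun setT f ->
  (forall x, 0 <= f x)%E -> (forall x, f x <= M%:E)%E ->
  PA (rt Z A @^-1` [set 0%N]) = 0%E ->
  (delta0%:E * pi S * \int[PA]_w \sum_(1 <= i < (rt Z A w).+1) f (Z i w).1
    = \int[pi]_x f x)%E.
Proof.
move=> mf f0 fM rt0; rewrite -(int_taboo_series mf f0 fM); congr (_ * _)%E.
have mAc := measurableC mA.
have mff : measurable_fun setT (fun z : T * bool => f z.1) by exact: (measurableT_comp mf measurable_fst).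
have mfZ i : measurable_fun setT (fun w => f (Z i w).1) by exact: (measurableT_comp mff (mZ i)).
pose h i w : \bar R := ((\1_(stays Z (~` A) 0 i) w)%:E * f (Z i.+1 w).1)%E.
have h0 i w : (0 <= h i w)%E by rewrite mule_ge0// lee_fin.
have mh i : measurable_fun setT (h i).
  by apply: emeasurable_funM => //; apply/measurable_EFinP; exact: measurable_indic.
have term i : (\int[Psi]_x iter i (pop Q) f x = \int[PA]_w h i w)%E.
  have mT : measurable ([set: Omega] : set (hist Z 0)) by exact: measurableT.
  have mpK : measurable_fun setT (pop K (fun z => f z.1)) by exact: measurable_pop.
  have pK0 z : (0 <= pop K (fun z => f z.1) z)%E by exact: pop_ge0.
  transitivity (\int[PA]_(w in stays Z (~` A) 0 i) f (Z i.+1 w).1)%E; last first.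
    rewrite [LHS]integral_mkcond; apply: eq_integral => w _.
    by rewrite patchE /h indicE; case: ifP => _; rewrite ?mul1e ?mul0e.
  have := @markov_joint _ _ _ _ _ PA K _ Z MCA _ _ i (stays Z (~` A) 0 i) (Z i)
    (@measurable_hist_stays _ _ _ _ Z (~` A) 0 i mAc) (measurable_hist (X:=Z) (leqnn i))
    (fun zz => f zz.2.1) (measurableT_comp mff measurable_snd) (fun _ => f0 _).
  rewrite /= => ->.
  have := @markov_stays _ _ _ _ _ PA K _ Z MCA (~` A) setT 0 i _ mAc mT mpK pK0.
  rewrite add0n setTI /pop => ->; rewrite -/(pop K _).
  apply/esym; apply: init_atom.
  - by apply: measurable_iter_kop.
  - by move=> z; apply: iter_kop_ge0.
  - by apply: integral_ge0 => x _; exact: iter_pop_ge0.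
  case: i => [|i] z Az.
    by case: z Az => x b [/= Sx ->]; exact: pop_atom.
  by rewrite iter_kop_atom// vopA_pop_fst// -iterSr.
under [RHS]eq_eseriesr do rewrite term.
rewrite -(integral_nneseries _ measurableT mh (fun i w _ => h0 i w)).
apply: ge0_ae_eq_integral => //.
- apply: (@measurable_fun_natdep _ _ _ _ (rt Z A) (fun n w => \sum_(1 <= i < n.+1) f (Z i w).1)%E).
    by move=> i; exact: measurable_rt.
  by move=> n; apply: emeasurable_sum.
- exact: ge0_emeasurable_sum.
- by move=> w _; apply: sume_ge0.
- by move=> w _; apply: nneseries_ge0 => i _ _.
exists (rt Z A @^-1` [set 0%N]); split => //; first exact: measurable_rt.
move=> w /= H; apply: contrapT => /eqP; rewrite -lt0n => r0; apply: H => _.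
rewrite (nneseries_split 0 (rt Z A w)); last by move=> i _; exact: h0.
rewrite add0n [X in (_ + X)%E]eseries0 ?adde0; last first.
  move=> i ri _; rewrite /h indicE memNset ?mul0e// -rt_gtE /=.
  by case=> [r00|]; [rewrite r00 in r0|rewrite ltnNge ri].
rewrite big_add1 /=; apply: eq_big_nat => i /andP[_ ir].
by rewrite /h indicE mem_set ?mul1e// -rt_gtE /=; right.
Qed.

End atom_start.

Section other_start.
Variables (nu : probability T R) (P0 : probability Omega R).
Hypothesis nu_core : nu (~` core) = 0%E.
Hypothesis MC : markov_chain P0 (fun z => K z : set (T * bool) -> \bar R)
  (nu \x bernoulli_prob delta0)%E Z.

Lemma tail_other n : (P0 (stays Z (~` A) 0 n.+1) <=
  \int[nu]_x pop P (iter n (pop Q) one) x)%E.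
Proof.
have mAc := measurableC mA.
have mst : measurable (stays Z (~` A) 0 n.+1) by exact: (measurable_stays MC).
have mT : measurable ([set: Omega] : set (hist Z 0)) by exact: measurableT.
have := @markov_stays _ _ _ _ _ P0 K _ Z MC (~` A) setT 0 n.+1 (cst 1%E) mAc mT (measurable_cst _) (fun _ => lee01).
rewrite add0n setTI integral_cst// mul1e => ->.
have mI : measurable_fun setT (iter n (kop K (~` A)) (cst 1%E)) by apply: measurable_iter_kop.
have I0 z : (0 <= iter n (kop K (~` A)) (cst 1%E) z)%E by apply: iter_kop_ge0.
rewrite (markov_init MC (f := iter n.+1 (kop K (~` A)) (cst 1%E))); last 2 first.
- by apply: measurable_iter_kop.
- by move=> z; apply: iter_kop_ge0.
rewrite (int_bernoulli_vop nu); last 2 first.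
- by apply: measurable_iter_kop.
- by move=> z; apply: iter_kop_ge0.
have mv1 : measurable_fun setT (vopA (cst 1%E)) by apply: measurable_vopA.
have v10 x : (0 <= vopA (cst 1%E) x)%E by apply: vopA_ge0 => z; exact: lee01.
have e x : vop (iter n.+1 (kop K (~` A)) (cst 1%E)) x = pop P (iter n (pop Q) (vopA (cst 1%E))) x.
  rewrite -vopA_iter_kop// -vop_pop_fst; last 2 first.
  - exact: measurable_vopA.
  - exact: vopA_ge0.
  by rewrite /vop /= !kop_vopA.
under eq_integral do rewrite e.
apply: (ge0_int_le _ measurableT).
- by apply: measurable_pop; [exact: measurable_iter_pop|exact: iter_pop_ge0].
- by apply: measurable_pop; [exact: measurable_iter_pop|exact: iter_pop_ge0].
- by apply: pop_ge0; exact: iter_pop_ge0.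
apply: le_pop; [exact: measurable_iter_pop|exact: measurable_iter_pop|exact: iter_pop_ge0|].
by apply: le_iter_pop => // x; exact: vopA1_le.
Qed.

Lemma geometric_tails (muA : probability (T * bool)%type R) : muA A = 1%E ->
  markov_chain PA (fun z => K z : set (T * bool) -> \bar R) muA Z ->
  exists c' rho : R, [/\ 0 <= c', 0 < rho < 1 &
  forall n, (PA (stays Z (~` A) 0 n) <= (c' * rho ^+ n)%:E)%E /\
            (P0 (stays Z (~` A) 0 n) <= (c' * rho ^+ n)%:E)%E].
Proof.
move=> muA1 MCA; have [c' [rho [c'0 /andP[rho0 rho1] geo]]] := taboo_geometric.
have ge n : 0 <= c' * rho ^+ n by rewrite mulr_ge0// exprn_ge0// ltW.
have hP n x : core x -> (pop P (iter n (pop Q) one) x <= (c' * rho ^+ n)%:E)%E.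
  move=> cx; apply: (@le_trans _ _ (\int[P x]_y (c' * rho ^+ n)%:E)%E); last first.
    by rewrite integral_cst// P1 mule1.
  apply: ae_ge0_le_integral => //; [by move=> y _; exact: iter_pop_ge0|exact: measurable_iter_pop|by move=> y _; rewrite lee_fin|].
  by apply: (ae_core (core_absorbing cx)) => y cy _; exact: geo.
have hA n : (PA (stays Z (~` A) 0 n.+1) <= (c' * rho ^+ n)%:E)%E.
  apply: (le_trans (tail_atom muA1 MCA n)); rewrite -[leRHS](int_cst Psi).
  apply: ae_ge0_le_integral => //; [by move=> y _; exact: iter_pop_ge0|exact: measurable_iter_pop|by move=> y _; rewrite lee_fin|].
  by apply: (ae_core Psi_coreC) => y cy _; exact: geo.
have hn n : (P0 (stays Z (~` A) 0 n.+1) <= (c' * rho ^+ n)%:E)%E.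
  apply: (le_trans (tail_other n)); rewrite -[leRHS](int_cst nu).
  apply: ae_ge0_le_integral => //.
  - by move=> y _; apply: pop_ge0; exact: iter_pop_ge0.
  - by apply: measurable_pop; [exact: measurable_iter_pop|exact: iter_pop_ge0].
  - by move=> y _; rewrite lee_fin.
  by apply: (ae_core nu_core) => y cy _; exact: hP.
have c1 : 0 <= c' / rho by rewrite divr_ge0// ltW.
(* The decay is known with the index shifted by one: dividing by [rho] shifts it back, and the added
   1 covers time 0. *)
have key (p : nat -> \bar R) : (p 0%N <= 1)%E -> (forall n, p n.+1 <= (c' * rho ^+ n)%:E)%E ->
    forall n, (p n <= ((1 + c' / rho) * rho ^+ n)%:E)%E.
  move=> p0 ps [|n].
    by apply: (le_trans p0); rewrite lee_fin expr0 mulr1 lerDl.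
  apply: (le_trans (ps n)); rewrite lee_fin mulrDl mul1r exprS.
  have -> : c' / rho * (rho * rho ^+ n) = c' * rho ^+ n by field; rewrite gt_eqF.
  by rewrite lerDr mulr_ge0// ?exprn_ge0// ltW.
exists (1 + c' / rho), rho; split.
- by rewrite addr_ge0.
- by rewrite rho0.
move=> n; split.
  apply: (key (fun n => PA (stays Z (~` A) 0 n)) _ hA).
  exact: (probability_le1 _ (measurable_stays MCA 0 0 (measurableC mA))).
apply: (key (fun n => P0 (stays Z (~` A) 0 n)) _ hn).
exact: (probability_le1 _ (measurable_stays MC 0 0 (measurableC mA))).
Qed.

End other_start.
End chain.
End geometric.

End taboo.
End split_chain.

(** * The Metropolis-Hastings kernel *)

Section density_measure.
Context (R : realType) (d : measure_display) (T : measurableType d).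
Variables (mu : {measure set T -> \bar R}) (h : T -> R).
Hypotheses (mh : measurable_fun setT h) (h0 : forall x, 0 <= h x).

Let mhE : measurable_fun setT (fun x => (h x)%:E). Proof. exact/measurable_EFinP. Qed.

Let hE0 x : (0 <= (h x)%:E)%E. Proof. by rewrite lee_fin. Qed.

Lemma int_sigma_additive : semi_sigma_additive (fun A => \int[mu]_(y in A) (h y)%:E)%E.
Proof.
move=> F mF tF mUF; rewrite ge0_integral_bigcup//; last exact: measurable_funTS.
by apply: is_cvg_nneseries => n _ _; exact: integral_ge0.
Qed.

Lemma int_density (nu : {measure set T -> \bar R}) :
  (forall A, measurable A -> nu A = \int[mu]_(y in A) (h y)%:E)%E ->
  forall f : T -> \bar R, measurable_fun setT f -> (forall x, 0 <= f x)%E ->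
  (\int[nu]_x f x = \int[mu]_x ((h x)%:E * f x))%E.
Proof.
move=> nuE; apply: ge0_measurable_fun_ind.
- move=> A mA; rewrite integral_ind// nuE// integral_mkcond; apply: eq_integral => x _.
  by rewrite patchE /= indicE; case: (x \in A); rewrite ?mule1 ?mule0.
- move=> k f k0 mf f0 IH; rewrite (ge0_intZl _ measurableT mf f0 k0) IH.
  rewrite -(ge0_intZl _ measurableT (emeasurable_funM mhE mf) _ k0); last by move=> x; rewrite mule_ge0.
  by apply: eq_integral => x _; rewrite muleCA.
- move=> f g mf f0 mg g0 IHf IHg.
  rewrite (ge0_intD _ measurableT mf f0 mg g0) IHf IHg -(ge0_intD _ measurableT (emeasurable_funM mhE mf) _ (emeasurable_funM mhE mg)); last 2 first.
  - by move=> x; rewrite mule_ge0.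
  - by move=> x; rewrite mule_ge0.
  by apply: eq_integral => x _; rewrite ge0_muleDr.
- move=> f_ mf f0 nd IH; rewrite (ge0_int_limn _ measurableT mf f0 nd).
  under eq_fun do rewrite IH.
  rewrite -(ge0_int_limn _ measurableT (fun n => emeasurable_funM mhE (mf n))); last 2 first.
  - by move=> n x; rewrite mule_ge0.
  - by move=> x i j ij; apply: lee_wpmul2l => //; exact: nd.
  apply: eq_integral => x _.
  have cv : cvgn (f_ ^~ x) by apply: ereal_nondecreasing_is_cvgn; exact: nd.
  by rewrite limeMl.
Qed.

Lemma density_probability : (\int[mu]_x (h x)%:E = 1)%E ->
  exists nu : probability T R, forall A, nu A = (\int[mu]_(y in A) (h y)%:E)%E.
Proof.
move=> h1.
have n0 : (\int[mu]_(y in set0) (h y)%:E = 0)%E by rewrite integral_set0.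
have nge0 A : (0 <= \int[mu]_(y in A) (h y)%:E)%E by apply: integral_ge0 => x _.
pose nu0 : {measure set T -> \bar R} := HB.pack (fun A => \int[mu]_(y in A) (h y)%:E)%E
  (isMeasure.Build _ _ _ (fun A => \int[mu]_(y in A) (h y)%:E)%E n0 nge0 int_sigma_additive).
have n1 : nu0 setT = 1%E by [].
pose nu : probability T R := HB.pack (Measure.sort nu0)
  (Measure_isProbability.Build _ _ _ (Measure.sort nu0) n1).
by exists nu.
Qed.

End density_measure.

(** * Boxes, open sets and the support of a density *)

Section boxes.
Context (R : realType) (n : nat).
Implicit Types (x y z : 'rV[R]_n) (s : R).

Definition box z s : set 'rV[R]_n := [set y | forall i, `|y ord0 i - z ord0 i| < s].

Lemma measurable_box z s : measurable (box z s).
Proof.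
rewrite (_ : box z s = \bigcap_(i in [set: 'I_n]) ([set y : 'rV[R]_n | `|y ord0 i - z ord0 i| < s])); last first.
  by apply/seteqP; split => y h i => [_|]; exact: h.
apply: fin_bigcap_measurable => // i _.
have mi : measurable_fun setT (fun y : 'rV[R]_n => `|y ord0 i - z ord0 i|).
  by apply: measurableT_comp => //; apply: measurable_funB => //; exact: measurable_row_coord.
have := mi measurableT _ (measurable_itv `]-oo, s[); rewrite setTI.
by rewrite (_ : _ @^-1` _ = [set y : 'rV[R]_n | `|y ord0 i - z ord0 i| < s])//; apply/seteqP; split => y; rewrite /= in_itv.
Qed.

Lemma open_box_sub (V : set 'rV[R]_n) x : open V -> V x -> exists2 e, 0 < e & box x e `<=` V.
Proof.
move=> oV Vx; have : nbhs x V by exact: open_nbhs_nbhs.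
move=> /nbhs_ballP[e /= e0 eV]; exists e => // y xy; apply: eV; split => // i j.
by rewrite /ball /= distrC (ord1 i); exact: xy.
Qed.

Lemma open_box z s : open (box z s).
Proof.
have [s0|s0] := ltP 0 s; last first.
  have [i|noi] := pselect (exists i : 'I_n, True).
    rewrite (_ : box z s = set0); first exact: open0.
    case: i => i _; apply/seteqP; split => // y /(_ i); rewrite ltNge.
    by rewrite (le_trans s0).
  rewrite (_ : box z s = setT); first exact: openT.
  by apply/seteqP; split => // y _ i; exfalso; apply: noi; exists i.
rewrite openE => y zy; apply/nbhs_ballP.
pose e := \big[Num.min/s]_(i < n) (s - `|y ord0 i - z ord0 i|).
have e0 : 0 < e by rewrite /e; elim/big_ind: _ => // [a b a0 b0|i _]; rewrite ?lt_min ?a0// subr_gt0.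
have ele i : e <= s - `|y ord0 i - z ord0 i| by exact: bigmin_le_cond.
exists e => //= w [_ yw] i.
have := yw ord0 i; rewrite /ball /= => h.
have := ele i; have := ler_distD (y ord0 i) (w ord0 i) (z ord0 i); rewrite (distrC (w ord0 i) (y ord0 i)); lra.
Qed.

(** Lindelöf's property through boxes with rational centres and radii, for a local property [H].
    Inclusion in a given open set yields measurability of open sets; nullity yields that the
    complement of the support is null. *)
Lemma countable_open_cover (W : set 'rV[R]_n) (H : set 'rV[R]_n -> Prop) :
  (forall x, W x -> exists V, [/\ open V, V x & forall A, measurable A -> A `<=` V -> H A]) ->
  exists F : nat -> set 'rV[R]_n,
    [/\ forall i, measurable (F i), forall i, F i = set0 \/ H (F i) & W `<=` \bigcup_i F i].
Proof.
move=> hW.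
pose B (cq : 'rV[rat]_n * rat) := box (map_mx ratr cq.1) (ratr cq.2).
pose F i := if (choice.unpickle i : option ('rV[rat]_n * rat)) is Some cq then (if `[< H (B cq) >] then B cq else set0) else set0.
exists F; split.
- by move=> i; rewrite /F; case: choice.unpickle => // cq; case: asboolP => // _; exact: measurable_box.
- by move=> i; rewrite /F; case: choice.unpickle => [cq|]; [case: asboolP => h; [right|left]|left].
move=> x Wx; have [V [oV Vx hV]] := hW x Wx.
have [e e0 eV] := open_box_sub oV Vx.
have e42 : e / 4 < e / 2 by lra.
have [q] := rat_in_itvoo e42.
rewrite in_itv/= => /andP[q1 q2].
have /choice[c hc] : forall i : 'I_n, exists c : rat, `|x ord0 i - ratr c| < e / 4.
  move=> i; have xe : x ord0 i - e / 4 < x ord0 i by lra.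
  have [c] := rat_in_itvoo xe.
  by rewrite in_itv/= => /andP[c1 c2]; exists c; rewrite ger0_norm; lra.
pose cq := (\row_i c i, q).
have HB : H (B cq).
  apply: hV; first exact: measurable_box.
  move=> y hy; apply: eV => i.
  have := hy i; have := hc i; rewrite !mxE /= => h1 h2.
  have := ler_distD (ratr (c i)) (y ord0 i) (x ord0 i); rewrite (distrC (ratr (c i))).
  lra.
exists (choice.pickle cq) => //; rewrite /F choice.pickleK asboolT//.
by move=> i; rewrite !mxE /=; have := hc i; lra.
Qed.

Lemma open_measurable_row (V : set 'rV[R]_n) : open V -> measurable V.
Proof.
move=> oV; have [F [mF hF VF]] := @countable_open_cover V (fun A => A `<=` V)
  (fun x Vx => ex_intro _ V (And3 oV Vx (fun A _ AV => AV))).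
rewrite (_ : V = \bigcup_i F i); first exact: bigcupT_measurable.
apply/seteqP; split => // x [i _ Fix]; case: (hF i) => h; last exact: h.
by rewrite h in Fix.
Qed.

End boxes.

Lemma measurable_invr_ge0 (R : realType) d (T : measurableType d) (f : T -> R) :
  (forall x, 0 <= f x) -> measurable_fun setT f -> measurable_fun setT (fun x => (f x)^-1).
Proof.
move=> f0 mf.
rewrite (_ : (fun x => _) = fun x => (f x) `^ (-1)); last first.
  by apply/funext => x; rewrite powR_inv1.
exact: (measurableT_comp (measurable_powR (-1)) mf).
Qed.

Section support.
Context (R : realType) (d : nat) (p : 'rV[R]_d -> R).
Hypothesis dp : density p.
Variable pi : probability 'rV[R]_d R.
Hypothesis piE : forall A, pi A = (\int[lebesgue_row R d]_(y in A) (p y)%:E)%E.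

Lemma closed_density_support : closed (density_support p).
Proof.
rewrite -openC openE => x /= /existsNP[V /not_implyP[oV /not_implyP[Vx nV]]].
apply: filterS (open_nbhs_nbhs (conj oV Vx)) => y Vy /(_ V oV Vy); exact: nV.
Qed.

Lemma measurable_density_support : measurable (density_support p).
Proof.
rewrite -[density_support p]setCK; apply: measurableC; apply: open_measurable_row.
by rewrite openC; exact: closed_density_support.
Qed.

Lemma density_supportC0 : pi (~` density_support p) = 0%E.
Proof.
have h x : (~` density_support p) x ->
    exists V, [/\ open V, V x & forall A, measurable A -> A `<=` V -> pi A = 0%E].
  move=> /existsNP[V /not_implyP[oV /not_implyP[Vx nV]]].
  have piV : pi V = 0%E by rewrite piE; apply/eqP; rewrite eq_le leNgt; apply/andP; split;
    [exact/negP|apply: integral_ge0 => y _; case: dp => _ p0 _; rewrite lee_fin].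
  exists V; split => // A mA AV.
  exact: (subset_measure0 mA (open_measurable_row oV) AV piV).
have [F [mF hF WF]] := countable_open_cover h.
apply: (subset_measure0 _ _ WF).
- exact: measurableC measurable_density_support.
- exact: bigcupT_measurable.
- by apply: null_bigcup => // i; case: (hF i) => [->|//]; rewrite measure0.
Qed.

End support.

Lemma ge0_intZr (R : realType) (d : measure_display) (T : measurableType d)
    (mu : {measure set T -> \bar R}) (f : T -> \bar R) (c : \bar R) :
  measurable_fun setT f -> (forall x, 0 <= f x)%E -> (0 <= c)%E ->
  (\int[mu]_x (f x * c) = \int[mu]_x f x * c)%E.
Proof. by move=> mf f0 c0; rewrite ge0_integralZr. Qed.

Lemma semi_sigma_additive_ext (R : realType) (d : measure_display) (T : measurableType d)
    (K m : set T -> \bar R) : (forall A, measurable A -> K A = m A) ->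
  semi_sigma_additive m -> semi_sigma_additive K.
Proof.
move=> Km h F mF tF mUF; rewrite Km//.
by under eq_fun do under eq_bigr do rewrite Km//; exact: h.
Qed.

(** * Reversibility of the Metropolis-Hastings kernel *)

Section metropolis_hastings.
Context (R : realType) (d : nat).
Local Notation Rd := 'rV[R]_d.
Local Notation leb := (lebesgue_row R d).
Variables (p : Rd -> R) (q : Rd -> Rd -> R).
Hypotheses (dp : density p) (pq : proposal q).

Let mp : measurable_fun setT p. Proof. by case: dp. Qed.
Let p0 x : 0 <= p x. Proof. by case: dp. Qed.
Let mq : measurable_fun setT (fun z : Rd * Rd => q z.1 z.2). Proof. by case: pq. Qed.
Let q0 x y : 0 <= q x y. Proof. by case: pq. Qed.
Let q1 x : (\int[leb]_y (q x y)%:E = 1)%E. Proof. by case: pq. Qed.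

Local Notation acc := (mh_accept p q).

Lemma mh_accept_ge0 x y : 0 <= acc x y.
Proof.
rewrite /mh_accept; case: ifP => // h.
by rewrite le_min ler01/= divr_ge0 ?mulr_ge0// ltW.
Qed.

Lemma mh_accept_le1 x y : acc x y <= 1.
Proof. by rewrite /mh_accept; case: ifP => // h; rewrite ge_min lexx. Qed.

Definition mh_flow x y : R := p x * q x y * acc x y.

(** The minimum is symmetric, which is detailed balance. If [p x * q x y = 0], the acceptance value
    1 is harmless since the flow is 0 anyway. *)
Lemma mh_flowE x y : mh_flow x y = Num.min (p x * q x y) (p y * q y x).
Proof.
rewrite /mh_flow /mh_accept; case: ifPn => h; last first.
  have -> : p x * q x y = 0 by apply/eqP; rewrite eq_le mulr_ge0// andbT leNgt.
  by rewrite mul0r; apply/esym/min_idPl; rewrite mulr_ge0.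
by rewrite minr_pMr ?ltW// mulr1 mulrCA divff ?mulr1// gt_eqF.
Qed.

Lemma mh_flowC x y : mh_flow x y = mh_flow y x.
Proof. by rewrite !mh_flowE minC. Qed.

Let mp1 : measurable_fun setT (fun z : Rd * Rd => p z.1).
Proof. exact: (measurableT_comp mp measurable_fst). Qed.
Let mp2 : measurable_fun setT (fun z : Rd * Rd => p z.2).
Proof. exact: (measurableT_comp mp measurable_snd). Qed.
Let mqs : measurable_fun setT (fun z : Rd * Rd => q z.2 z.1).
Proof.
exact: (measurableT_comp mq (measurable_fun_pair measurable_snd measurable_fst)).
Qed.

Lemma measurable_mh_accept : measurable_fun setT (fun z : Rd * Rd => acc z.1 z.2).
Proof.
have mpq : measurable_fun setT (fun z : Rd * Rd => p z.1 * q z.1 z.2) by exact: measurable_funM.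
apply: measurable_fun_if => //; first exact: measurable_fun_ltr.
apply: measurable_funTS; apply: measurable_minr => //.
apply: measurable_funM; first exact: measurable_funM.
by apply: measurable_invr_ge0 => // z; rewrite mulr_ge0.
Qed.

Let ma1 x : measurable_fun setT (fun y => q x y * acc x y).
Proof.
have mx : measurable_fun setT (fun y : Rd => (x, y)) by exact: measurable_fun_pair.
exact: (measurableT_comp (measurable_funM mq measurable_mh_accept) mx).
Qed.

Let mr1 x : measurable_fun setT (fun y => q x y * (1 - acc x y)).
Proof.
have mx : measurable_fun setT (fun y : Rd => (x, y)) by exact: measurable_fun_pair.
have m2 : measurable_fun setT (fun z : Rd * Rd => 1 - acc z.1 z.2).
  by apply: measurable_funB => //; exact: measurable_mh_accept.
exact: (measurableT_comp (measurable_funM mq m2) mx).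
Qed.

Let ma1E x : measurable_fun setT (fun y => (q x y * acc x y)%:E).
Proof. by apply/measurable_EFinP; exact: ma1. Qed.

Let mr1E x : measurable_fun setT (fun y => (q x y * (1 - acc x y))%:E).
Proof. by apply/measurable_EFinP; exact: mr1. Qed.

Let a0 x y : 0 <= q x y * acc x y.
Proof. by rewrite mulr_ge0// mh_accept_ge0. Qed.

Let r0 x y : 0 <= q x y * (1 - acc x y).
Proof. by rewrite mulr_ge0// subr_ge0 mh_accept_le1. Qed.

Definition mh_reject x : R := fine (\int[leb]_y (q x y * (1 - acc x y))%:E).

Lemma mh_rejectE x : ((mh_reject x)%:E = \int[leb]_y (q x y * (1 - acc x y))%:E)%E.
Proof.
rewrite fineK// ge0_fin_numE; last by apply: integral_ge0 => y _; rewrite lee_fin.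
apply: (@le_lt_trans _ _ (\int[leb]_y (q x y)%:E)%E); last by rewrite q1 ltry.
have mx : measurable_fun setT (fun y : Rd => (x, y)) by exact: measurable_fun_pair.
apply: (ge0_int_le _ measurableT).
- exact: mr1E.
- by apply/measurable_EFinP; exact: (measurableT_comp mq mx).
- by move=> y; rewrite lee_fin.
- by move=> y; rewrite lee_fin ler_piMr// gerBl mh_accept_ge0.
Qed.

Lemma mh_reject_ge0 x : 0 <= mh_reject x.
Proof. by rewrite -lee_fin mh_rejectE; apply: integral_ge0 => y _; rewrite lee_fin. Qed.

(** Accepted moves have a density; rejections accumulate in a mass at [x]. *)
Lemma mh_kernelE x A : measurable A -> mh_kernel p q x A =
  (\int[leb]_(y in A) (q x y * acc x y)%:E + (mh_reject x)%:E * \d_x A)%E.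
Proof.
move=> mA; rewrite integral_mkcond mh_rejectE.
have mA1 : measurable_fun setT ((fun y => (q x y * acc x y)%:E) \_ A).
  apply/(measurable_restrictT _ _).1 => //; apply: measurable_funTS; exact: ma1E.
have mR : measurable_fun setT (fun y => (q x y * (1 - acc x y))%:E) by exact: mr1E.
have R0 y : (0 <= (q x y * (1 - acc x y))%:E)%E by rewrite lee_fin.
rewrite -(ge0_intZr _ mR R0); last by rewrite lee_fin.
rewrite -(ge0_intD _ measurableT mA1); last 3 first.
- by move=> y; rewrite patchE; case: ifP => // _; rewrite lee_fin.
- exact: emeasurable_funM.
- by move=> y; rewrite mule_ge0.
apply: eq_integral => y _.
rewrite bernoulli_probE ?mh_accept_ge0 ?mh_accept_le1// !diracE patchE.
have -> : (true \in [set B : bool | A (if B then y else x)]) = (y \in A).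
  by apply/idP/idP => /set_mem /= h; exact/mem_set.
have -> : (false \in [set B : bool | A (if B then y else x)]) = (x \in A).
  by apply/idP/idP => /set_mem /= h; exact/mem_set.
have -> : (if y \in A then (q x y * acc x y)%:E else point) = (q x y * acc x y * (y \in A)%:R)%:E.
  by case: (y \in A); rewrite ?mulr1 ?mulr0.
by rewrite -?EFinM -?EFinD -?EFinM; congr EFin; rewrite /unstable.onem; ring.
Qed.

Lemma mh_finite_kernel : exists P : R.-fker Rd ~> Rd,
  (forall x A, measurable A -> P x A = mh_kernel p q x A) /\ (forall x, P x setT = 1%E).
Proof.
have K1 x : mh_kernel p q x setT = 1%E.
  rewrite mh_kernelE// diracT mule1 mh_rejectE.
  rewrite -(ge0_intD _ measurableT); last 4 first.
  - exact: ma1E.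
  - by move=> y; rewrite lee_fin.
  - exact: mr1E.
  - by move=> y; rewrite lee_fin.
  rewrite -(q1 x); apply: eq_integral => y _; rewrite -EFinD; congr EFin; lra.
have [] := @finite_kernel_of R _ _ Rd Rd (mh_kernel p q).
- move=> x; rewrite mh_kernelE// integral_set0 measure0 mule0 adde0//.
- move=> x A mA; rewrite mh_kernelE// adde_ge0//.
    by apply: integral_ge0 => y _; rewrite lee_fin.
  by rewrite mule_ge0// lee_fin mh_reject_ge0.
- move=> x.
  have n0 : (\int[leb]_(y in set0) (q x y * acc x y)%:E = 0)%E by rewrite integral_set0.
  have nge0 A : (0 <= \int[leb]_(y in A) (q x y * acc x y)%:E)%E.
    by apply: integral_ge0 => y _; rewrite lee_fin.
  pose nu : {measure set Rd -> \bar R} := HB.pack (fun A => \int[leb]_(y in A) (q x y * acc x y)%:E)%E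
    (isMeasure.Build _ _ _ (fun A => \int[leb]_(y in A) (q x y * acc x y)%:E)%E n0 nge0
      (int_sigma_additive (mu := leb) (ma1 x) (a0 x))).
  apply: (@semi_sigma_additive_ext _ _ _ _ (measure_add nu (mscale (NngNum (mh_reject_ge0 x)) \d_x))).
    by move=> A mA; rewrite mh_kernelE// measure_addE.
  exact: measure_semi_sigma_additive.
- move=> A mA.
  have mi : measurable_fun setT (fun x => \d_x A : \bar R).
    under eq_fun do rewrite diracE -[(_ \in A)%:R]/(_ : R) -indicE.
    by apply/measurable_EFinP; exact: measurable_indic.
  rewrite (_ : (fun x => mh_kernel p q x A) = (fun x => \int[leb]_y ((q x y * acc x y) * \1_A y)%:E +
     (\int[leb]_y (q x y * (1 - acc x y))%:E) * \d_x A)%E); last first.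
    apply/funext => x; rewrite mh_kernelE// mh_rejectE integral_mkcond; congr (_ + _)%E.
    apply: eq_integral => y _; rewrite patchE indicE; case: (y \in A); rewrite ?mulr1 ?mulr0//.
  have mI : measurable_fun setT (fun z : Rd * Rd => \1_A z.2 : R).
    by apply: (measurableT_comp _ measurable_snd); exact: measurable_indic.
  apply: emeasurable_funD; last apply: emeasurable_funM => //.
    apply: (@measurable_fun_fubini_tonelli_F _ _ _ _ _ leb (fun z : Rd * Rd => ((q z.1 z.2 * acc z.1 z.2) * \1_A z.2)%:E)).
      by apply/measurable_EFinP; apply: measurable_funM => //; apply: measurable_funM => //; exact: measurable_mh_accept.
    by move=> z; rewrite lee_fin mulr_ge0.
  apply: (@measurable_fun_fubini_tonelli_F _ _ _ _ _ leb (fun z : Rd * Rd => (q z.1 z.2 * (1 - acc z.1 z.2))%:E)).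
    apply/measurable_EFinP; apply: measurable_funM => //; apply: measurable_funB => //; exact: measurable_mh_accept.
  by move=> z; rewrite lee_fin.
- by move=> x; rewrite K1.
move=> P hP; exists P; split => // x.
by rewrite hP.
Qed.

Section with_kernel.
Variable P : R.-fker Rd ~> Rd.
Hypothesis PE : forall x A, measurable A -> P x A = mh_kernel p q x A.
Variable pi : probability Rd R.
Hypothesis piE : forall A, pi A = (\int[leb]_(y in A) (p y)%:E)%E.

Lemma pop_mh f x : measurable_fun setT f -> (forall y, 0 <= f y)%E ->
  (pop P f x = \int[leb]_y ((q x y * acc x y)%:E * f y) + (mh_reject x)%:E * f x)%E.
Proof.
move=> mf f0.
have n0 : (\int[leb]_(y in set0) (q x y * acc x y)%:E = 0)%E by rewrite integral_set0.
have nge0 A : (0 <= \int[leb]_(y in A) (q x y * acc x y)%:E)%E.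
  by apply: integral_ge0 => y _; rewrite lee_fin.
pose nu : {measure set Rd -> \bar R} := HB.pack (fun A => \int[leb]_(y in A) (q x y * acc x y)%:E)%E
  (isMeasure.Build _ _ _ (fun A => \int[leb]_(y in A) (q x y * acc x y)%:E)%E n0 nge0
    (int_sigma_additive (mu := leb) (ma1 x) (a0 x))).
have h A : measurable A -> P x A = (1%:E * nu A + (mh_reject x)%:E * \d_x A)%E.
  by move=> mA; rewrite PE// mh_kernelE// mul1e.
rewrite /pop (ge0_int_mix ler01 (mh_reject_ge0 x) h mf f0) mul1e.
have hn A : measurable A -> nu A = (\int[leb]_(y in A) (q x y * acc x y)%:E)%E by [].
rewrite (int_density (ma1 x) (a0 x) hn mf f0).
by rewrite integral_dirac// diracT mul1e.
Qed.

(** Accepted moves form a symmetric flow, so Tonelli exchanges the two endpoints; rejections do not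
    move. The two parts recombine to [p x * q x y], whose integral in [y] is [p x]. *)
Lemma mh_invariant f : measurable_fun setT f -> (forall y, 0 <= f y)%E ->
  (\int[pi]_x pop P f x = \int[pi]_x f x)%E.
Proof.
move=> mf f0.
have pid := int_density mp p0 (fun A _ => piE A).
rewrite (pid _ (measurable_pop P mf f0) (pop_ge0 P f0)) (pid _ mf f0).
have mf1 : measurable_fun setT (fun z : Rd * Rd => f z.1) by exact: (measurableT_comp mf measurable_fst).
have mf2 : measurable_fun setT (fun z : Rd * Rd => f z.2) by exact: (measurableT_comp mf measurable_snd).
have mfl : measurable_fun setT (fun z : Rd * Rd => (mh_flow z.1 z.2)%:E).
  apply/measurable_EFinP; apply: measurable_funM; last exact: measurable_mh_accept.
  exact: measurable_funM.
pose gam x y := p x * (q x y * (1 - acc x y)).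
have mgam : measurable_fun setT (fun z : Rd * Rd => (gam z.1 z.2)%:E).
  apply/measurable_EFinP; apply: measurable_funM => //; apply: measurable_funM => //.
  by apply: measurable_funB => //; exact: measurable_mh_accept.
have fl0 x y : (0 <= (mh_flow x y)%:E)%E by rewrite lee_fin /mh_flow !mulr_ge0// mh_accept_ge0.
have gam0 x y : (0 <= (gam x y)%:E)%E by rewrite lee_fin mulr_ge0.
have mfl2 := emeasurable_funM mfl mf2; have mfl1 := emeasurable_funM mfl mf1.
have mgam1 := emeasurable_funM mgam mf1.
have sec (F : Rd * Rd -> \bar R) x : measurable_fun setT F -> measurable_fun setT (fun y => F (x, y)).
  by move=> mF; apply: (measurableT_comp mF); exact: measurable_fun_pair.
transitivity (\int[leb]_x (\int[leb]_y ((mh_flow x y)%:E * f y) + \int[leb]_y ((gam x y)%:E * f x)))%E.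
  apply: eq_integral => x _; rewrite pop_mh// ge0_muleDr; last 2 first.
  - by apply: integral_ge0 => y _; rewrite mule_ge0// lee_fin.
  - by rewrite mule_ge0// lee_fin mh_reject_ge0.
  congr (_ + _)%E.
    rewrite -(ge0_intZl _ measurableT _ _ (p0 x)); last 2 first.
    + by apply: emeasurable_funM => //; exact: ma1E.
    + by move=> y; rewrite mule_ge0// lee_fin.
    by apply: eq_integral => y _; rewrite muleA -EFinM /mh_flow mulrA.
  rewrite muleA mh_rejectE -(ge0_intZl _ measurableT _ _ (p0 x)); last 2 first.
  + exact: mr1E.
  + by move=> y; rewrite lee_fin.
  rewrite -(ge0_intZr _ _ _ (f0 x))//.
    exact: (measurable_funeM _ (mr1E x)).
  by move=> y; rewrite -EFinM; exact: gam0.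
have swap : (\int[leb]_x \int[leb]_y ((mh_flow x y)%:E * f y) =
    \int[leb]_x \int[leb]_y ((mh_flow x y)%:E * f x))%E.
  rewrite (@fubini_tonelli _ _ _ _ _ leb leb _ mfl2)/=; last by move=> z; rewrite mule_ge0.
  by apply: eq_integral => x _; apply: eq_integral => y _; rewrite mh_flowC.
rewrite (ge0_intD _ measurableT (@measurable_fun_fubini_tonelli_F _ _ _ _ _ leb _ mfl2 _) _
  (@measurable_fun_fubini_tonelli_F _ _ _ _ _ leb _ mgam1 _)); last 4 first.
- by move=> z; rewrite mule_ge0.
- by move=> x; apply: integral_ge0 => y _; rewrite mule_ge0.
- by move=> z; rewrite mule_ge0.
- by move=> x; apply: integral_ge0 => y _; rewrite mule_ge0.
rewrite /fubini_F /= swap.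
rewrite -(ge0_intD _ measurableT (@measurable_fun_fubini_tonelli_F _ _ _ _ _ leb _ mfl1 _) _
  (@measurable_fun_fubini_tonelli_F _ _ _ _ _ leb _ mgam1 _)); last 4 first.
- by move=> z; rewrite mule_ge0.
- by move=> x; apply: integral_ge0 => y _; rewrite mule_ge0.
- by move=> z; rewrite mule_ge0.
- by move=> x; apply: integral_ge0 => y _; rewrite mule_ge0.
apply: eq_integral => x _; rewrite /fubini_F /=.
rewrite -(ge0_intD _ measurableT (sec _ x mfl1) _ (sec _ x mgam1)); last 2 first.
- by move=> y; rewrite mule_ge0.
- by move=> y; rewrite mule_ge0.
transitivity (\int[leb]_y ((p x)%:E * (q x y)%:E * f x))%E.
  apply: eq_integral => y _ /=; rewrite -ge0_muleDl// -EFinD -EFinM; congr (_%:E * _)%E.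
  rewrite /mh_flow /gam; lra.
have mqx : measurable_fun setT (fun y => (q x y)%:E).
  by apply: (sec (fun z => (q z.1 z.2)%:E) x); exact/measurable_EFinP.
rewrite (ge0_intZr _ (measurable_funeM _ mqx) _ (f0 x)); last by move=> y; rewrite -EFinM lee_fin mulr_ge0.
rewrite (ge0_intZl _ measurableT mqx _ (p0 x)); last by move=> y; rewrite lee_fin.
by rewrite q1 mule1.
Qed.

End with_kernel.
End metropolis_hastings.

(** * Minorization of a power of the kernel on the support *)

Section minorization.
Context (R : realType) (d : nat).
Local Notation Rd := 'rV[R]_d.
Local Notation leb := (lebesgue_row R d).
Variables (p : Rd -> R) (q : Rd -> Rd -> R) (b eps M : R).
Hypotheses (dp : density p) (pq : proposal q) (pM : forall x, p x <= M).
Hypotheses (b0 : 0 < b) (eps0 : 0 < eps) (hq : forall x y, b * \1_(eball x eps) y <= q x y).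
Variable P : R.-fker Rd ~> Rd.
Hypothesis PE : forall x A, measurable A -> P x A = mh_kernel p q x A.
Variable pi : probability Rd R.
Hypothesis piE : forall A, pi A = (\int[leb]_(y in A) (p y)%:E)%E.
Local Notation E := (density_support p).
Hypotheses (bE : bounded_set E) (cE : convex_set (E : set (convex_lmodType Rd))).
Hypothesis M0 : 0 < M.

Let mp : measurable_fun setT p. Proof. by case: dp. Qed.
Let p0 x : 0 <= p x. Proof. by case: dp. Qed.
Let q0 x y : 0 <= q x y. Proof. by case: pq. Qed.

(** A box of half-side [4 * s = eps / d.+1] fits in the Euclidean ball of radius [eps]. The factor 4
    leaves room for an advance of [2 * s] and an error of [s]. *)
Let s : R := eps / d.+1%:R / 4.
Let s0 : 0 < s. Proof. by rewrite !divr_gt0. Qed.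

Let beta : R := b / M.
Let beta0 : 0 < beta. Proof. by rewrite divr_gt0. Qed.

Lemma box_eball (x y : Rd) : box x (4 * s) y -> eball x eps y.
Proof.
move=> xy; rewrite /eball /=.
have e : 4 * s = eps / d.+1%:R by rewrite /s mulrC divfK ?pnatr_eq0.
have ed0 : 0 < eps / d.+1%:R by rewrite divr_gt0.
rewrite -[ltRHS](ger0_norm (ltW eps0)) -sqrtr_sqr ltr_sqrt; last by rewrite exprn_gt0.
apply: (@le_lt_trans _ _ (\sum_(i < d) (eps / d.+1%:R) ^+ 2)).
  apply: ler_sum => i _; rewrite -real_normK ?num_real// lerXn2r ?nnegrE ?(ltW ed0)//.
  by rewrite -e ltW//; exact: xy.
rewrite sumr_const card_ord -[_ *+ d]mulr_natl expr_div_n.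
rewrite mulrCA -[ltRHS]mulr1 ltr_pM2l; last by rewrite exprn_gt0.
rewrite ltr_pdivrMr; last by rewrite exprn_gt0.
rewrite mul1r -natrX ltr_nat expnS expn1; nia.
Qed.

(** When [p x] is positive the right-hand side is the minimum of [q x y] and [p y * q y x / p x]. At
    this distance both proposal densities are at least [b], and [p] is at most [M], so each is at
    least [b * p y / M]. *)
Lemma mh_move_ge x y : box x (4 * s) y -> beta * p y <= q x y * mh_accept p q x y.
Proof.
move=> xy.
have yx : box y (4 * s) x by move=> i; rewrite distrC; exact: xy.
have qxy : b <= q x y.
  by have := hq x y; rewrite indicE mem_set ?mulr1//; exact: box_eball.
have qyx : b <= q y x.
  by have := hq y x; rewrite indicE mem_set ?mulr1//; exact: box_eball.
have bp : beta * p y <= b.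
  by rewrite /beta mulrAC ler_pdivrMr// ler_wpM2l// ltW.
rewrite /mh_accept; case: ifPn => h; last by rewrite mulr1 (le_trans bp).
have qp : 0 < q x y by apply: lt_le_trans qxy.
have pp : 0 < p x by rewrite -(pmulr_lgt0 _ qp).
rewrite (minr_pMr _ _ (ltW qp)) mulr1 le_min (le_trans bp)//=.
have -> : q x y * (p y * q y x / (p x * q x y)) = p y * q y x / p x.
  by field; rewrite !gt_eqF.
rewrite ler_pdivlMr// /beta.
apply: (@le_trans _ _ (b / M * p y * M)).
  by rewrite ler_wpM2l// mulr_ge0// ltW.
have -> : b / M * p y * M = p y * b by field; rewrite gt_eqF.
by rewrite ler_wpM2l.
Qed.

Lemma pop_mh_ge f x : measurable_fun setT f -> (forall y, 0 <= f y)%E ->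
  (beta%:E * \int[pi]_y ((\1_(box x (4 * s)) y)%:E * f y) <= pop P f x)%E.
Proof.
move=> mf f0.
have m1 : measurable_fun setT (fun y : Rd => (\1_(box x (4 * s)) y)%:E : \bar R).
  by apply/measurable_EFinP; apply: measurable_indic; exact: measurable_box.
have mg := emeasurable_funM m1 mf.
have g0 y : (0 <= (\1_(box x (4 * s)) y)%:E * f y)%E by rewrite mule_ge0// lee_fin.
rewrite (pop_mh dp pq PE x mf f0) (int_density mp p0 (fun A _ => piE A) mg g0).
have mpE : measurable_fun setT (fun y => (p y)%:E) by exact/measurable_EFinP.
apply: (@le_trans _ _ (\int[leb]_y ((q x y * mh_accept p q x y)%:E * f y))%E); last first.
  by rewrite leeDl// mule_ge0// lee_fin mh_reject_ge0.
rewrite -(ge0_intZl _ measurableT (emeasurable_funM mpE mg) _ (ltW beta0)); last first.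
  by move=> y; rewrite mule_ge0// lee_fin.
apply: (ge0_int_le _ measurableT).
- exact: (measurable_funeM _ (emeasurable_funM mpE mg)).
- apply: emeasurable_funM => //; apply/measurable_EFinP.
  have mx : measurable_fun setT (fun y : Rd => (x, y)) by exact: measurable_fun_pair.
  apply: measurable_funM.
    by case: pq => mq _ _; exact: (measurableT_comp mq mx).
  exact: (measurableT_comp (measurable_mh_accept dp pq) mx).
- by move=> y; rewrite !mule_ge0// lee_fin// ltW.
move=> y; rewrite indicE; have [xy|xy] := pselect (box x (4 * s) y).
  by rewrite mem_set// mul1e muleA -EFinM; apply: lee_wpmul2r => //; rewrite lee_fin; exact: mh_move_ge.
by rewrite memNset// mul0e !mule0 mule_ge0// lee_fin mulr_ge0// mh_accept_ge0.
Qed.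

Let i1 (B : set Rd) : Rd -> \bar R := fun y => (\1_B y)%:E.
Let mi1 B : measurable B -> measurable_fun setT (i1 B).
Proof. by move=> mB; apply/measurable_EFinP; exact: measurable_indic. Qed.
Let i10 B y : (0 <= i1 B y)%E. Proof. by rewrite lee_fin. Qed.

Let mE : measurable E. Proof. exact: measurable_density_support. Qed.

Lemma finite_box_net t : 0 < t -> exists2 l : seq Rd, (forall y, y \in l -> E y) &
  forall x, E x -> exists2 y, y \in l & box y t x.
Proof.
move=> t0; have : compact E.
  by apply: bounded_closed_compact => //; exact: closed_density_support.
rewrite compact_cover => /(_ _ E (fun y => box y t)) [].
- by move=> y _; exact: open_box.
- by move=> x Ex; exists x => // i; rewrite subrr normr0.
move=> D' DE cov; exists (enum_fset D').
  by move=> y yl; exact: set_mem (DE y yl).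
by move=> x /cov[y /= yD xy]; exists y.
Qed.

(** Compactness makes the positivity in the definition of the support uniform: the box at [z]
    contains one of the finitely many half-size boxes of a net. *)
Lemma box_mass_lower_bound : exists2 eta, 0 < eta & forall z, E z -> (eta%:E <= pi (box z s `&` E))%E.
Proof.
have s20 : 0 < s / 2 by rewrite divr_gt0.
have [l lE cov] := finite_box_net s20.
have pos y : E y -> (0 < pi (box y (s / 2)))%E.
  move=> Ey; rewrite piE; apply: Ey; first exact: open_box.
  by move=> i; rewrite subrr normr0.
have [eta eta0 heta] : exists2 eta, 0 < eta & forall y, y \in l -> (eta%:E <= pi (box y (s / 2)))%E.
  elim: l lE {cov} => [|y l IH] lE; first by exists 1.
  have lE' z : z \in l -> E z by move=> zl; apply: lE; rewrite inE zl orbT.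
  have [eta eta0 h] := IH lE'.
  have := pos y (lE y (mem_head _ _)).
  have fy : pi (box y (s / 2)) \is a fin_num by exact: fin_num_measure (measurable_box _ _).
  rewrite -(fineK fy) lte_fin => py.
  exists (Num.min eta (fine (pi (box y (s / 2))))); first by rewrite lt_min eta0.
  move=> z; rewrite inE => /orP[/eqP ->|zl]; first by rewrite -[leRHS](fineK fy) lee_fin ge_min lexx orbT.
  by apply: le_trans (h z zl); rewrite lee_fin ge_min lexx.
exists eta => // z Ez; have [y yl yz] := cov z Ez.
apply: (le_trans (heta y yl)).
have -> : pi (box z s `&` E) = pi (box z s).
  apply/eqP; rewrite eq_le; apply/andP; split.
    apply: le_meas => //; last exact: measurable_box.
    by apply: measurableI => //; exact: measurable_box.
  have h : pi (box z s `&` ~` E) = 0%E.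
    apply: (@subset_measure0 _ _ _ _ _ (~` E)); [|exact: measurableC|by []|exact: density_supportC0].
    by apply: measurableI; [exact: measurable_box|exact: measurableC].
  rewrite -{1}(setIT (box z s)) -(setUv E) setIUr.
  apply: le_measU_null h.
  - by apply: measurableI => //; exact: measurable_box.
  - by apply: measurableI; [exact: measurable_box|exact: measurableC].
apply: le_meas; [exact: measurable_box|exact: measurable_box|].
move=> w yw i; have := yw i; have := yz i.
have := ler_distD (y ord0 i) (w ord0 i) (z ord0 i); rewrite (distrC (y ord0 i) (z ord0 i)); lra.
Qed.

(** Each additional step allows one more [s] of distance: the chain first moves near a point [z] of
    the segment from [x] to [y], where it has probability at least [beta * eta] to land, and the
    induction hypothesis does the rest from any landing point in [E]. *)
Lemma chain_of_boxes k : exists2 c, 0 < c & forall x y, E x -> E y ->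
  (forall i, `|y ord0 i - x ord0 i| <= k.+2%:R * s) -> forall B, measurable B ->
  (c%:E * pi (B `&` box y s) <= iter k.+1 (pop P) (i1 B) x)%E.
Proof.
have [eta eta0 heta] := box_mass_lower_bound.
elim: k => [|k [c c0 IH]].
  exists beta => // x y Ex Ey xy B mB.
  apply: (le_trans _ (pop_mh_ge x (mi1 mB) (i10 B))).
  rewrite lee_pmul2l// -(integral_ind pi (measurableI _ _ mB (measurable_box y s))).
  apply: (ge0_int_le _ measurableT).
  - by apply: mi1; apply: measurableI => //; exact: measurable_box.
  - by apply: emeasurable_funM; [apply: mi1; exact: measurable_box|exact: mi1].
  - by move=> w; rewrite lee_fin.
  move=> w; rewrite /i1 -EFinM lee_fin.
  have [[Bw yw]|n] := pselect ((B `&` box y s) w); last first.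
    by rewrite [\1_(B `&` _) w]indicE (memNset n) mulr_ge0.
  have xw : box x (4 * s) w.
    move=> i; have := xy i; have := yw i.
    by have := ler_distD (y ord0 i) (w ord0 i) (x ord0 i); have := s0; lra.
  have Byw : (B `&` box y s) w by split.
  by rewrite !indicE (mem_set Bw) (mem_set xw) (mem_set Byw) mulr1.
exists (beta * (c * eta)); first exact: (mulr_gt0 beta0 (mulr_gt0 c0 eta0)).
move=> x y Ex Ey xy B mB.
(* The fraction of the segment that makes [z] at distance at most [2 * s] from [x] and [k.+1%:R * s]
   from [y]; a landing point within [s] of [z] then satisfies the hypothesis for [k]. *)
pose t : R := 2 / k.+3%:R.
have k3 : 0 < k.+3%:R :> R by rewrite ltr0n.
have t0 : 0 <= t by rewrite divr_ge0.
have t1 : t <= 1 by rewrite ler_pdivrMr// mul1r ler_nat.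
pose z : Rd := t *: y + (1 - t) *: x.
have Ez : E z.
  have := cE (Itv01 t0 t1) (mem_set Ey) (mem_set Ex).
  by move=> /set_mem.
have zx i : `|z ord0 i - x ord0 i| <= 2 * s.
  have -> : z ord0 i - x ord0 i = t * (y ord0 i - x ord0 i) by rewrite !mxE; ring.
  rewrite normrM (ger0_norm t0); have := ler_wpM2l t0 (xy i).
  by rewrite /t mulrA divfK ?gt_eqF.
have zy i : `|y ord0 i - z ord0 i| <= k.+1%:R * s.
  have -> : y ord0 i - z ord0 i = (1 - t) * (y ord0 i - x ord0 i) by rewrite !mxE; ring.
  have t1' : 0 <= 1 - t by lra.
  rewrite normrM (ger0_norm t1'); have := ler_wpM2l t1' (xy i).
  have -> : (1 - t) * (k.+3%:R * s) = k.+1%:R * s.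
    by rewrite mulrA mulrBl mul1r /t divfK ?gt_eqF// -natrB.
  by [].
have mIk : measurable_fun setT (iter k.+1 (pop P) (i1 B)) by apply: measurable_iter_pop => //; exact: mi1.
have Ik0 w : (0 <= iter k.+1 (pop P) (i1 B) w)%E by exact: iter_pop_ge0.
apply: (le_trans _ (pop_mh_ge x mIk Ik0)).
rewrite (EFinM beta) -muleA lee_pmul2l//.
have mzE : measurable (box z s `&` E) by apply: measurableI => //; exact: measurable_box.
apply: (@le_trans _ _ (\int[pi]_w ((c%:E * pi (B `&` box y s)) * i1 (box z s `&` E) w))%E).
  have f : pi (B `&` box y s) \is a fin_num.
    by apply: fin_num_measure; apply: measurableI => //; exact: measurable_box.
  rewrite -(fineK f) -EFinM (ge0_intZl _ measurableT (mi1 mzE) (i10 _)); last first.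
    by rewrite mulr_ge0 ?(ltW c0)// fine_ge0.
  rewrite /i1 integral_ind// mulrAC [leLHS]EFinM; apply: lee_wpmul2l; last exact: heta.
  by rewrite lee_fin mulr_ge0 ?(ltW c0)// fine_ge0.
apply: (ge0_int_le _ measurableT).
- by apply: emeasurable_funM => //; exact: mi1.
- by apply: emeasurable_funM => //; apply: mi1; exact: measurable_box.
- by move=> w; rewrite !mule_ge0// lee_fin ltW.
move=> w; rewrite /i1 !indicE.
have [[zw Ew]|nzw] := pselect ((box z s `&` E) w); last first.
  by rewrite (memNset nzw) mule0 mule_ge0// lee_fin.
have xw : box x (4 * s) w.
  move=> i; have := zw i; have := zx i.
  have := ler_distD (z ord0 i) (w ord0 i) (x ord0 i); have := s0; lra.
rewrite (mem_set xw) mul1e mem_set// mule1; apply: IH => // i.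
have := zw i; have := zy i.
have := ler_distD (z ord0 i) (y ord0 i) (w ord0 i); rewrite (distrC (z ord0 i) (w ord0 i)).
rewrite -[k.+2%:R]natr1 mulrDl mul1r; lra.
Qed.

Lemma support_diameter : exists k, forall x y, E x -> E y ->
  forall i, `|y ord0 i - x ord0 i| <= k.+2%:R * s.
Proof.
have [l lE cov] := finite_box_net s0.
have [L hL] : exists L : R, forall y z i, y \in l -> z \in l -> `|y ord0 i - z ord0 i| <= L.
  exists (\sum_(y <- l) \sum_(z <- l) \sum_i `|y ord0 i - z ord0 i|) => y z i yl zl.
  have h (I : eqType) (r : seq I) (F : I -> R) (j : I) : (forall j, 0 <= F j) -> j \in r -> F j <= \sum_(j <- r) F j.
    move=> F0; elim: r => [//|a r IHr]; rewrite inE big_cons => /orP[/eqP ->|jr].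
      by rewrite lerDl sumr_ge0.
    by rewrite (le_trans (IHr jr))// lerDr.
  apply: le_trans (h _ l (fun y => \sum_(z <- l) \sum_i `|y ord0 i - z ord0 i|) y _ yl); last first.
    by move=> ?; apply: sumr_ge0 => ? _; exact: sumr_ge0.
  apply: le_trans (h _ l (fun z => \sum_i `|y ord0 i - z ord0 i|) z _ zl); last first.
    by move=> ?; exact: sumr_ge0.
  by apply: (h _ _ (fun i => `|y ord0 i - z ord0 i|)) => //; rewrite mem_index_enum.
have [k hk] : exists k : nat, L <= k%:R * s.
  exists (Num.truncn `|L / s|).+1; rewrite -ler_pdivrMr//.
  by rewrite (le_trans (ler_norm _))// ltW// truncnS_gt.
exists k => x y Ex Ey i.
have [x' x'l xx'] := cov x Ex; have [y' y'l yy'] := cov y Ey.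
have := xx' i; have := yy' i; have := hL y' x' i y'l x'l.
have := ler_distD (y' ord0 i) (y ord0 i) (x ord0 i).
have := ler_distD (x' ord0 i) (y' ord0 i) (x ord0 i); rewrite (distrC (x' ord0 i) (x ord0 i)).
rewrite -[k.+2%:R]natr1 -[k.+1%:R]natr1 !mulrDl mul1r; lra.
Qed.

(** Finitely many boxes cover [E], hence [pi]-almost all of [B]. Their contributions are bounded one
    by one, with the same number of steps for every starting point thanks to [support_diameter]. *)
Lemma mh_minorization : exists m (c : R), 0 < c /\ forall x B, E x -> measurable B ->
  (c%:E * pi B <= iter m (pop P) (fun y => (\1_B y)%:E) x)%E.
Proof.
have [k hk] := support_diameter; have [c c0 hc] := chain_of_boxes k.
have [l lE cov] := finite_box_net s0.
exists k.+1, (c / (size l).+1%:R); split; first by rewrite divr_gt0.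
move=> x B Ex mB; set v := iter _ _ _ x.
have v0 : (0 <= v)%E by exact: iter_pop_ge0.
have hB y : y \in l -> (c%:E * pi (B `&` box y s) <= v)%E.
  by move=> yl; apply: hc => //; [exact: lE|move=> i; apply: hk => //; exact: lE].
pose W (r : seq Rd) := \big[setU/set0]_(y <- r) (B `&` box y s).
have mW r : measurable (W r).
  by apply: bigsetU_measurable => y _; apply: measurableI => //; exact: measurable_box.
have hW r : {subset r <= l} -> (c%:E * pi (W r) <= (size r)%:R%:E * v)%E.
  elim: r => [|y r IH] rl; first by rewrite /W big_nil measure0 mule0 mul0e.
  rewrite /W big_cons -/(W r).
  apply: (@le_trans _ _ (c%:E * (pi (B `&` box y s) + pi (W r)))%E).
    rewrite lee_pmul2l//; apply: measureU2 => //.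
    by apply: measurableI => //; exact: measurable_box.
  rewrite ge0_muleDr//= -natr1 EFinD ge0_muleDl// mul1e addeC.
  apply: leeD; first by apply: IH => z zr; apply: rl; rewrite inE zr orbT.
  by apply: hB; apply: rl; rewrite mem_head.
have piB : (pi B <= pi (W l))%E.
  have : (pi B <= pi (W l `|` ~` E))%E.
    apply: le_meas => //; first by apply: measurableU => //; exact: measurableC.
    move=> w Bw; have [Ew|] := pselect (E w); last by right.
    left; have [y yl yw] := cov w Ew.
    rewrite /W; elim: l yl {lE cov hB hW} => [//|a r IH]; rewrite inE big_cons => /orP[/eqP <-|yr].
      by left; split.
    by right; exact: IH.
  move=> h; apply: (le_trans h); apply: le_measU_null => //; first exact: measurableC.
  exact: density_supportC0.
have key : (c%:E * pi B <= (size l)%:R%:E * v)%E.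
  by apply: le_trans (hW l _) => //; rewrite lee_pmul2l.
rewrite mulrC EFinM -muleA lee_pdivrMl//.
apply: (le_trans key); apply: lee_wpmul2r => //.
by rewrite lee_fin ler_nat.
Qed.

End minorization.

(** * Construction of the split kernel *)

Section split_kernel_theory.
Context (R : realType) (d : measure_display) (T : measurableType d).
Variables (P : R.-fker T ~> T) (kern : T -> set T -> \bar R).
Variables (S : set T) (delta0 : R) (Psi : probability T R).
Hypothesis PE : forall x A, measurable A -> P x A = kern x A.
Hypothesis P1 : forall x, P x setT = 1%E.
Hypothesis sm : small_set kern S delta0 Psi.

Let mS : measurable S. Proof. by case: sm. Qed.
Let d0 : 0 < delta0. Proof. by case: sm. Qed.
Let minor x B : S x -> measurable B -> (delta0%:E * Psi B <= P x B)%E.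
Proof. by move=> Sx mB; rewrite PE//; case: sm => _ _ _; exact. Qed.

Lemma small_set_nonempty : exists x, S x.
Proof.
apply: contrapT => h; case: sm => _ _ + _; rewrite (_ : S = set0) ?measure0.
  by move=> /eqP; rewrite eqe eq_sym oner_eq0.
by apply/seteqP; split => // x Sx; apply: h; exists x.
Qed.

Lemma small_set_le1 : delta0 <= 1.
Proof.
have [x Sx] := small_set_nonempty; have := minor Sx measurableT.
by rewrite P1 probability_setT mule1 lee_fin.
Qed.

Let e1 : 0 <= 1 - delta0. Proof. by rewrite subr_ge0 small_set_le1. Qed.

Let a x B : R := fine (P x B).
Let psi B : R := fine (Psi B).
Let aE x B : measurable B -> P x B = (a x B)%:E.
Proof.
move=> mB; rewrite /a fineK// ge0_fin_numE//.
by apply: (@le_lt_trans _ _ (P x setT)); [exact: le_meas|rewrite P1 ltry].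
Qed.
Let psiE B : measurable B -> Psi B = (psi B)%:E.
Proof. by move=> mB; rewrite /psi fineK// fin_num_measure. Qed.
Let psi_le x B : S x -> measurable B -> delta0 * psi B <= a x B.
Proof. by move=> Sx mB; rewrite -lee_fin EFinM -psiE// -aE//; exact: minor. Qed.

Definition split_base (z : T * bool) (B : set T) : \bar R :=
  (if z.1 \in S then if z.2 then Psi B
     else ((1 - delta0)^-1)%:E * (kern z.1 B - delta0%:E * Psi B)
   else kern z.1 B)%E.

Let res x B : R := (1 - delta0)^-1 * (a x B - delta0 * psi B).

Let baseE z B : measurable B -> split_base z B =
  (if z.1 \in S then if z.2 then (psi B)%:E else (res z.1 B)%:E else (a z.1 B)%:E).
Proof.
by move=> mB; rewrite /split_base -PE// aE// psiE// -EFinM -EFinB -EFinM.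
Qed.

Let cvg_measure_real (mu : {measure set T -> \bar R}) (m : set T -> R) :
  (forall B, measurable B -> mu B = (m B)%:E) -> forall F : (set T)^nat,
  (forall i, measurable (F i)) -> trivIset setT F -> measurable (\bigcup_i F i) ->
  (fun n => \sum_(0 <= i < n) m (F i)) @ \oo --> m (\bigcup_i F i).
Proof.
move=> mE F mF tF mUF; have := @measure_semi_sigma_additive _ _ _ mu F mF tF mUF.
rewrite mE// (_ : (fun n => _) = EFin \o (fun n => \sum_(0 <= i < n) m (F i))).
  by move=> /fine_cvg.
by apply/funext => n /=; rewrite -sumEFin; apply: eq_bigr => i _; rewrite mE.
Qed.

Let measure_setCD (mu : {measure set T -> \bar R}) B : measurable B ->
  (mu B + mu (~` B) = mu setT)%E.
Proof.
move=> mB; rewrite -(setUv B) measureU//; [exact: measurableC|exact: setICr].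
Qed.

(** The residual law is a difference of measures, so its additivity is proved with the real-valued
    [a] and [psi], whose partial sums can be subtracted in the limit. For [delta0 = 1] the
    coefficient is the inverse of 0, which is 0, and the mass is still at most 1. *)
Lemma split_base_kernel : exists Bs : R.-fker (T * bool)%type ~> T,
  forall z B, measurable B -> Bs z B = split_base z B.
Proof.
apply: finite_kernel_of.
- by move=> [x b]; rewrite baseE//= /res /a /psi !measure0 /= mulr0 subr0 mulr0; case: (x \in S) => //; case: b.
- move=> [x b] B mB; rewrite baseE//=; case: ifPn => [/set_mem Sx|_]; last by rewrite lee_fin fine_ge0.
  case: b; rewrite lee_fin ?fine_ge0// mulr_ge0 ?invr_ge0// subr_ge0; exact: psi_le.
- move=> [x b]; apply: (@semi_sigma_additive_ext _ _ _ _ (fun B => if x \in S then if b then (psi B)%:E else (res x B)%:E else (a x B)%:E)).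
    by move=> B mB; rewrite baseE.
  case: (x \in S); last first.
    apply: (@semi_sigma_additive_ext _ _ _ _ (P x)); last exact: measure_semi_sigma_additive.
    by move=> B mB; rewrite aE.
  case: b.
    apply: (@semi_sigma_additive_ext _ _ _ _ Psi); last exact: measure_semi_sigma_additive.
    by move=> B mB; rewrite psiE.
  move=> F mF tF mUF.
  have cP := cvg_measure_real (aE x) mF tF mUF.
  have cPsi := cvg_measure_real psiE mF tF mUF.
  rewrite (_ : (fun n => _) = EFin \o (fun n => (1 - delta0)^-1 *
     (\sum_(0 <= i < n) a x (F i) - delta0 * \sum_(0 <= i < n) psi (F i)))); last first.
    apply/funext => n /=; rewrite sumEFin; congr EFin.
    by rewrite /res -mulr_sumr sumrB -mulr_sumr.
  apply: cvg_EFin; first by apply: nearW.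
  by apply: cvgMr; apply: cvgB => //; exact: cvgMr.
- move=> B mB.
  have mI (C : set (T * bool)) : measurable C -> measurable_fun setT (fun z => (\1_C z)%:E : \bar R).
    by move=> mC; apply/measurable_EFinP; exact: measurable_indic.
  have mp : measurable_fun setT (fun z : T * bool => P z.1 B).
    exact: (measurableT_comp (measurable_kernel P B mB) measurable_fst).
  rewrite (_ : (fun z => _) = (fun z => (\1_(S `*` [set true]) z)%:E * Psi B +
    ((\1_(S `*` [set false]) z)%:E * (((1 - delta0)^-1)%:E * (P z.1 B - delta0%:E * Psi B)) +
    (\1_(~` (S `*` setT)) z)%:E * P z.1 B))%E); last first.
    apply/funext => -[x b]; rewrite /split_base -PE//=.
    have i1 c : \1_(S `*` [set c]) (x, b) = ((x \in S) && (b == c))%:R :> R.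
      rewrite indicE; congr (nat_of_bool _)%:R; apply/idP/andP => [/set_mem [/= Sx ->]|[/set_mem Sx /eqP ->]].
        by rewrite eqxx; split => //; exact: mem_set.
      by apply/mem_set.
    have i2 : \1_(~` (S `*` setT)) (x, b) = (x \notin S)%:R :> R.
      rewrite indicE; congr (nat_of_bool _)%:R; apply/idP/idP => [/set_mem h|].
        by apply/negP => /set_mem Sx; apply: h.
      by rewrite notin_setE => h; apply/mem_set => -[].
    rewrite !i1 i2; move: i1 i2 => _ _; case: (x \in S); case: b => /=; rewrite ?mul1e ?mul0e ?add0e ?adde0//.
  apply: emeasurable_funD.
    by apply: emeasurable_funM => //; apply: mI; exact: measurableX.
  apply: emeasurable_funD.
    apply: emeasurable_funM; first by apply: mI; exact: measurableX.
    by apply: measurable_funeM; apply: emeasurable_funB.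
  apply: emeasurable_funM => //; apply: mI; apply: measurableC; exact: measurableX.
move=> [x b]; rewrite baseE//=; case: ifPn => [/set_mem Sx|_]; last by rewrite -aE// P1.
case: b; first by rewrite -psiE// probability_setT.
have h : psi setT = 1 by rewrite /psi probability_setT.
have h' : a x setT = 1 by rewrite /a P1.
rewrite lee_fin /res h h' mulr1; have [->|n] := eqVneq (1 - delta0) 0; first by rewrite mulr0.
by rewrite mulVf.
Qed.

Lemma split_finite_kernel : exists K : R.-fker (T * bool)%type ~> (T * bool)%type,
  [/\ forall z C, measurable C -> K z C = split_kernel kern S delta0 Psi z C,
      forall z, (K z setT <= 1)%E,
      forall z C, measurable C ->
        K z C = (delta0%:E * K z (fst @^-1` ((fun x => (x, true)) @^-1` C)) +
           (1 - delta0)%:E * K z (fst @^-1` ((fun x => (x, false)) @^-1` C)))%E,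
      forall x B, S x -> measurable B -> K (x, true) (fst @^-1` B) = Psi B &
      forall x B, measurable B -> P x B =
        (delta0%:E * K (x, true) (fst @^-1` B) + (1 - delta0)%:E * K (x, false) (fst @^-1` B))%E].
Proof.
have [Bs BsE] := split_base_kernel.
have mpair b : measurable_fun setT (fun x : T => (x, b) : T * bool) by exact: measurable_fun_pair.
have mpre (b : bool) (C : set (T * bool)) : measurable C -> measurable ((fun x : T => (x, b)) @^-1` C).
  by move=> mC; rewrite -[X in measurable X]setTI; exact: mpair.
have mfst (B : set T) : measurable B -> measurable (fst @^-1` B : set (T * bool)).
  by move=> mB; rewrite -[X in measurable X]setTI; exact: measurable_fst.
pose Kf z C := (delta0%:E * Bs z ((fun x => (x, true)) @^-1` C) +
   (1 - delta0)%:E * Bs z ((fun x => (x, false)) @^-1` C))%E.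
have Bs1 z : (Bs z setT <= 1)%E.
  rewrite BsE// baseE//; case: ifPn => [/set_mem Sx|_]; last by rewrite -aE// P1.
  case: z.2; first by rewrite -psiE// probability_setT.
  have h : psi setT = 1 by rewrite /psi probability_setT.
  have h' : a z.1 setT = 1 by rewrite /a P1.
  rewrite lee_fin /res h h' mulr1; have [->|n] := eqVneq (1 - delta0) 0; first by rewrite mulr0.
  by rewrite mulVf.
have Ksplit z C : measurable C -> Kf z C = split_kernel kern S delta0 Psi z C.
  move=> mC; rewrite /split_kernel /product_measure2 integral_bernoulli_prob; last 2 first.
  - by rewrite (ltW d0) small_set_le1.
  - move=> b /=; rewrite -/(split_base z (ysection C b)) -BsE//.
    exact: measurable_ysection.
  rewrite /= -/(split_base z (ysection C true)) -/(split_base z (ysection C false)).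
  have e b : ysection C b = (fun x : T => (x, b)) @^-1` C.
    by apply/seteqP; split => x /=; rewrite /ysection/= => h; [exact: set_mem|exact: mem_set].
  by rewrite !e -!BsE//; exact: mpre.
have [] := @finite_kernel_of R _ _ _ _ Kf.
- by move=> z; rewrite /Kf !preimage_set0 !measure0 !mule0 adde0.
- by move=> z C mC; rewrite /Kf adde_ge0// mule_ge0// lee_fin// ltW.
- move=> z; have m1 := mpair true; have m2 := mpair false.
  pose mu : {measure set (T * bool) -> \bar R} :=
     measure_add (mscale (NngNum (ltW d0)) (pushforward (Bs z) (fun x : T => (x, true))))
     (mscale (NngNum e1) (pushforward (Bs z) (fun x : T => (x, false)))).
  have -> : Kf z = (mu m1 m2 : set (T * bool) -> \bar R).
    by apply/funext => B; rewrite /mu /= -[RHS]/(measure_add _ _ B) measure_addE.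
  exact: measure_semi_sigma_additive.
- move=> C mC; apply: emeasurable_funD; apply: measurable_funeM; apply: measurable_kernel; exact: mpre.
- move=> z; rewrite /Kf !preimage_setT.
  apply: (@le_trans _ _ (delta0%:E * 1 + (1 - delta0)%:E * 1)%E).
    by apply: leeD; apply: lee_wpmul2l => //; rewrite lee_fin// ltW.
  by rewrite !mule1 -EFinD addrC subrK.
move=> K KE.
have Kfst z B : measurable B -> K z (fst @^-1` B) = Bs z B.
  move=> mB; rewrite KE; last exact: mfst.
  rewrite /Kf.
  have e b : (fun x : T => (x, b)) @^-1` (fst @^-1` B) = B by [].
  rewrite !e -ge0_muleDl ?lee_fin// ?(ltW d0)// -EFinD addrC subrK mul1e//.
exists K; split.
- by move=> z C mC; rewrite KE// Ksplit.
- move=> z; rewrite -[X in K z X](preimage_setT fst) Kfst//.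
- by move=> z C mC; rewrite !Kfst ?KE//; exact: mpre.
- by move=> x B Sx mB; rewrite Kfst// BsE// /split_base /= (mem_set Sx).
move=> x B mB; rewrite !Kfst// !BsE// !baseE//= aE//.
case: ifPn => [/set_mem Sx|_]; last first.
  by rewrite -!EFinM -EFinD; congr EFin; ring.
rewrite -!EFinM -EFinD; congr EFin; rewrite /res.
have [e|n] := eqVneq (1 - delta0) 0; last by rewrite mulrA mulfV// mul1r; ring.
(* Here the residual part has weight 0, so [P x] must equal [Psi]. It dominates [Psi] on [B] and on
   the complement, and both have total mass 1. *)
rewrite e mul0r addr0; have d1 : delta0 = 1 by lra.
have h C : measurable C -> psi C <= a x C by move=> mC; have := psi_le Sx mC; rewrite d1 mul1r.
have mBC := measurableC mB.
have : psi B + psi (~` B) = a x B + a x (~` B).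
  apply: EFin_inj; rewrite !EFinD -!psiE// -!aE//.
  have hP : (P x B + P x (~` B) = 1)%E by rewrite measure_setCD.
  by rewrite hP; exact: (etrans (measure_setCD Psi mB) (probability_setT Psi)).
by have := h _ mB; have := h _ mBC; rewrite d1; lra.
Qed.

End split_kernel_theory.

(** * Moments of the regeneration time *)

Section geometric_moments.
Context (R : realType) (d : measure_display) (Omega : measurableType d).
Variables (P : probability Omega R) (N : Omega -> nat) (c rho : R).
Hypothesis mN : forall i, measurable (N @^-1` [set i]).
Hypotheses (c0 : 0 <= c) (rho01 : 0 < rho < 1).
Hypothesis tailN : forall n, (P [set w | N w = 0%N \/ (n < N w)%N] <= (c * rho ^+ n)%:E)%E.

Let sg : R := Num.sqrt rho.
Let sg0 : 0 < sg. Proof. by rewrite sqrtr_gt0; case/andP: rho01. Qed.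
Let sg2 : sg ^+ 2 = rho. Proof. by rewrite sqr_sqrtr// ltW//; case/andP: rho01. Qed.
Let sg1 : sg < 1.
Proof.
case/andP: rho01 => r0 r1; rewrite -sqrtr1 ltr_sqrt//.
Qed.

(** Chosen so that [expR (4 * tail_rate * n)] is [sg ^- n]: half of the decay of the tail is given
    up, and the series left sums to [exp_bound]. The factor 4 leaves room for three powers of [n]
    and a tilt of rate at most [tail_rate]. *)
Definition tail_rate : R := - ln sg / 4.
Definition exp_bound : R := c / (sg * (1 - sg)).

Lemma tail_rate_gt0 : 0 < tail_rate.
Proof. by rewrite divr_gt0// oppr_gt0 ln_lt0// sg0 sg1. Qed.

Let mset (Q : pred nat) : measurable [set w | Q (N w)].
Proof.
rewrite (_ : [set w | _] = \bigcup_(i in [set i | Q i]) N @^-1` [set i]).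
  by apply: bigcup_measurable.
apply/seteqP; split => [w Qw|w [i Qi /= Ni]]; first by exists (N w).
by rewrite /= Ni.
Qed.

Lemma geometric_rho_cvg : (fun n => c * rho ^+ n) @ \oo --> (0 : R).
Proof.
rewrite -[X in _ --> X](mulr0 c); apply: cvgMr; apply: cvg_expr.
by case/andP: rho01 => r0 r1; rewrite ger0_norm// ltW.
Qed.

Lemma null_never : P (N @^-1` [set 0%N]) = 0%E.
Proof.
apply/eqP; rewrite eq_le measure_ge0 andbT; apply/lee_addgt0Pr => e e0; rewrite add0e.
have /cvgrPdist_lt/(_ e e0) [n _ /(_ n (leqnn n))] := geometric_rho_cvg.
rewrite /= sub0r normrN => h.
apply: (@le_trans _ _ (P [set w | N w = 0%N \/ (n < N w)%N])).
  apply: le_meas => //; last by move=> w /= ->; left.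
  rewrite (_ : [set w | _] = [set w | (N w == 0%N) || (n < N w)%N]); first exact: (mset (fun i => (i == 0%N) || (n < i)%N)).
  by apply/seteqP; split => w /=; [case=> [->|->]; rewrite ?orbT|case/orP => [/eqP ->|->]; [left|right]].
apply: (le_trans (tailN n)); rewrite lee_fin (le_trans (ler_norm _))// ltW//.
Qed.

Lemma int_fun_nat (h : nat -> R) : (forall n, 0 <= h n) ->
  (\int[P]_w (h (N w))%:E = \sum_(0 <= n <oo) (h n)%:E * P (N @^-1` [set n]))%E.
Proof.
move=> h0.
have cover : [set: Omega] = \bigcup_n N @^-1` [set n].
  by apply/esym; rewrite -subTset => w _; exists (N w).
have tr : trivIset setT (fun n => N @^-1` [set n]).
  by apply/trivIsetP => i j _ _ ij; apply/seteqP; split => // w [/= -> /eqP]; rewrite (negbTE ij).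
have mh : measurable_fun setT (fun w => (h (N w))%:E).
  by apply: (@measurable_fun_natdep _ _ _ _ N (fun n _ => (h n)%:E)).
rewrite cover ge0_integral_bigcup//; last 2 first.
- by rewrite -cover.
- by move=> w _; rewrite lee_fin.
apply: eq_eseriesr => n _; rewrite -integral_cst//; apply: eq_integral => w /set_mem /= ->.
by [].
Qed.

Lemma int_expR_le : (\int[P]_w (expR (4 * tail_rate * (N w)%:R))%:E <= exp_bound%:E)%E.
Proof.
have e4 n : expR (4 * tail_rate * n%:R) = sg ^- n.
  rewrite mulrC expRM_natl /tail_rate.
  by rewrite [4 * _]mulrC divfK// expRN lnK// ?posrE// exprVn.
rewrite (@int_fun_nat (fun n => expR (4 * tail_rate * n%:R))); last by move=> n; exact: expR_ge0.
apply: lime_le.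
  by apply: is_cvg_nneseries => n _ _; rewrite mule_ge0// lee_fin expR_ge0.
have s1 : 0 < 1 - sg by rewrite subr_gt0.
have term n : ((expR (4 * tail_rate * n.+1%:R))%:E * P (N @^-1` [set n.+1]) <= (c / sg * sg ^+ n)%:E)%E.
  apply: (@le_trans _ _ ((expR (4 * tail_rate * n.+1%:R))%:E * (c * rho ^+ n)%:E)%E).
    apply: lee_wpmul2l; first by rewrite lee_fin expR_ge0.
    apply: le_trans (tailN n); apply: le_meas => //; last by move=> w /= ->; right.
    rewrite (_ : [set w | _] = [set w | (N w == 0%N) || (n < N w)%N]); first exact: (mset (fun i => (i == 0%N) || (n < i)%N)).
    by apply/seteqP; split => w /=; [case=> [->|->]; rewrite ?orbT|case/orP => [/eqP ->|->]; [left|right]].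
  rewrite -EFinM lee_fin e4 -sg2 -exprM mulnC exprM expr2 exprS.
  rewrite le_eqVlt; apply/orP; left; apply/eqP; field.
  by rewrite expf_neq0 gt_eqF.
have bound n : \sum_(0 <= i < n) c / sg * sg ^+ i <= exp_bound.
  rewrite -mulr_sumr /exp_bound invfM mulrA ler_wpM2l//; first by rewrite divr_ge0// ltW.
  rewrite -[leRHS]mul1r ler_pdivlMr//.
  have -> : (\sum_(0 <= i < n) sg ^+ i) * (1 - sg) = 1 - sg ^+ n.
    elim: n => [|n IH]; first by rewrite big_nil mul0r expr0 subrr.
    by rewrite big_nat_recr//= mulrDl IH exprS; ring.
  by rewrite gerBl exprn_ge0// ltW.
apply: nearW => -[|n].
  by rewrite big_nil lee_fin /exp_bound divr_ge0// mulr_ge0// ltW.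
rewrite big_nat_recl//= null_never mule0 add0e.
apply: (@le_trans _ _ (\sum_(0 <= i < n) (c / sg * sg ^+ i)%:E)%E).
  by apply: lee_sum => i _; exact: term.
by rewrite sumEFin lee_fin.
Qed.

Let y := tail_rate.
Let y0 : 0 < y := tail_rate_gt0.

Let mexp (a : R) : measurable_fun setT (fun w => (expR (a * (N w)%:R))%:E).
Proof. by apply: (@measurable_fun_natdep _ _ _ _ N (fun n _ => (expR (a * n%:R))%:E)). Qed.

Let le_expR (t : R) : t <= expR t.
Proof. by have := expR_ge1Dx t; lra. Qed.

Let exp_comp (h : nat -> R) (h' : R) : 0 <= h' -> (forall n, 0 <= h n) ->
  (forall n, h n <= h' * expR (4 * y * n%:R)) ->
  (\int[P]_w (h (N w))%:E <= (h' * exp_bound)%:E)%E.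
Proof.
move=> h'0 h0 hh; apply: (@le_trans _ _ (\int[P]_w (h'%:E * (expR (4 * y * (N w)%:R))%:E))%E).
  apply: (ge0_int_le P measurableT).
  - by apply: (@measurable_fun_natdep _ _ _ _ N (fun n _ => (h n)%:E)).
  - exact: measurable_funeM.
  - by move=> w; rewrite lee_fin.
  - by move=> w; rewrite -EFinM lee_fin.
rewrite (ge0_intZl P measurableT (mexp _) _ h'0); last by move=> w; rewrite lee_fin expR_ge0.
by rewrite EFinM; apply: lee_wpmul2l; [rewrite lee_fin|exact: int_expR_le].
Qed.

Lemma exp_bound_ge1 : 1 <= exp_bound.
Proof.
rewrite -lee_fin; apply: le_trans int_expR_le; rewrite -[leLHS](int_cst P).
apply: (ge0_int_le P measurableT) => // w.
rewrite lee_fin (le_trans _ (expR_ge1Dx _))// lerDl.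
by apply: mulr_ge0 => //; apply: mulr_ge0 => //; exact: (ltW tail_rate_gt0).
Qed.

Let yn n : 0 <= y * n%:R. Proof. by rewrite mulr_ge0// ltW. Qed.

Lemma int_nat_le : (\int[P]_w ((N w)%:R)%:E <= (exp_bound / y)%:E)%E.
Proof.
rewrite mulrC; apply: (exp_comp (h := fun n => n%:R)) => [|//|n]; first by rewrite invr_ge0 (ltW y0).
rewrite ler_pdivlMl//; apply: (le_trans (le_expR _)); rewrite ler_expR.
by have := yn n; lra.
Qed.

Lemma int_sqr_le : (\int[P]_w ((N w)%:R ^+ 2)%:E <= (exp_bound / y ^+ 2)%:E)%E.
Proof.
rewrite mulrC; apply: (exp_comp (h := fun n => n%:R ^+ 2)) => [|n|n].
- by rewrite invr_ge0 exprn_ge0// (ltW y0).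
- exact: sqr_ge0.
rewrite ler_pdivlMl ?exprn_gt0// -exprMn.
apply: (@le_trans _ _ (expR (y * n%:R) ^+ 2)).
  by rewrite lerXn2r ?nnegrE ?expR_ge0.
by rewrite -expRM_natl ler_expR; have := yn n; lra.
Qed.

(** By [expR x <= 1 + x * expR x], the tilt adds to the second moment at most
    [th / y ^+ 3 * exp_bound], which the last condition on [th] keeps below 1, hence below [m2]. *)
Lemma int_sqr_expR_le (th : R) : 0 <= th -> th <= y -> th <= y ^+ 3 / exp_bound ->
  forall m2 : R, 1 <= m2 -> (\int[P]_w ((N w)%:R ^+ 2)%:E = m2%:E)%E ->
  (\int[P]_w ((N w)%:R ^+ 2 * expR (th * (N w)%:R))%:E <= (2 * m2)%:E)%E.
Proof.
move=> th0 thy thy3 m2 m21 m2E.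
have m2' : measurable_fun setT (fun w => ((N w)%:R ^+ 2)%:E : \bar R).
  by apply: (@measurable_fun_natdep _ _ _ _ N (fun n _ => (n%:R ^+ 2)%:E)).
have ck : 0 <= th / y ^+ 3 by rewrite divr_ge0// exprn_ge0// ltW.
apply: (@le_trans _ _ (\int[P]_w (((N w)%:R ^+ 2)%:E + (th / y ^+ 3)%:E * (expR (4 * y * (N w)%:R))%:E))%E).
  apply: (ge0_int_le P measurableT).
  - by apply: (@measurable_fun_natdep _ _ _ _ N (fun n _ => (n%:R ^+ 2 * expR (th * n%:R))%:E)).
  - by apply: emeasurable_funD => //; exact: measurable_funeM.
  - by move=> w; rewrite lee_fin mulr_ge0 ?sqr_ge0 ?expR_ge0.
  move=> w; set n := N w; rewrite -EFinM -EFinD lee_fin.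
  have tn : 0 <= th * n%:R by rewrite mulr_ge0.
  have e1 : expR (th * n%:R) <= 1 + th * n%:R * expR (th * n%:R).
    have := expR_ge1Dx (- (th * n%:R)).
    rewrite -(ler_pM2r (expR_gt0 (th * n%:R))) -expRD addNr expR0; lra.
  have e2 : th * n%:R * expR (th * n%:R) * n%:R ^+ 2 <= th / y ^+ 3 * expR (4 * y * n%:R).
    have -> : th * n%:R * expR (th * n%:R) * n%:R ^+ 2 = th / y ^+ 3 * ((y * n%:R) ^+ 3 * expR (th * n%:R)).
      by field; rewrite gt_eqF.
    apply: ler_wpM2l => //.
    apply: (@le_trans _ _ (expR (y * n%:R) ^+ 3 * expR (y * n%:R))).
      apply: ler_pM; rewrite ?exprn_ge0 ?expR_ge0//; last by rewrite ler_expR ler_wpM2r.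
      by rewrite lerXn2r ?nnegrE ?expR_ge0.
    by rewrite -expRM_natl -expRD ler_expR; lra.
  have s0 : 0 <= n%:R ^+ 2 :> R by rewrite sqr_ge0.
  by have := ler_wpM2l s0 e1; lra.
rewrite (ge0_intD P measurableT m2' _ (measurable_funeM _ (mexp _))); last 2 first.
- by move=> w; rewrite lee_fin sqr_ge0.
- by move=> w; rewrite mule_ge0// lee_fin expR_ge0.
rewrite (ge0_intZl P measurableT (mexp _) _ ck); last by move=> w; rewrite lee_fin expR_ge0.
rewrite m2E.
apply: (@le_trans _ _ (m2%:E + (th / y ^+ 3)%:E * exp_bound%:E)%E).
  by apply: leeD => //; apply: lee_wpmul2l; [rewrite lee_fin|exact: int_expR_le].
rewrite -EFinM -EFinD lee_fin.
have b0 : 0 < exp_bound by rewrite (lt_le_trans ltr01)// exp_bound_ge1.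
have : th / y ^+ 3 * exp_bound <= 1.
  rewrite mulrAC ler_pdivrMr ?exprn_gt0// mul1r.
  by move: thy3; rewrite ler_pdivlMr.
lra.
Qed.

(** The logarithm of the moment is linear in [th], so in the Chernoff bound the first block acts
    like a deterministic shift by [mean_bound]. *)
Lemma int_expR_small (th : R) : 0 <= th -> th <= y ->
  (\int[P]_w (expR (th * (N w)%:R))%:E <= (expR (th * (exp_bound / y)))%:E)%E.
Proof.
move=> th0 thy; have ck : 0 <= th / y by rewrite divr_ge0// ltW.
apply: (@le_trans _ _ (\int[P]_w (1 + (th / y)%:E * (expR (4 * y * (N w)%:R))%:E))%E).
  apply: (ge0_int_le P measurableT) => //.
    by apply: emeasurable_funD => //; exact: measurable_funeM.
  move=> w; set n := N w; rewrite -EFinM -EFinD lee_fin.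
  have tn : 0 <= th * n%:R by rewrite mulr_ge0.
  have e1 : expR (th * n%:R) <= 1 + th * n%:R * expR (th * n%:R).
    have := expR_ge1Dx (- (th * n%:R)).
    rewrite -(ler_pM2r (expR_gt0 (th * n%:R))) -expRD addNr expR0; lra.
  have e2 : th * n%:R * expR (th * n%:R) <= th / y * expR (4 * y * n%:R).
    have -> : th * n%:R * expR (th * n%:R) = th / y * ((y * n%:R) * expR (th * n%:R)).
      by field; rewrite gt_eqF.
    apply: ler_wpM2l => //.
    apply: (@le_trans _ _ (expR (y * n%:R) * expR (y * n%:R))).
      by apply: ler_pM; rewrite ?expR_ge0// ler_expR ler_wpM2r.
    by rewrite -expRD ler_expR; have := yn n; lra.
  lra.
rewrite (ge0_intD P measurableT (measurable_cst _) _ (measurable_funeM _ (mexp _))); last 2 first.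
- by move=> w; exact: lee01.
- by move=> w; rewrite mule_ge0// lee_fin expR_ge0.
rewrite (ge0_intZl P measurableT (mexp _) _ ck); last by move=> w; rewrite lee_fin expR_ge0.
rewrite int_cst.
apply: (@le_trans _ _ (1 + (th / y)%:E * exp_bound%:E)%E).
  by apply: leeD => //; apply: lee_wpmul2l; [rewrite lee_fin|exact: int_expR_le].
rewrite -EFinM -EFinD lee_fin mulrAC -mulrA; exact: expR_ge1Dx.
Qed.

End geometric_moments.

(** The unconstrained minimizer is [u / (2 * V)], with value [- (u ^+ 2 / (4 * V))]; if it exceeds
    [th0], the quadratic term at [th0] is at most half of the linear one. *)
Lemma chernoff_exponent (R : realType) (V u t th0 : R) : 0 < V -> 0 < u -> 0 < th0 ->
  4 * V * t <= u ^+ 2 -> 2 * t / th0 <= u ->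
  exists2 th, 0 <= th <= th0 & V * th ^+ 2 - th * u <= - t.
Proof.
move=> V0 u0 th00 h1 h2; have [h|h] := leP (u / (2 * V)) th0.
  exists (u / (2 * V)); first by rewrite h andbT divr_ge0// ?mulr_ge0// ltW.
  have -> : V * (u / (2 * V)) ^+ 2 - u / (2 * V) * u = - (u ^+ 2 / (4 * V)) by field; rewrite gt_eqF.
  by rewrite lerN2 ler_pdivlMr ?mulr_gt0// mulrC.
exists th0; first by rewrite lexx ltW.
move: h; rewrite ltr_pdivlMr ?mulr_gt0// => h.
move: h2; rewrite ler_pdivrMr// => h2.
have : V * th0 ^+ 2 <= th0 * u / 2 by rewrite expr2; nra.
lra.
Qed.

(** * Explicit constants and bounds for a regenerative chain *)

Section moment_constants.
Context (R : realType).
Implicit Types c rho U Kc : R.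

Definition mean_bound c rho : R := exp_bound c rho / tail_rate rho.
Definition sqr_bound c rho : R := exp_bound c rho / tail_rate rho ^+ 2.
(** The two restrictions on the tilt in [int_sqr_expR_le]. *)
Definition exp_radius c rho : R := Num.min (tail_rate rho) (tail_rate rho ^+ 3 / exp_bound c rho).
(** In this order: the symmetrized blocks, the overshoot and the first block, for functions of norm
    at most [2 * U]. *)
Definition rate_const Kc U c rho : R :=
  2 * Kc * Num.sqrt (sqr_bound c rho) + 2 * U * sqr_bound c rho + 2 * U * mean_bound c rho.

End moment_constants.

Section regenerative_bounds.
Context (R : realType) (d dO : measure_display) (T : measurableType d)
  (Omega : measurableType dO).
Variables (A : set T) (k : R.-fker T ~> T) (Z : nat -> Omega -> T).
Variables (PA P0 : probability Omega R) (muA mu0 : set T -> \bar R).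
Hypotheses (mA : measurable A) (muA1 : muA A = 1%E)
  (atom : forall x y B, A x -> A y -> measurable B -> k x B = k y B)
  (MCA : markov_chain PA (fun x => k x : set T -> \bar R) muA Z)
  (MC0 : markov_chain P0 (fun x => k x : set T -> \bar R) mu0 Z).
Variables (r : nat) (g : T -> 'rV[R]_r) (U Kc c rho : R).
Hypotheses (mg : measurable_fun setT g) (U0 : 0 < U) (gU : forall x, row_norm (g x) <= 2 * U).
Hypotheses (Kc0 : 0 <= Kc) (c0 : 0 <= c) (rho01 : 0 < rho < 1).
Hypothesis tailA : forall n, (PA (stays Z (~` A) 0 n) <= (c * rho ^+ n)%:E)%E.
Hypothesis tail0 : forall n, (P0 (stays Z (~` A) 0 n) <= (c * rho ^+ n)%:E)%E.
Hypothesis det : forall l : seq Omega,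
  ravg (map (block A Z g) l) (@row_norm R r) 0 <= Kc * Num.sqrt (\sum_(w <- l) (rt Z A w)%:R ^+ 2).
Hypothesis centred : forall i, PA.-integrable setT (fun w => (block A Z g w ord0 i)%:E) /\
  (\int[PA]_w (block A Z g w ord0 i)%:E = 0)%E.

Local Notation S := (psum Z g 0).
Local Notation rt := (rt Z A).
Local Notation y := (tail_rate rho).
Local Notation X := (exp_bound c rho).
Local Notation Q := (sqr_bound c rho).
Local Notation C2 := (mean_bound c rho).
Local Notation D1 := (rate_const Kc U c rho).

Let mZ n : measurable_fun setT (Z n). Proof. by case: MCA. Qed.
Let mrt i : measurable (rt @^-1` [set i]). Proof. exact: measurable_rt. Qed.

Let tA n : (PA [set w | rt w = 0%N \/ (n < rt w)%N] <= (c * rho ^+ n)%:E)%E.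
Proof. by rewrite rt_gtE. Qed.
Let t0 n : (P0 [set w | rt w = 0%N \/ (n < rt w)%N] <= (c * rho ^+ n)%:E)%E.
Proof. by rewrite rt_gtE. Qed.

Let nullA : PA (rt @^-1` [set 0%N]) = 0%E. Proof. exact: (null_never mrt rho01 tA). Qed.
Let null0 : P0 (rt @^-1` [set 0%N]) = 0%E. Proof. exact: (null_never mrt rho01 t0). Qed.

Let y0 : 0 < y. Proof. exact: tail_rate_gt0. Qed.
Let X1 : 1 <= X. Proof. exact: (exp_bound_ge1 mrt c0 rho01 tA). Qed.
Let X0 : 0 < X. Proof. exact: lt_le_trans ltr01 X1. Qed.
Let Q0 : 0 < Q. Proof. by rewrite divr_gt0// exprn_gt0. Qed.
Let C20 : 0 < C2. Proof. by rewrite divr_gt0. Qed.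

Definition block_m1 : R := fine (\int[PA]_w ((rt w)%:R)%:E).
Definition block_m2 : R := fine (\int[PA]_w ((rt w)%:R ^+ 2)%:E).

Let mr (h : nat -> R) : measurable_fun setT (fun w => (h (rt w))%:E).
Proof. by apply/measurable_EFinP; exact: (measurable_rtR mA MCA h). Qed.

Lemma block_m1E : (\int[PA]_w ((rt w)%:R)%:E = block_m1%:E)%E.
Proof.
rewrite fineK// ge0_fin_numE; last by apply: integral_ge0 => w _; rewrite lee_fin.
exact: le_lt_trans (int_nat_le mrt c0 rho01 tA) (ltry _).
Qed.

Lemma block_m2E : (\int[PA]_w ((rt w)%:R ^+ 2)%:E = block_m2%:E)%E.
Proof.
rewrite fineK// ge0_fin_numE; last by apply: integral_ge0 => w _; rewrite lee_fin sqr_ge0.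
exact: le_lt_trans (int_sqr_le mrt c0 rho01 tA) (ltry _).
Qed.

Lemma block_m1_le : block_m1 <= C2.
Proof. by rewrite -lee_fin -block_m1E; exact: (int_nat_le mrt c0 rho01 tA). Qed.

Lemma block_m2_le : block_m2 <= Q.
Proof. by rewrite -lee_fin -block_m2E; exact: (int_sqr_le mrt c0 rho01 tA). Qed.

Lemma block_m1_ge1 : 1 <= block_m1.
Proof.
rewrite -lee_fin -block_m1E -[leLHS](int_cst PA).
apply: (ae_ge0_le_integral measurableT (fun _ _ => lee01) (measurable_cst _) _ (mr (fun n => n%:R))) => [w _|].
  by rewrite lee_fin.
by apply: (rt_pos_ae mA MCA nullA) => w rw _; rewrite lee_fin ler1n.
Qed.

Lemma block_m2_ge1 : 1 <= block_m2.
Proof.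
rewrite -lee_fin -block_m2E -[leLHS](int_cst PA).
apply: ae_ge0_le_integral => //.
- exact: (mr (fun n => n%:R ^+ 2)).
by apply: (rt_pos_ae mA MCA nullA) => w rw _; rewrite lee_fin -natrX ler1n expn_gt0 rw.
Qed.

Let m20 : 0 < block_m2. Proof. exact: lt_le_trans ltr01 block_m2_ge1. Qed.

Let B := 2 * U.
Let B0 : 0 <= B. Proof. by rewrite mulr_ge0// ltW. Qed.

Let H n : R := 2 * Kc * Num.sqrt (n%:R * block_m2) + B * block_m2.

Let H0 n : 0 <= H n.
Proof. by rewrite addr_ge0// !mulr_ge0 ?sqrtr_ge0// ltW. Qed.

Let hvalH n j : (j <= n)%N -> hval Z PA g j 0 <= H n.
Proof.
move=> jn; rewrite -lee_fin -(avalE MCA mg B0 gU).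
apply: (le_trans (aval_norm_le mA muA1 atom MCA mg B0 gU Kc0 det block_m2E nullA centred block_m2_ge1 j)).
rewrite lee_fin lerD2r ler_wpM2l ?mulr_ge0// ler_wsqrtr// ler_wpM2r ?(ltW m20)// ler_nat//.
Qed.

Let HD n : (0 < n)%N -> H n + B * C2 <= D1 * Num.sqrt n%:R.
Proof.
move=> n0; have sn : 1 <= Num.sqrt n%:R :> R.
  by rewrite -[leLHS]sqrtr1 ler_wsqrtr// ler1n.
have -> : D1 * Num.sqrt n%:R = 2 * Kc * Num.sqrt Q * Num.sqrt n%:R + B * Q * Num.sqrt n%:R + B * C2 * Num.sqrt n%:R.
  by rewrite /rate_const /B; ring.
rewrite /H; apply: lerD; first apply: lerD.
- rewrite sqrtrM// -[leRHS]mulrA [Num.sqrt Q * _]mulrC ler_wpM2l ?mulr_ge0//.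
  by rewrite ler_wpM2l ?sqrtr_ge0// ler_wsqrtr// block_m2_le.
- apply: (@le_trans _ _ (B * Q)); first by rewrite ler_wpM2l// block_m2_le.
  by rewrite ler_peMr// mulr_ge0// ltW.
- by rewrite ler_peMr// mulr_ge0// ltW.
Qed.

Lemma int_row_norm_le n : (0 < n)%N ->
  (\int[P0]_w (row_norm (S n w))%:E <= (D1 * Num.sqrt n%:R)%:E)%E.
Proof.
move=> n0; apply: (le_trans (int_norm_le mA muA1 atom MCA mg B0 gU MC0 null0 (H0 n) (@hvalH n))).
apply: (@le_trans _ _ (B%:E * C2%:E + (H n)%:E)%E).
  by apply: leeD => //; apply: lee_wpmul2l => //; exact: (int_nat_le mrt c0 rho01 t0).
by rewrite -EFinM -EFinD lee_fin addrC; exact: HD.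
Qed.

(** Markov's inequality at the exponent of [chernoff_exponent]. With [B = 2 * U] the variance term
    is [V = 8 * B ^+ 2 * block_m2 * n], so [4 * V * t] gives 128; the tilt [2 * B * th] must stay
    below [exp_radius], and [2 * t / th0] gives 8. *)
Lemma row_norm_deviation n t : (0 < n)%N -> 0 < t ->
  (P0 [set w | (D1 * Num.sqrt n%:R + Num.max (Num.sqrt (128 * U ^+ 2 * block_m2 * n%:R * t))
     (8 * U * t / exp_radius c rho) < row_norm (S n w))%R] <= (expR (- t))%:E)%E.
Proof.
move=> n0 tp; set u := Num.max _ _; set a := D1 * _ + u.
have n0' : 0 < n%:R :> R by rewrite ltr0n.
have er0 : 0 < exp_radius c rho by rewrite lt_min y0 divr_gt0// exprn_gt0.
pose V := 32 * U ^+ 2 * block_m2 * n%:R.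
have V0 : 0 < V by rewrite !mulr_gt0// exprn_gt0.
have vt : 128 * U ^+ 2 * block_m2 * n%:R * t = 4 * V * t by rewrite /V; ring.
have Vt0 : 0 < 4 * V * t by rewrite !mulr_gt0.
have u0 : 0 < u by rewrite lt_max vt sqrtr_gt0 Vt0.
have u1 : 4 * V * t <= u ^+ 2.
  rewrite -[leLHS](sqr_sqrtr (ltW Vt0)) lerXn2r ?nnegrE ?sqrtr_ge0 ?(ltW u0)//.
  by rewrite /u vt le_max lexx.
have th00 : 0 < exp_radius c rho / (4 * U) by rewrite divr_gt0// mulr_gt0.
have u2 : 2 * t / (exp_radius c rho / (4 * U)) <= u.
  have -> : 2 * t / (exp_radius c rho / (4 * U)) = 8 * U * t / exp_radius c rho.
    by field; rewrite !gt_eqF.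
  by rewrite /u le_max lexx orbT.
have [th /andP[th0 thle] hth] := chernoff_exponent V0 u0 th00 u1 u2.
have thr : 2 * B * th <= exp_radius c rho.
  by move: thle; rewrite ler_pdivlMr ?mulr_gt0// /B; lra.
have thr0 : 0 <= 2 * B * th by rewrite mulr_ge0// mulr_ge0.
have min1 : exp_radius c rho <= y by rewrite ge_min lexx.
have min2 : exp_radius c rho <= y ^+ 3 / X by rewrite ge_min lexx orbT.
have rt2 := int_sqr_expR_le mrt c0 rho01 tA thr0 (le_trans thr min1) (le_trans thr min2) block_m2_ge1 block_m2E.
have tb0 : 0 <= th * B by rewrite mulr_ge0.
have tby : th * B <= y by apply: le_trans (le_trans thr min1); lra.
have E0 := int_expR_small mrt c0 rho01 t0 tb0 tby.
have mgf := int_expR_norm_le mA muA1 atom MCA mg B0 gU MC0 null0 (H0 n) (@hvalH n) th0 (ltW m20) nullA rt2.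
have mN : measurable_fun setT (fun w => row_norm (S n w)).
  exact: (measurableT_comp measurable_row_norm (measurable_psum MCA mg 0 n)).
have mF : measurable [set w | a < row_norm (S n w)].
  have := mN measurableT _ (measurable_itv `]a, +oo[); rewrite setTI.
  by rewrite (_ : _ @^-1` _ = [set w | a < row_norm (S n w)])//; apply/seteqP; split => w; rewrite /= in_itv /= andbT.
have ea0 : 0 <= expR (th * a) by exact: expR_ge0.
have key : ((expR (th * a))%:E * P0 [set w | (a < row_norm (S n w))%R] <=
    (expR (th * H n + n%:R * (8 * B ^+ 2 * block_m2 * th ^+ 2)))%:E * (expR (th * B * C2))%:E)%E.
  apply: (@le_trans _ _ (\int[P0]_w (expR (th * row_norm (S n w)))%:E)%E); last first.
    apply: (le_trans mgf); apply: lee_wpmul2l; first by rewrite lee_fin expR_ge0.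
    exact: E0.
  have mi : measurable_fun setT (fun w => (\1_[set w | a < row_norm (S n w)] w)%:E : \bar R).
    by apply/measurable_EFinP; exact: measurable_indic.
  rewrite -(integral_ind P0 mF) -(ge0_intZl P0 measurableT mi _ ea0); last by move=> w; rewrite lee_fin.
  apply: (ge0_int_le P0 measurableT).
  - exact: measurable_funeM.
  - apply/measurable_EFinP; apply: (measurableT_comp (@measurable_expR R)).
    exact: measurable_funM.
  - by move=> w; rewrite mule_ge0// lee_fin.
  move=> w; rewrite -EFinM lee_fin indicE.
  have [h|h] := pselect ([set w | a < row_norm (S n w)] w).
    by rewrite (mem_set h) mulr1 ler_expR ler_wpM2l// ltW.
  by rewrite (memNset h) mulr0 expR_ge0.
rewrite -(lee_pmul2l _ (_ : (0 < (expR (th * a))%:E)%E)) ?lte_fin ?expR_gt0//.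
apply: (le_trans key); rewrite -!EFinM lee_fin -!expRD ler_expR.
have := ler_wpM2l th0 (HD n0).
have -> : n%:R * (8 * B ^+ 2 * block_m2 * th ^+ 2) = V * th ^+ 2 by rewrite /B /V; ring.
rewrite /a !mulrDr; lra.
Qed.

End regenerative_bounds.

(** * Suprema over the class *)

Section bounded_density_mean.
Context (R : realType) (d : nat) (p : 'rV[R]_d -> R).
Local Notation Rd := 'rV[R]_d.
Local Notation leb := (lebesgue_row R d).
Hypothesis dp : density p.
Variable pi : probability Rd R.
Hypothesis piE : forall A, pi A = (\int[leb]_(y in A) (p y)%:E)%E.
Variables (E : set Rd) (g : Rd -> R) (U : R).
Hypotheses (mE : measurable E) (mg : measurable_fun E g) (gU : forall x, E x -> `|g x| <= U).
Hypothesis U0 : 0 <= U.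

Let mp : measurable_fun setT p. Proof. by case: dp. Qed.
Let p0 x : 0 <= p x. Proof. by case: dp. Qed.

Lemma restrict_norm_le x : `|(g \_ E) x| <= U.
Proof.
rewrite patchE; case: ifPn => [/set_mem|_]; first exact: gU.
by rewrite normr0.
Qed.

Lemma measurable_restrictE : measurable_fun setT (g \_ E).
Proof. by apply/(measurable_restrictT _ _).1. Qed.

(** The shift by [U] makes the integrand nonnegative, as the change of measure [int_density]
    requires. *)
Lemma int_restrict_mean : (\int[pi]_x ((g \_ E) x + U)%:E = (mean_on E p g + U)%:E)%E.
Proof.
have mr := measurable_restrictE.
have mpr : measurable_fun setT (fun x => (p x * (g \_ E) x)%:E).
  by apply/measurable_EFinP; exact: measurable_funM.
have ip : leb.-integrable setT (fun x => (p x)%:E).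
  apply/integrableP; split; first exact/measurable_EFinP.
  under eq_integral do rewrite gee0_abs ?lee_fin//.
  by case: dp => _ _ ->; rewrite ltry.
have iU : leb.-integrable setT (fun x => U%:E * (p x)%:E)%E by exact: integrableZl.
have ipr : leb.-integrable setT (fun x => (p x * (g \_ E) x)%:E).
  apply: (le_integrable measurableT mpr _ iU) => x _.
  rewrite abse_EFin -EFinM abse_EFin lee_fin !normrM mulrC (ger0_norm U0) ler_wpM2r//.
  exact: restrict_norm_le.
have mnE : (mean_on E p g)%:E = (\int[leb]_x (p x * (g \_ E) x)%:E)%E.
  rewrite /mean_on /Rintegral.
  have -> : (\int[leb]_(y in E) (g y * p y)%:E = \int[leb]_x (p x * (g \_ E) x)%:E)%E.
    rewrite integral_mkcond; apply: eq_integral => x _; rewrite !patchE.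
    by case: (x \in E); rewrite ?mulr0// mulrC.
  rewrite fineK//; exact: integrable_fin_num.
have h0 x : (0 <= ((g \_ E) x + U)%:E)%E.
  by rewrite lee_fin; have := restrict_norm_le x; rewrite ler_norml => /andP[]; lra.
have mh : measurable_fun setT (fun x => ((g \_ E) x + U)%:E).
  by apply/measurable_EFinP; exact: measurable_funD.
rewrite (int_density mp p0 (fun A _ => piE A) mh h0).
transitivity (\int[leb]_x ((p x * (g \_ E) x)%:E + U%:E * (p x)%:E))%E.
  by apply: eq_integral => x _; rewrite -!EFinM -EFinD; congr EFin; ring.
rewrite integralD// -mnE EFinD; congr (_ + _)%E.
rewrite (ge0_intZl _ measurableT _ _ U0); [|exact/measurable_EFinP|by move=> x; rewrite lee_fin].
by case: dp => _ _ ->; rewrite mule1.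
Qed.

Lemma mean_on_norm_le : `|mean_on E p g| <= U.
Proof.
have mh : measurable_fun setT (fun x => ((g \_ E) x + U)%:E).
  by apply/measurable_EFinP; apply: measurable_funD => //; exact: measurable_restrictE.
have rn := restrict_norm_le.
have l : 0 <= mean_on E p g + U.
  rewrite -lee_fin -int_restrict_mean; apply: integral_ge0 => x _.
  by rewrite lee_fin; have := rn x; rewrite ler_norml => /andP[]; lra.
have u : mean_on E p g + U <= 2 * U.
  rewrite -lee_fin -int_restrict_mean -[leRHS](int_cst pi).
  apply: (ge0_int_le pi measurableT) => // x; rewrite lee_fin; have := rn x; rewrite ler_norml => /andP[]; lra.
by rewrite ler_norml; apply/andP; split; lra.
Qed.

Lemma int_centred_shift :
  (\int[pi]_x ((g \_ E) x - mean_on E p g + 2 * U)%:E = (2 * U)%:E)%E.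
Proof.
have mh : measurable_fun setT (fun x => ((g \_ E) x + U)%:E).
  by apply/measurable_EFinP; apply: measurable_funD => //; exact: measurable_restrictE.
have mn := mean_on_norm_le; have c0 : 0 <= U - mean_on E p g by move: mn; rewrite ler_norml => /andP[]; lra.
transitivity (\int[pi]_x (((g \_ E) x + U)%:E + (U - mean_on E p g)%:E))%E.
  by apply: eq_integral => x _; rewrite -EFinD; congr EFin; ring.
rewrite (ge0_intD pi measurableT mh _ (measurable_cst _)); last 2 first.
- by move=> x; rewrite lee_fin; have := restrict_norm_le x; rewrite ler_norml => /andP[]; lra.
- by move=> x; rewrite lee_fin.
rewrite int_restrict_mean int_cst -EFinD; congr EFin; ring.
Qed.

End bounded_density_mean.

Section countable_supremum.
Context (R : realType) (d : nat) (dO : measure_display) (Omega : measurableType dO).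
Local Notation Rd := 'rV[R]_d.
Variables (E : set Rd) (p : Rd -> R) (e : nat -> Rd -> R) (X : nat -> Omega -> Rd).

(** The first [r] members of an enumeration of the class; every estimate is uniform in [r]. *)
Definition centred_row r (x : Rd) : 'rV[R]_r := \row_(i < r) ((e i \_ E) x - mean_on E p (e i)).

Lemma psum_centred_row r n w (i : 'I_r) : psum X (centred_row r) 0 n w ord0 i =
  \sum_(1 <= j < n.+1) ((e i \_ E) (X j w) - mean_on E p (e i)).
Proof. by rewrite /psum summxE; apply: eq_bigr => j _; rewrite mxE. Qed.

Local Notation dev := (sup_deviation E p (range e) X).
Local Notation nr r n w := (row_norm (psum X (centred_row r) 0 n w)).

Lemma le_row_norm_psum r n w : ((nr r n w)%:E <= dev n w)%E.
Proof.
have d0 : (0 <= dev n w)%E.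
  apply: (@le_trans _ _ (`|\sum_(1 <= j < n.+1) ((e 0%N \_ E) (X j w) - mean_on E p (e 0%N))|)%:E).
    by rewrite lee_fin.
  by apply: ereal_sup_ubound; exists (e 0%N) => //; exists 0%N.
have h i : ((`|psum X (centred_row r) 0 n w ord0 i|)%:E <= dev n w)%E.
  by rewrite psum_centred_row; apply: ereal_sup_ubound; exists (e i) => //; exists i.
move: d0 h; case: (dev n w) => [y| |]; last by rewrite leeNy_eq.
  rewrite !lee_fin => y0 h; apply: row_norm_le => // i.
by move=> _ _; rewrite leey.
Qed.

Lemma row_norm_psum_nd n w : {homo (fun r => (nr r n w)%:E) : r s / (r <= s)%N >-> (r <= s)%E}.
Proof.
move=> r s rs; rewrite lee_fin; apply: row_norm_le => [|i]; first exact: row_norm_ge0.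
rewrite psum_centred_row -(psum_centred_row n w (widen_ord rs i)).
exact: ler_row_norm.
Qed.

Lemma sup_deviation_limn n w : dev n w = limn (fun r => (nr r n w)%:E).
Proof.
have cv := ereal_nondecreasing_cvgn (@row_norm_psum_nd n w).
rewrite (cvg_lim _ cv)//; apply/eqP; rewrite eq_le; apply/andP; split; last first.
  by apply: ge_ereal_sup => _ [r _ <-]; exact: le_row_norm_psum.
apply: ge_ereal_sup => _ [_ [i _ <-] <-].
apply: (@le_trans _ _ (nr i.+1 n w)%:E); last by apply: ereal_sup_ubound; exists i.+1.
by rewrite lee_fin -(psum_centred_row n w (ord_max : 'I_i.+1)); exact: ler_row_norm.
Qed.

Section probability.
Variable P : probability Omega R.
Hypothesis mN : forall r n, measurable_fun setT (fun w => nr r n w).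

Lemma int_sup_deviation_le n (c : \bar R) :
  (forall r, \int[P]_w (nr r n w)%:E <= c)%E -> (\int[P]_w dev n w <= c)%E.
Proof.
move=> h; under eq_integral do rewrite sup_deviation_limn.
have mNE r : measurable_fun setT (fun w => (nr r n w)%:E) by exact/measurable_EFinP.
have N0 r w : (0 <= (nr r n w)%:E)%E by rewrite lee_fin row_norm_ge0.
rewrite (ge0_int_limn P measurableT mNE N0 (@row_norm_psum_nd n)).
apply: lime_le; last by apply: nearW.
apply: ereal_nondecreasing_is_cvgn => r s rs.
by apply: (ge0_int_le P measurableT) => // w; exact: row_norm_psum_nd.
Qed.

(** The events that the first [r] members exceed [y] increase to the complement of the event
    considered, so a bound uniform in [r] survives the limit. *)
Lemma sup_deviation_tail n (y de : R) :
  (forall r, P [set w | (y < nr r n w)%R] <= de%:E)%E ->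
  ((1 - de)%:E <= P [set w | (dev n w <= y%:E)%E])%E.
Proof.
move=> h.
have mF r : measurable [set w | y < nr r n w].
  have := mN r n measurableT (measurable_itv `]y, +oo[); rewrite setTI.
  by rewrite (_ : _ @^-1` _ = [set w | y < nr r n w])//; apply/seteqP; split => w; rewrite /= in_itv /= andbT.
have mU : measurable (\bigcup_r [set w | y < nr r n w]) by exact: bigcupT_measurable.
have -> : [set w | (dev n w <= y%:E)%E] = ~` (\bigcup_r [set w | y < nr r n w]).
  apply/seteqP; split => w /=.
    move=> dy [r _ /=]; rewrite ltNge => /negP; apply.
    by rewrite -lee_fin; apply: le_trans dy; exact: le_row_norm_psum.
  move=> hn; rewrite sup_deviation_limn; apply: lime_le.
    by apply: ereal_nondecreasing_is_cvgn; exact: row_norm_psum_nd.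
  apply: nearW => r; rewrite lee_fin leNgt; apply/negP => yr; apply: hn; by exists r.
rewrite probability_setC// EFinB; apply: leeB => //.
have nd : nondecreasing_seq (fun r => [set w | y < nr r n w]).
  move=> r s rs; apply/subsetPset => w /= yr; apply: (lt_le_trans yr).
  by rewrite -lee_fin; exact: row_norm_psum_nd.
have cv := nondecreasing_cvg_mu (mu := P) mF mU nd.
rewrite -(cvg_lim _ cv)//; apply: lime_le; first by apply/cvg_ex; eexists; exact: cv.
by apply: nearW => r; exact: h.
Qed.

End probability.
End countable_supremum.

(** * The split Metropolis-Hastings chain and its centred blocks *)

Section mh_split_chain.
Context (R : realType) (d : nat).
Local Notation Rd := 'rV[R]_d.
Variables (p : Rd -> R) (q : Rd -> Rd -> R) (b eps M : R).
Variables (nu : probability Rd R) (dO : measure_display) (Omega : measurableType dO).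
Variables (X : nat -> Omega -> Rd) (Pr : probability Rd R -> probability Omega R).
Variables (S : set Rd) (delta0 : R) (Psi : probability Rd R).
Variables (dO' : measure_display) (Omega' : measurableType dO').
Variables (Z : nat -> Omega' -> Rd * bool) (PZnu PZA : probability Omega' R).
Variable muA : probability (Rd * bool)%type R.
Local Notation E := (density_support p).
Local Notation A := (S `*` [set true]).
Local Notation split := (split_kernel (mh_kernel p q) S delta0 Psi).
Hypotheses (dp : density p) (pM : forall x, p x <= M) (bE : bounded_set E).
Hypothesis cE : convex_set (E : set (convex_lmodType Rd)).
Hypotheses (pq : proposal q) (b0 : 0 < b) (eps0 : 0 < eps).
Hypothesis hq : forall x y, b * \1_(eball x eps) y <= q x y.
Hypothesis MF : markov_family (mh_kernel p q) X Pr.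
Hypothesis XE : {ae Pr nu, forall w, forall n, E (X n w)}.
Hypotheses (SE : S `<=` E) (sm : small_set (mh_kernel p q) S delta0 Psi).
Hypothesis ret : (ereal_sup [set \int[Pr \d_x]_w return_time R X S w | x in S] < +oo)%E.
Hypothesis muA1 : muA A = 1%E.
Hypothesis MCnu : markov_chain PZnu split (nu \x bernoulli_prob delta0)%E Z.
Hypothesis MCA : markov_chain PZA split muA Z.

(** Gathers what the concentration argument takes from the chain. The number of steps and the
    constant of the minorization no longer appear, only the existence of geometric tails. *)
Lemma mh_split_chain : exists (pi : probability Rd R) (K : R.-fker (Rd * bool)%type ~> (Rd * bool)%type),
  [/\ forall B, pi B = (\int[lebesgue_row R d]_(y in B) (p y)%:E)%E,
      [/\ markov_chain PZnu (fun z => K z : set (Rd * bool) -> \bar R) (nu \x bernoulli_prob delta0)%E Z,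
          markov_chain PZA (fun z => K z : set (Rd * bool) -> \bar R) muA Z &
          forall x y B, A x -> A y -> measurable B -> K x B = K y B],
      exists c rho : R, [/\ 0 <= c, 0 < rho < 1 &
        forall n, (PZA (stays Z (~` A) 0 n) <= (c * rho ^+ n)%:E)%E /\
                  (PZnu (stays Z (~` A) 0 n) <= (c * rho ^+ n)%:E)%E],
      PZA (rt Z A @^-1` [set 0%N]) = 0%E -> exists2 kap : R, 0 < kap &
        forall (f : Rd -> \bar R) (L : R), measurable_fun setT f ->
        (forall x, 0 <= f x)%E -> (forall x, f x <= L%:E)%E ->
        (kap%:E * \int[PZA]_w \sum_(1 <= i < (rt Z A w).+1) f (Z i w).1 = \int[pi]_x f x)%E &
      forall r (g : Rd -> 'rV[R]_r), measurable_fun setT g ->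
        forall (phi : 'rV[R]_r -> \bar R) n, measurable_fun setT phi -> (forall s, 0 <= phi s)%E ->
        (\int[Pr nu]_w phi (psum X g 0 n w) =
         \int[PZnu]_w phi (psum Z (fun z => g z.1) 0 n w))%E].
Proof.
have [P [PE P1]] := mh_finite_kernel dp pq.
have mp : measurable_fun setT p by case: dp.
have p0 x : 0 <= p x by case: dp.
have p1 : (\int[lebesgue_row R d]_x (p x)%:E = 1)%E by case: dp.
have [pi piE] := density_probability mp p0 p1.
have PE' x B : measurable B -> mh_kernel p q x B = P x B by move=> mB; rewrite PE.
have MF' : markov_family (fun x => P x : set Rd -> \bar R) X Pr.
  by move=> mu; exact: markov_chain_ext PE' (MF mu).
have mE : measurable E := measurable_density_support p.
have mS : measurable S by case: sm.
have d0 : 0 < delta0 by case: sm.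
have d1 : delta0 <= 1 := small_set_le1 PE P1 sm.
have inv f (mf : measurable_fun setT f) (f0 : forall x, (0 <= f x)%E) := mh_invariant dp pq PE piE mf f0.
have piE0 : pi (~` E) = 0%E := density_supportC0 dp piE.
have pM1 x : p x <= Num.max M 1 by rewrite le_max pM.
have M1 : 0 < Num.max M 1 by rewrite lt_max ltr01 orbT.
have [m [c [c0 minor]]] := mh_minorization dp pq pM1 b0 eps0 hq PE piE bE cE M1.
have [x0 Sx0] := small_set_nonempty sm.
have ret' x : S x -> (\int[Pr \d_x]_w return_time R X S w < +oo)%E.
  move=> Sx; apply: le_lt_trans ret; apply: ereal_sup_ubound; by exists x.
have piS := recurrent_set_charged P1 MF' mS SE c0 inv minor ret' Sx0.
have [K [KE K1 Kprod KPsi KP]] := split_finite_kernel PE P1 sm.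
have KE' z C : measurable C -> split z C = K z C by move=> mC; rewrite KE.
have MKnu := markov_chain_ext KE' MCnu.
have MKA := markov_chain_ext KE' MCA.
have [Q QE] := taboo_kernel mS d0 d1 K1.
(* The mean under [nu] of the probability of being outside [E] at time [j] is the probability that
   [X j] is outside [E], which is 0. *)
have nu_core : nu (~` core P E) = 0%E.
  apply: null_coreC => // j.
  have MX := MF' nu.
  have mX n : measurable_fun setT (X n) by case: MX.
  have mEc := measurableC mE.
  have m1 : measurable_fun setT (fun y => (\1_(~` E) y)%:E : \bar R).
    by apply/measurable_EFinP; exact: measurable_indic.
  have i0 y : (0 <= (\1_(~` E) y)%:E :> \bar R)%E by rewrite lee_fin.
  have mT : measurable ([set: Omega] : set (hist X 0)) by exact: measurableT.
  have := @markov_stays _ _ _ _ _ _ P _ X MX setT setT 0 j _ measurableT mT m1 i0.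
  rewrite add0n setTI (_ : stays X setT 0 j = setT); last by apply/seteqP; split.
  rewrite (markov_init (f := iter j (kop P setT) (fun y => (\1_(~` E) y)%:E)) MX); last 2 first.
  - by apply: measurable_iter_pop.
  - exact: iter_pop_ge0.
  move=> <-.
  rewrite -[RHS](integral0 (Pr nu) setT).
  apply: ge0_ae_eq_integral => //.
  - exact: (measurableT_comp m1 (mX j)).
  case: XE => W [mW W0 hW]; exists W; split => // w /= h; apply: hW => /= hE; apply: h => _.
  by rewrite indicE memNset//= => /(_ (hE j)).
exists pi, K; split => //.
- split => // -[x1 x2] [y1 y2] B [/= Sx ->] [/= Sy ->] mB.
  have mpre (bb : bool) : measurable ((fun x : Rd => (x, bb)) @^-1` B).
    have mb : measurable_fun setT (fun x : Rd => (x, bb)) by exact: measurable_fun_pair.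
    by rewrite -[X in measurable X]setTI; exact: mb.
  by rewrite Kprod// [RHS]Kprod// !KPsi.
- exact: (geometric_tails P1 mS d0 d1 Kprod KPsi KP QE mE c0 inv minor piE0 piS nu_core MKnu muA1 MKA).
- move=> rt0; exists (delta0 * fine (pi S)).
    rewrite mulr_gt0// fine_gt0// lt0e piS measure_ge0/=.
    by rewrite (le_lt_trans (probability_le1 _ mS))// ltry.
  move=> f L mf f0 fL; rewrite EFinM fineK; last exact: fin_num_measure.
  exact: (int_block_sum P1 mS d0 d1 Kprod KPsi KP QE mE SE c0 inv minor piE0 piS muA1 MKA mf f0 fL rt0).
- move=> r g mg phi n mphi phi0.
  have := psum_law_transfer d0 d1 Kprod KP (MF' nu) MKnu mg n 0 mphi phi0.
  by under eq_integral do rewrite add0r; under [RHS]eq_integral do rewrite add0r.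
Qed.

End mh_split_chain.

Section centred_blocks.
Context (R : realType) (d : nat) (dO : measure_display) (Omega : measurableType dO).
Local Notation Rd := 'rV[R]_d.
Variables (p : Rd -> R) (pi : probability Rd R) (E : set Rd) (e : nat -> Rd -> R) (U : R).
Hypotheses (dp : density p) (piE : forall B, pi B = (\int[lebesgue_row R d]_(y in B) (p y)%:E)%E).
Hypotheses (mE : measurable E) (me : forall i, measurable_fun E (e i)).
Hypotheses (eU : forall i x, E x -> `|e i x| <= U) (U0 : 0 < U).

Let U0' : 0 <= U. Proof. exact: ltW. Qed.
Let mr i : measurable_fun setT (e i \_ E). Proof. exact: measurable_restrictE. Qed.
Let rn i x : `|(e i \_ E) x| <= U. Proof. by apply: restrict_norm_le => // y; exact: eU. Qed.
Let mn i : `|mean_on E p (e i)| <= U.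
Proof. exact: (mean_on_norm_le dp piE mE (me i) (eU i) U0'). Qed.

Lemma measurable_centred_row r : measurable_fun setT (centred_row E p e r).
Proof.
apply: measurable_fun_row => i.
under eq_fun do rewrite mxE.
by apply: measurable_funB => //; exact: measurable_cst.
Qed.

Lemma row_norm_centred_row r x : row_norm (centred_row E p e r x) <= 2 * U.
Proof.
apply: row_norm_le => [|i]; first by rewrite mulr_ge0.
rewrite mxE (le_trans (ler_normB _ _))//.
by have := rn i x; have := mn i; lra.
Qed.

Lemma measurable_row_norm_psum (X : nat -> Omega -> Rd) r n :
  (forall n, measurable_fun setT (X n)) ->
  measurable_fun setT (fun w => row_norm (psum X (centred_row E p e r) 0 n w)).
Proof.
move=> mX; apply: measurableT_comp; first exact: measurable_row_norm.
apply: measurable_fun_row => i; under eq_fun do rewrite psum_centred_row.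
apply: measurable_sum => j; apply: measurable_funB; last exact: measurable_cst.
exact: (measurableT_comp (mr i) (mX j)).
Qed.

Variables (A : set (Rd * bool)) (Z : nat -> Omega -> Rd * bool).
Local Notation gz r := (fun z : Rd * bool => centred_row E p e r z.1).

Lemma rademacher_centred_blocks (G : set (Rd -> R)) (C v : R) r (l : seq Omega) :
  vc_class E G U C v -> E !=set0 -> (forall i, G (e i)) ->
  ravg (map (block A Z (gz r)) l) (@row_norm R r) 0 <=
    U * chain_const C v * Num.sqrt (\sum_(w <- l) (rt Z A w)%:R ^+ 2).
Proof.
move=> GVC E0 Ge.
pose bs := [seq [seq (Z j w).1 | j <- index_iota 1 (rt Z A w).+1] | w <- l].
have := @rademacher_blocks _ _ _ _ _ _ _ _ mE GVC U0 E0 r (fun i => e i) (fun i => mean_on E p (e i)) bs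
  (fun i => Ge i) (fun i => mn i).
rewrite /bs -map_comp big_map.
congr (_ <= _).
  congr (ravg _ _ _); apply: eq_map => w /=; apply/rowP => i.
  by rewrite mxE big_map /block /psum summxE; apply: eq_bigr => j _; rewrite mxE.
congr (_ * Num.sqrt _); apply: eq_bigr => w _.
by rewrite size_map size_iota subn1.
Qed.

Variables (PA : probability Omega R) (kap : R).
Hypothesis kap0 : 0 < kap.
Hypothesis kac : forall (f : Rd -> \bar R) (L : R), measurable_fun setT f ->
  (forall x, 0 <= f x)%E -> (forall x, f x <= L%:E)%E ->
  (kap%:E * \int[PA]_w \sum_(1 <= i < (rt Z A w).+1) f (Z i w).1 = \int[pi]_x f x)%E.
Hypothesis mrt : forall h : nat -> R, measurable_fun setT (fun w => h (rt Z A w)).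
Hypothesis mbl : forall r, measurable_fun setT (block A Z (gz r)).

(** Kac's formula is available for nonnegative bounded functions only. It is applied to the centred
    function shifted by [2 * U] and to the constant [2 * U]; both block sums have mean
    [2 * U / kap], and the block is their difference. *)
Lemma block_centred r i : PA.-integrable setT (fun w => (block A Z (gz r) w ord0 i)%:E) /\
  (\int[PA]_w (block A Z (gz r) w ord0 i)%:E = 0)%E.
Proof.
have blE w : block A Z (gz r) w ord0 i =
    \sum_(1 <= j < (rt Z A w).+1) ((e i \_ E) (Z j w).1 - mean_on E p (e i)).
  by rewrite /block /psum summxE; apply: eq_bigr => j _; rewrite mxE.
have mb : measurable_fun setT (fun w => block A Z (gz r) w ord0 i).
  exact: (measurableT_comp (@measurable_row_coord R r i) (@mbl r)).
pose f x := (e i \_ E) x - mean_on E p (e i) + 2 * U.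
have f0 x : 0 <= f x.
  by rewrite /f; have := rn i x; have := mn i; rewrite !ler_norml => /andP[? ?] /andP[? ?]; lra.
have fL x : f x <= 4 * U.
  by rewrite /f; have := rn i x; have := mn i; rewrite !ler_norml => /andP[? ?] /andP[? ?]; lra.
have mf : measurable_fun setT f.
  apply: measurable_funD; last exact: measurable_cst.
  by apply: measurable_funB => //; exact: measurable_cst.
pose F w := block A Z (gz r) w ord0 i + 2 * U * (rt Z A w)%:R.
have FE w : F w = \sum_(1 <= j < (rt Z A w).+1) f (Z j w).1.
  rewrite /F blE [RHS]big_split/=; congr (_ + _).
  by rewrite big_const_nat iter_addr addr0 subn1 mulr_natr.
have F0 w : 0 <= F w by rewrite FE; apply: sumr_ge0.
have mF : measurable_fun setT F.
  by apply: measurable_funD => //; exact: (mrt (fun n => 2 * U * n%:R)).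
have cancel x y : (kap%:E * x = y%:E)%E -> x = (y / kap)%:E.
  move=> h; have <- : (kap^-1%:E * (kap%:E * x) = x)%E.
    by rewrite muleA -EFinM mulVf ?lt0r_neq0// mul1e.
  by rewrite h -EFinM mulrC.
have iF : (\int[PA]_w (F w)%:E = ((2 * U) / kap)%:E)%E.
  apply: cancel; have := @kac (fun x => (f x)%:E) (4 * U) _ _ _.
  rewrite (int_centred_shift dp piE mE (me i) (eU i) U0') => <-//.
  - by congr (_ * _)%E; apply: eq_integral => w _; rewrite FE sumEFin.
  - exact/measurable_EFinP.
have iR : (\int[PA]_w (2 * U * (rt Z A w)%:R)%:E = ((2 * U) / kap)%:E)%E.
  apply: cancel; have := @kac (fun x => (2 * U)%:E) (2 * U) _ _ _.
  rewrite int_cst => <-//.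
    congr (_ * _)%E; apply: eq_integral => w _; rewrite sumEFin; congr EFin.
    by rewrite big_const_nat iter_addr addr0 subn1 mulr_natr.
  by move=> _; rewrite lee_fin mulr_ge0.
have mR : measurable_fun setT (fun w => 2 * U * (rt Z A w)%:R) by exact: (mrt (fun n => 2 * U * n%:R)).
have gF : PA.-integrable setT (fun w => (F w)%:E).
  apply/integrableP; split; first exact/measurable_EFinP.
  by under eq_integral do rewrite gee0_abs ?lee_fin//; rewrite iF ltry.
have gR : PA.-integrable setT (fun w => (2 * U * (rt Z A w)%:R)%:E).
  apply/integrableP; split; first exact/measurable_EFinP.
  by under eq_integral do rewrite gee0_abs ?lee_fin ?mulr_ge0//; rewrite iR ltry.
have bE w : ((block A Z (gz r) w ord0 i)%:E = (F w)%:E - (2 * U * (rt Z A w)%:R)%:E)%E.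
  by rewrite -EFinB /F addrK.
under eq_integral do rewrite bE.
split; last by rewrite integralB_EFin// iF iR -EFinB subrr.
by under eq_fun do rewrite bE; exact: integrableB.
Qed.

End centred_blocks.

Section mh_sup_deviation.
Context (R : realType) (d : nat).
Local Notation Rd := 'rV[R]_d.
Variables (p : Rd -> R) (q : Rd -> Rd -> R) (b eps M : R).
Variables (nu : probability Rd R) (dO : measure_display) (Omega : measurableType dO).
Variables (X : nat -> Omega -> Rd) (Pr : probability Rd R -> probability Omega R).
Variables (S : set Rd) (delta0 : R) (Psi : probability Rd R).
Variables (dO' : measure_display) (Omega' : measurableType dO').
Variables (Z : nat -> Omega' -> Rd * bool) (PZnu PZA : probability Omega' R).
Variable muA : probability (Rd * bool)%type R.
Local Notation E := (density_support p).
Local Notation A := (S `*` [set true]).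
Local Notation split := (split_kernel (mh_kernel p q) S delta0 Psi).
Hypotheses (dp : density p) (pM : forall x, p x <= M) (bE : bounded_set E).
Hypothesis cE : convex_set (E : set (convex_lmodType Rd)).
Hypotheses (pq : proposal q) (b0 : 0 < b) (eps0 : 0 < eps).
Hypothesis hq : forall x y, b * \1_(eball x eps) y <= q x y.
Hypothesis MF : markov_family (mh_kernel p q) X Pr.
Hypothesis XE : {ae Pr nu, forall w, forall n, E (X n w)}.
Hypotheses (SE : S `<=` E) (sm : small_set (mh_kernel p q) S delta0 Psi).
Hypothesis ret : (ereal_sup [set \int[Pr \d_x]_w return_time R X S w | x in S] < +oo)%E.
Hypothesis muA1 : muA A = 1%E.
Hypothesis MCnu : markov_chain PZnu split (nu \x bernoulli_prob delta0)%E Z.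
Hypothesis MCA : markov_chain PZA split muA Z.
Local Notation tauA := (return_time R Z A).

(** Kept apart so that everything after it holds for any geometric bound, in particular for one
    selected from the tails alone. *)
Lemma regeneration_tails : exists c rho : R, [/\ 0 <= c, 0 < rho < 1 &
  forall n, (tail PZA tauA n <= (c * rho ^+ n)%:E)%E /\
            (tail PZnu tauA n <= (c * rho ^+ n)%:E)%E].
Proof.
have [pi [K [_ _ [c [rho [c0 r01 h]]] _ _]]] := mh_split_chain dp pM bE cE pq b0 eps0 hq MF XE SE sm ret muA1 MCnu MCA.
by exists c, rho; split => // n; rewrite !tail_stays.
Qed.

Variables (c rho : R).
Hypotheses (c0 : 0 <= c) (rho01 : 0 < rho < 1).
Hypothesis tails : forall n, (tail PZA tauA n <= (c * rho ^+ n)%:E)%E /\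
  (tail PZnu tauA n <= (c * rho ^+ n)%:E)%E.

Let tailA n : (PZA (stays Z (~` A) 0 n) <= (c * rho ^+ n)%:E)%E.
Proof. by rewrite -(@tail_stays _ _ _ _ _ _ R); case: (tails n). Qed.
Let tailnu n : (PZnu (stays Z (~` A) 0 n) <= (c * rho ^+ n)%:E)%E.
Proof. by rewrite -(@tail_stays _ _ _ _ _ _ R); case: (tails n). Qed.

Let mA : measurable A.
Proof. by apply: measurableX => //; case: sm. Qed.
Let mZ n : measurable_fun setT (Z n). Proof. by case: MCA. Qed.

Let null : PZA (rt Z A @^-1` [set 0%N]) = 0%E.
Proof.
apply: (null_never (measurable_rt mA mZ) rho01 (c := c)) => n.
by rewrite rt_gtE; exact: tailA.
Qed.

Local Notation m1 := (block_m1 A Z PZA).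
Local Notation m2 := (block_m2 A Z PZA).

Lemma regeneration_moments : [/\ 1 <= m1 <= mean_bound c rho, 1 <= m2 <= sqr_bound c rho, 0 < exp_radius c rho,
  (\int[PZA]_w tauA w = m1%:E)%E & (\int[PZA]_w (tauA w ^+ 2) = m2%:E)%E].
Proof.
have [pi [K [_ [MKnu MKA atom] _ _ _]]] := mh_split_chain dp pM bE cE pq b0 eps0 hq MF XE SE sm ret muA1 MCnu MCA.
have mR h : measurable_fun setT (fun w => (h (rt Z A w))%:E : \bar R).
  by apply/measurable_EFinP; exact: (measurable_rtR mA MKA h).
have mtau : measurable_fun setT (fun w => tauA w).
  under eq_fun do rewrite return_timeE.
  have m0 : measurable_fun setT (fun w => rt Z A w == 0%N).
    apply: (measurable_fun_bool true).
    rewrite setTI (_ : _ @^-1` _ = rt Z A @^-1` [set 0%N]); first exact: (measurable_rt mA mZ).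
    by apply/seteqP; split => w /= /eqP.
  exact: (measurable_fun_ifT m0 (measurable_cst _) (mR (fun n => n%:R))).
have tau0 w : (0 <= tauA w)%E.
  by rewrite return_timeE; case: ifP => // _; rewrite ?leey// lee_fin.
split.
- by rewrite (block_m1_ge1 mA MKA c0 rho01 tailA) (block_m1_le mA MKA c0 rho01 tailA).
- by rewrite (block_m2_ge1 mA MKA c0 rho01 tailA) (block_m2_le mA MKA c0 rho01 tailA).
- have tA n : (PZA [set w | rt Z A w = 0%N \/ (n < rt Z A w)%N] <= (c * rho ^+ n)%:E)%E.
    by rewrite rt_gtE; exact: tailA.
  have X1 := exp_bound_ge1 (measurable_rt mA mZ) c0 rho01 tA.
  have y0 := tail_rate_gt0 rho01.
  by rewrite lt_min y0 divr_gt0// ?exprn_gt0// (lt_le_trans ltr01 X1).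
- rewrite -(block_m1E mA MKA c0 rho01 tailA).
  apply: ge0_ae_eq_integral => //.
  apply: (rt_pos_ae mA MKA null) => w r0 _.
  by rewrite return_timeE gtn_eqF.
- rewrite -(block_m2E mA MKA c0 rho01 tailA).
  apply: ge0_ae_eq_integral => //.
  + exact: emeasurable_funM.
  + exact: (mR (fun n => n%:R ^+ 2)).
  + by move=> w _; exact: mule_ge0.
  apply: (rt_pos_ae mA MKA null) => w r0 _.
  by rewrite return_timeE gtn_eqF.
Qed.

Variables (e : nat -> Rd -> R) (U C v : R).
Hypotheses (U0 : 0 < U) (E0 : E !=set0) (GVC : vc_class E (range e) U C v).
Local Notation D1 := (rate_const (U * chain_const C v) U c rho).
Local Notation dev := (sup_deviation E p (range e) X).

Let mE : measurable E. Proof. exact: measurable_density_support. Qed.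
Let me i : measurable_fun E (e i).
Proof. by case: GVC => _ /(_ (e i)) h _ _ _; case: h => //; exists i. Qed.
Let eU i x : E x -> `|e i x| <= U.
Proof. by case: GVC => _ /(_ (e i)) h _ _ _; case: h => [|_]; [exists i | exact]. Qed.
Let mX n : measurable_fun setT (X n). Proof. by case: (MF nu). Qed.
Let cr r := centred_row E p e r.
Let mcr r : measurable_fun setT (cr r).
Proof.
have [pi [K [piE _ _ _ _]]] := mh_split_chain dp pM bE cE pq b0 eps0 hq MF XE SE sm ret muA1 MCnu MCA.
exact: (@measurable_centred_row _ _ p _ _ mE me r).
Qed.
Let mN r n : measurable_fun setT (fun w => row_norm (psum X (cr r) 0 n w)).
Proof. exact: (measurable_row_norm_psum p mE me r n mX). Qed.
Let crU r x : row_norm (cr r x) <= 2 * U.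
Proof.
have [pi [K [piE _ _ _ _]]] := mh_split_chain dp pM bE cE pq b0 eps0 hq MF XE SE sm ret muA1 MCnu MCA.
exact: (row_norm_centred_row dp piE mE me eU U0).
Qed.
Let Kc0 : 0 <= U * chain_const C v.
Proof. by rewrite mulr_ge0 ?(ltW U0)//; exact: (chain_const_ge0 GVC). Qed.

Lemma int_sup_deviation_rate n : (0 < n)%N ->
  (\int[Pr nu]_w dev n w <= (D1 * Num.sqrt n%:R)%:E)%E.
Proof.
move=> n0.
have [pi [K [piE [MKnu MKA atom] _ /(_ null)[kap kap0 kac] transfer]]] :=
  mh_split_chain dp pM bE cE pq b0 eps0 hq MF XE SE sm ret muA1 MCnu MCA.
apply: (int_sup_deviation_le mN) => r.
have mg : measurable_fun setT (fun z : Rd * bool => cr r z.1) by exact: (measurableT_comp (@mcr r) measurable_fst).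
rewrite (transfer r (cr r) (@mcr r) (fun s => (row_norm s)%:E) n)//; last 2 first.
- by apply/measurable_EFinP; exact: measurable_row_norm.
- by move=> s; rewrite lee_fin row_norm_ge0.
apply: (int_row_norm_le mA muA1 atom MKA MKnu mg U0 _ Kc0 c0 rho01 tailA tailnu _ _ n0).
- by move=> z; exact: crU.
- move=> l; apply: (rademacher_centred_blocks dp piE mE me eU U0 _ _ r l GVC E0) => i; by exists i.
- move=> i; apply: (block_centred dp piE mE me eU U0 kap0 kac (measurable_rtR mA MKA)) => r'.
  apply: (measurable_block mA MKA).
  exact: (measurableT_comp (@mcr r') measurable_fst).
Qed.

Lemma sup_deviation_concentration n t y : (0 < n)%N -> 0 < t ->
  D1 * Num.sqrt n%:R + Num.max (Num.sqrt (128 * U ^+ 2 * m2 * n%:R * t))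
    (8 * U * t / exp_radius c rho) <= y ->
  ((1 - expR (- t))%:E <= Pr nu [set w | (dev n w <= y%:E)%E])%E.
Proof.
move=> n0 t0; set y1 := D1 * _ + _ => y1y.
have [pi [K [piE [MKnu MKA atom] _ /(_ null)[kap kap0 kac] transfer]]] :=
  mh_split_chain dp pM bE cE pq b0 eps0 hq MF XE SE sm ret muA1 MCnu MCA.
apply: (sup_deviation_tail mN) => r.
have mg : measurable_fun setT (fun z : Rd * bool => cr r z.1) by exact: (measurableT_comp (@mcr r) measurable_fst).
pose V z : set 'rV[R]_r := [set s | z < row_norm s].
have mV z : measurable (V z).
  have := @measurable_row_norm R r measurableT _ (measurable_itv `]z, +oo[); rewrite setTI.
  by rewrite (_ : _ @^-1` _ = V z)//; apply/seteqP; split => s; rewrite /= in_itv /= andbT.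
have mpre d' (T : measurableType d') (f : T -> 'rV[R]_r) z : measurable_fun setT f -> measurable (f @^-1` V z).
  by move=> mf; rewrite -[X in measurable X]setTI; exact: mf.
have mpX : measurable_fun setT (psum X (cr r) 0 n).
  have [P [PE _]] := mh_finite_kernel dp pq.
  have PE' x B : measurable B -> mh_kernel p q x B = P x B by move=> mB; rewrite PE.
  exact: (measurable_psum (markov_chain_ext PE' (MF nu)) (@mcr r)).
have mpZ := measurable_psum MKnu mg 0 n.
suff h : (Pr nu (psum X (cr r) 0 n @^-1` V y) <= (expR (- t))%:E)%E by exact: h.
have := transfer r (cr r) (@mcr r) (fun s => (\1_(V y) s)%:E) n _ _.
rewrite (integral_ind _ (mpre _ _ _ _ mpX)) => ->; last 2 first.
- by apply/measurable_EFinP; exact: measurable_indic.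
- by move=> s; rewrite lee_fin.
rewrite [leLHS](integral_ind _ (mpre _ _ _ _ mpZ)).
apply: (le_trans (le_meas _ (mpre _ _ _ y mpZ) (mpre _ _ _ y1 mpZ) _)) => [w|]; first exact: le_lt_trans.
apply: (row_norm_deviation mA muA1 atom MKA MKnu mg U0 _ Kc0 c0 rho01 tailA tailnu _ _ n0 t0).
- by move=> z; exact: crU.
- move=> l; apply: (rademacher_centred_blocks dp piE mE me eU U0 _ _ r l GVC E0) => i; by exists i.
- move=> i; apply: (block_centred dp piE mE me eU U0 kap0 kac (measurable_rtR mA MKA)) => r'.
  apply: (measurable_block mA MKA).
  exact: (measurableT_comp (@mcr r') measurable_fst).
Qed.

Lemma sup_deviation1_le w : (dev 1 w <= (2 * U)%:E)%E.
Proof.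
rewrite sup_deviation_limn; apply: lime_le.
  by apply: ereal_nondecreasing_is_cvgn => r s rs; exact: row_norm_psum_nd.
by apply: nearW => r; rewrite lee_fin /psum big_nat1; exact: crU.
Qed.

End mh_sup_deviation.

(** * Final constants and the theorem *)

Section constants.
Context (R : realType).

(* [xget] returns the junk value (1, 1/2) if no geometric bound exists. *)
Definition tail_bound (tA tnu : nat -> \bar R) : R * R :=
  xget (1, 2^-1) [set cr | [/\ 0 <= cr.1, 0 < cr.2 < 1 &
    forall n, (tA n <= (cr.1 * cr.2 ^+ n)%:E)%E /\ (tnu n <= (cr.1 * cr.2 ^+ n)%:E)%E]].

(** The added [2 * U] covers [n = 1], where a deterministic bound is used. *)
Definition deviation_const (v C U : R) (tA tnu : nat -> \bar R) : R :=
  let: (c, rho) := tail_bound tA tnu in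
  rate_const (U * chain_const C v) U c rho + 2 * U.

(** For [n >= 2] it gives [8 * m1 / exp_radius <= tau * ln 2 <= tau ^+ 3 * ln n], where [m1] is the
    mean regeneration time, at most [mean_bound]; this produces the division by that mean in the
    statement. The absolute value keeps it positive at junk values. *)
Definition deviation_tau (tA tnu : nat -> \bar R) : R :=
  let: (c, rho) := tail_bound tA tnu in
  1 + `|8 * mean_bound c rho / (exp_radius c rho * ln 2)|.

Definition loglog_rate (n : nat) : R := Num.sqrt (n%:R * Num.max 1 (ln (ln n%:R))).

Lemma sqrt_le_loglog_rate n : Num.sqrt n%:R <= loglog_rate n.
Proof. by rewrite ler_wsqrtr// ler_peMr// le_max lexx. Qed.

Lemma tail_bound_le tA tnu :
  (exists c rho : R, [/\ 0 <= c, 0 < rho < 1 & forall n,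
     (tA n <= (c * rho ^+ n)%:E)%E /\ (tnu n <= (c * rho ^+ n)%:E)%E]) ->
  [/\ 0 <= (tail_bound tA tnu).1, 0 < (tail_bound tA tnu).2 < 1 & forall n,
    (tA n <= ((tail_bound tA tnu).1 * (tail_bound tA tnu).2 ^+ n)%:E)%E /\
    (tnu n <= ((tail_bound tA tnu).1 * (tail_bound tA tnu).2 ^+ n)%:E)%E].
Proof.
by move=> [c [rho h]]; apply: (@xgetPex _ _ [set cr : R * R | [/\ 0 <= cr.1, 0 < cr.2 < 1 &
  forall n, (tA n <= (cr.1 * cr.2 ^+ n)%:E)%E /\ (tnu n <= (cr.1 * cr.2 ^+ n)%:E)%E]]); exists (c, rho).
Qed.

Lemma exponential_term_le (tau U C2 er m1 t : R) (n : nat) : 0 < U -> 0 < er -> 0 <= t ->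
  1 <= m1 <= C2 -> (1 < n)%N -> tau = 1 + `|8 * C2 / (er * ln 2)| ->
  8 * U * t / er <= t * (tau ^+ 3 * U * ln n%:R / m1).
Proof.
move=> U0 er0 t0 /andP[m11 mC] n1 tauE.
have l2 : 0 < ln 2 :> R by rewrite ln_gt0// ltr1n.
have ln2 : ln 2 <= ln n%:R :> R by rewrite ler_ln ?posrE ?ltr0n ?ler_nat//; lia.
have tau1 : 1 <= tau by rewrite tauE lerDl.
have m0 : 0 < m1 := lt_le_trans ltr01 m11.
have h1 : 8 * m1 / er <= tau * ln 2.
  apply: (@le_trans _ _ (8 * C2 / er)).
    by rewrite ler_wpM2r ?invr_ge0 ?(ltW er0)// ler_wpM2l.
  rewrite -ler_pdivrMr// tauE -[leLHS]addr0 addrC lerD//.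
  by apply: le_trans (ler_norm _); rewrite invfM mulrA.
have h2 : tau * ln 2 <= tau ^+ 3 * ln n%:R.
  apply: ler_pM => //; [lra|exact: ltW|].
  by rewrite exprS ler_peMr ?(le_trans ler01)// exprn_ege1.
have -> : 8 * U * t / er = t * U * (8 * m1 / er / m1) by field; rewrite !gt_eqF.
have -> : t * (tau ^+ 3 * U * ln n%:R / m1) = t * U * (tau ^+ 3 * ln n%:R / m1) by ring.
rewrite ler_wpM2l ?mulr_ge0 ?(ltW U0)// ler_wpM2r ?invr_ge0 ?(ltW m0)//.
exact: le_trans h1 h2.
Qed.

Lemma rate_const_ge0 (Kc U c rho : R) : 0 <= Kc -> 0 <= U -> 0 <= sqr_bound c rho ->
  0 <= mean_bound c rho -> 0 <= rate_const Kc U c rho.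
Proof.
move=> Kc0 U0 Q0 M0; rewrite /rate_const.
have h x : 0 <= x -> 0 <= 2 * U * x by move=> x0; rewrite !mulr_ge0.
by rewrite addr_ge0 ?h// addr_ge0 ?h// !mulr_ge0// sqrtr_ge0.
Qed.

End constants.

Lemma countable_range (T : choiceType) (G : set T) : countable G -> G !=set0 ->
  exists e : nat -> T, G = range e.
Proof.
move=> /countable_injP[f finj] [g0 Gg0].
exists (fun n => xget g0 [set g | G g /\ f g = n]); apply/seteqP; split => [g Gg|_ [n _ <-]].
  exists (f g) => //; case: xgetP => [h _ [Gh]|/(_ g)]; last by case.
  by move=> /finj; apply; exact: mem_set.
by case: xgetP => [h _ []|].
Qed.

Theorem proposition11 (R : realType) :
  exists K : R, 0 < K /\
  exists (D : R -> R -> R -> (nat -> \bar R) -> (nat -> \bar R) -> R)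
         (tau : (nat -> \bar R) -> (nat -> \bar R) -> R),
  (forall tA tnu, 0 < tau tA tnu) /\
  forall (d : nat) (E : set 'rV[R]_d) (p : 'rV[R]_d -> R)
    (q : 'rV[R]_d -> 'rV[R]_d -> R) (b eps : R)
    (nu : probability 'rV[R]_d R)
    (dO : measure_display) (Omega : measurableType dO)
    (X : nat -> Omega -> 'rV[R]_d)
    (Pr : probability 'rV[R]_d R -> probability Omega R)
    (S : set 'rV[R]_d) (delta0 : R) (Psi : probability 'rV[R]_d R)
    (dO' : measure_display) (Omega' : measurableType dO')
    (Z : nat -> Omega' -> 'rV[R]_d * bool)
    (PZnu PZA : probability Omega' R)
    (muA : probability ('rV[R]_d * bool)%type R)
    (G : set ('rV[R]_d -> R)) (U C v : R),
  (0 < d)%N ->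
  density p -> (exists M, forall x, p x <= M) ->
  E = density_support p ->
  bounded_set E -> convex_set (E : set (convex_lmodType 'rV[R]_d)) ->
  interior E !=set0 ->
  proposal q -> 0 < b -> 0 < eps ->
  (forall x y, b * \1_(eball x eps) y <= q x y) ->
  nu E = 1%E ->
  markov_family (mh_kernel p q) X Pr ->
  {ae Pr nu, forall w, forall n, E (X n w)} ->
  S `<=` E ->
  small_set (mh_kernel p q) S delta0 Psi ->
  (ereal_sup [set \int[Pr \d_x]_w return_time R X S w | x in S] < +oo)%E ->
  (\int[Pr nu]_w return_time R X S w < +oo)%E ->
  let A := S `*` [set true] in
  muA A = 1%E ->
  let split := split_kernel (mh_kernel p q) S delta0 Psi in
  markov_chain PZnu split (nu \x bernoulli_prob delta0)%E Z ->
  markov_chain PZA split muA Z ->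
  let tauA := return_time R Z A in
  let tA := tail PZA tauA in
  let tnu := tail PZnu tauA in
  let EA1 := (\int[PZA]_w tauA w)%E in
  let EA2 := (\int[PZA]_w (tauA w ^+ 2))%E in
  vc_class E G U C v ->
  let rate n := Num.sqrt (n%:R * Num.max 1 (ln (ln n%:R))) in
  (forall n, (1 <= n)%N ->
    (\int[Pr nu]_w sup_deviation E p G X n w <= (D v C U tA tnu * rate n)%:E)%E)
  /\
  (forall (delta : R) (n : nat), 0 < delta < 1 -> (1 <= n)%N ->
    ((tau tA tnu ^+ 3)%:E / (U%:E * EA2) <= (n%:R)%:E / (ln n%:R)%:E)%E ->
    ((1 - delta)%:E <= Pr nu [set w | sup_deviation E p G X n w <=
       (K * D v C U tA tnu * rate n)%:E
       + maxe (sqrte ((n%:R * U ^+ 2)%:E * EA2 * (K * ln (K / delta))%:E))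
              ((ln (K / delta))%:E
               * ((tau tA tnu ^+ 3 * U * ln n%:R)%:E / EA1))])%E).
Proof.
(* 128 is the variance factor of [row_norm_deviation]; the other uses of the constant only need it
   to be at least 1. *)
exists 128; split => //; exists (@deviation_const R), (@deviation_tau R); split.
  by move=> tA tnu; rewrite /deviation_tau; case: tail_bound => c rho; rewrite ltr_wpDr.
move=> d E p q b eps nu dO Omega X Pr S delta0 Psi dO' Omega' Z PZnu PZA muA G U C v.
move=> _ dp [M pM] ->{E} bE cE [x0 /interior_subset Ex0] pq b0 eps0 hq _ MF XE SE sm ret _ A muA1 split
  MCnu MCA tauA tA tnu EA1 EA2 GVC rate.
set E := density_support p in bE cE Ex0 XE SE GVC *.
(* The estimates are obtained in [sqrt n]; the iterated logarithm enters through this comparison. *)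
have rate1 n : Num.sqrt n%:R <= rate n by exact: sqrt_le_loglog_rate.
have [c0 rho01 tails] := tail_bound_le (regeneration_tails dp pM bE cE pq b0 eps0 hq MF XE SE sm ret muA1 MCnu MCA).
rewrite -/A -/tauA -/tA -/tnu in c0 rho01 tails.
rewrite /deviation_const /deviation_tau; case: tail_bound c0 rho01 tails => c rho /= c0 rho01 tails.
have [/andP[m1_ge1 m1_le] /andP[m2_ge1 m2_le] er0 EA1E EA2E] :=
  regeneration_moments dp pM bE cE pq b0 eps0 hq MF XE SE sm ret muA1 MCnu MCA c0 rho01 tails.
rewrite /EA1 /EA2 EA1E EA2E.
set m1 := block_m1 _ _ _ in m1_ge1 m1_le EA1E *; set m2 := block_m2 _ _ _ in m2_ge1 m2_le EA2E *.
set D := rate_const _ _ _ _ + _.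
have nb n delta (y : \bar R) : (y <= (128 * D * rate n)%:E)%E ->
    (y <= (128 * D * rate n)%:E + maxe (sqrte ((n%:R * U ^+ 2)%:E * m2%:E * (128 * ln (128 / delta))%:E))
      ((ln (128 / delta))%:E * (((1 + `|8 * mean_bound c rho / (exp_radius c rho * ln 2)|) ^+ 3 *
         U * ln n%:R)%:E / m1%:E)))%E.
  by move=> h; apply: (le_trans h); apply: leeDl; rewrite le_max sqrte_ge0.
have full n delta : 0 < delta -> (forall w, sup_deviation E p G X n w <= (128 * D * rate n)%:E)%E ->
    ((1 - delta)%:E <= Pr nu [set w | (sup_deviation E p G X n w <=
      (128 * D * rate n)%:E + maxe (sqrte ((n%:R * U ^+ 2)%:E * m2%:E * (128 * ln (128 / delta))%:E))
      ((ln (128 / delta))%:E * (((1 + `|8 * mean_bound c rho / (exp_radius c rho * ln 2)|) ^+ 3 *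
         U * ln n%:R)%:E / m1%:E)))%E])%E.
  move=> d0 h; rewrite (_ : [set w | _] = setT); last by apply/seteqP; split => // w _; exact: nb.
  by rewrite [leRHS]probability_setT lee_fin gerBl ltW.
(* Over the empty class the supremum is [-oo], and there is no enumeration. *)
have [G_eq0|/set0P G0] := eqVneq G set0.
  have dev0 n w : sup_deviation E p G X n w = -oo%E by rewrite /sup_deviation G_eq0 image_set0 ereal_sup0.
  split => [n _|delta n /andP[d0 _] _ _].
    by under eq_integral do rewrite dev0; rewrite int_cst leNye.
  by apply: full => // w; rewrite dev0 leNye.
have [e GE] := countable_range (let: And5 cG _ _ _ _ := GVC in cG) G0.
rewrite {}GE {G G0} in GVC full *.
have mE : measurable E by exact: measurable_density_support.
have me i : measurable_fun E (e i).
  by case: GVC => _ /(_ (e i)) h _ _ _; case: h => //; exists i.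
have eU i x : E x -> `|e i x| <= U.
  by case: GVC => _ /(_ (e i)) h _ _ _; case: h => [|_]; [exists i | exact].
have U0 : 0 <= U := le_trans (normr_ge0 _) (eU 0%N _ Ex0).
have [pi piE] : exists pi : probability 'rV[R]_d R, forall B, pi B = (\int[lebesgue_row R d]_(y in B) (p y)%:E)%E.
  by case: dp => mp p0 p1; exact: density_probability.
(* For [U = 0] all functions vanish on [E], and so does the constant [D]; the estimates for the
   regenerative chain assume [U] positive. *)
have [U_eq0|U_neq0] := eqVneq U 0.
  have dev0 n w : sup_deviation E p (range e) X n w = 0%E.
    apply/eqP; rewrite eq_le; apply/andP; split.
      apply: ge_ereal_sup => _ [_ [i _ <-] <-]; rewrite big1 ?normr0// => j _.
      have := restrict_norm_le (eU i) U0 (X j w); have := mean_on_norm_le dp piE mE (me i) (eU i) U0.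
      by rewrite U_eq0 !normr_le0 => /eqP-> /eqP->; rewrite subr0.
    apply: (@le_trans _ _ (`|\sum_(1 <= j < n.+1) ((e 0%N \_ E) (X j w) - mean_on E p (e 0%N))|)%:E).
      by rewrite lee_fin.
    by apply: ereal_sup_ubound; exists (e 0%N) => //; exists 0%N.
  have D0 : D = 0 by rewrite /D /rate_const U_eq0; ring.
  split => [n _|delta n /andP[d0 _] _ _].
    by under eq_integral do rewrite dev0; rewrite int_cst D0 mul0r.
  by apply: full => // w; rewrite dev0 D0 mulr0 mul0r.
have Ugt0 : 0 < U by rewrite lt0r U_neq0.
have Enz : E !=set0 by exists x0.
set D1 := rate_const _ _ _ _ in D nb full *.
have D10 : 0 <= D1.
  apply: rate_const_ge0 => //; [|by apply: le_trans m2_le; lra|by apply: le_trans m1_le; lra].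
  by rewrite mulr_ge0//; exact: (chain_const_ge0 GVC).
have DD1 : 0 <= D1 <= D by rewrite D10 lerDl mulr_ge0.
have D1D n : D1 * Num.sqrt n%:R <= D * rate n.
  by apply: ler_pM; rewrite ?sqrtr_ge0//; case/andP: DD1.
split => [n n0|delta n /andP[d0 d1] n0 _].
  apply: (le_trans (int_sup_deviation_rate dp pM bE cE pq b0 eps0 hq MF XE SE sm ret muA1 MCnu MCA
    c0 rho01 tails Ugt0 Enz GVC n0)).
  by rewrite lee_fin.
have Dr n' : (0 < n')%N -> D <= D * rate n'.
  move=> n'0; rewrite ler_peMr//; first by case/andP: DD1; exact: le_trans.
  by apply: le_trans (rate1 n'); rewrite -[leLHS]sqrtr1 ler_wsqrtr// ler1n.
have D0 : 0 <= D * rate n by apply: le_trans (Dr _ n0); case/andP: DD1; exact: le_trans.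
(* At [n = 1] the logarithm vanishes and cannot dominate the exponential term; the deviation is at
   most [2 * U], hence at most [D]. *)
have [n1|n1] := leqP n 1.
  apply: full => // w.
  have -> : n = 1%N by apply/eqP; rewrite eqn_leq n1.
  apply: (le_trans (sup_deviation1_le dp pM bE cE pq b0 eps0 hq MF XE SE sm ret muA1 MCnu MCA
    Ugt0 GVC w)).
  rewrite lee_fin; have := Dr 1%N isT.
  by rewrite /D; lra.
(* Then [expR (- t)] is [delta / 128], within the allowed probability. *)
set t := ln (128 / delta).
have t0 : 0 < t by rewrite ln_gt0// ltr_pdivlMr// mul1r; lra.
have et : expR (- t) <= delta.
  by rewrite expRN lnK ?posrE ?divr_gt0// invf_div ler_pdivrMr// ler_peMr ?(ltW d0)// ler1n.
rewrite inver gt_eqF ?(lt_le_trans ltr01 m1_ge1)// -!EFinM/= -EFin_max -EFinD.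
apply: (@le_trans _ _ (1 - expR (- t))%:E); first by rewrite lee_fin lerD2l lerN2.
apply: (sup_deviation_concentration dp pM bE cE pq b0 eps0 hq MF XE SE sm ret muA1 MCnu MCA
    c0 rho01 tails Ugt0 Enz GVC n0 t0).
apply: lerD; first by rewrite -mulrA; apply: le_trans (D1D n) _; rewrite ler_peMl// ler1n.
have -> : 128 * U ^+ 2 * block_m2 (S `*` [set true]) Z PZA * n%:R * t = n%:R * U ^+ 2 * m2 * (128 * t).
  by rewrite /m2; ring.
rewrite ge_max !le_max lexx/=; apply/orP; right.
by apply: (exponential_term_le (C2 := mean_bound c rho)) => //; [exact: ltW|rewrite m1_ge1].
Qed.
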